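(* Let $\alpha\in(1,2)$ and let $p\ge2$ be an integer. Then $$\{n^{-\alpha}A_n^{p,\alpha}\}_n\sim_\lambda(f^{p,\alpha},[-\pi,\pi]),\qquad f^{p,\alpha}(\theta)=\sum_{l\in\mathbb Z}|\theta+2l\pi|^{\alpha}\left(\frac{\sin(\theta/2+l\pi)}{\theta/2+l\pi}\right)^{p+1}.$$
   Context: For $n\ge1$: knots $\xi_1=\dots=\xi_{p+1}=0$, $\xi_{i+p+1}=i/n$ ($i=0,\dots,n$), $\xi_{p+n+1}=\dots=\xi_{2p+n+1}=1$. B-splines: $N^0_i=\mathbf 1_{[\xi_i,\xi_{i+1})}$, $N^k_i(x)=\frac{x-\xi_i}{\xi_{i+k}-\xi_i}N^{k-1}_i(x)+\frac{\xi_{i+k+1}-x}{\xi_{i+k+1}-\xi_{i+1}}N^{k-1}_{i+1}(x)$ (zero-denominator fractions are zero). Greville abscissae $\eta_i=\frac{\xi_{i+1}+\dots+\xi_{i+p}}{p}$, $i=2,\dots,n+p-1$. On $[0,1]$: $D^\alpha_{0,x}u(x)=\frac{1}{\Gamma(2-\alpha)}\frac{d^2}{dx^2}\int_0^x(x-y)^{1-\alpha}u(y)dy$, $D^\alpha_{x,1}u(x)=\frac{1}{\Gamma(2-\alpha)}\frac{d^2}{dx^2}\int_x^1(y-x)^{1-\alpha}u(y)dy$. The B-spline collocation matrix (Greville collocation of the Riesz operator $\frac{1}{2\cos(\pi\alpha/2)}(D^\alpha_{0,x}+D^\alpha_{x,1})$ on the spline space spanned by $N^p_2,\dots,N^p_{n+p-1}$)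 is $A_n^{p,\alpha}=\frac{1}{2\cos(\pi\alpha/2)}(A_n^L+A_n^R)$ with $(A_n^L)_{i,j}=D^\alpha_{0,x}N^p_{j+1}(\eta_{i+1})$, $(A_n^R)_{i,j}=D^\alpha_{x,1}N^p_{j+1}(\eta_{i+1})$, $i,j=1,\dots,n+p-2$. A sequence $\{A_n\}_n$ of matrices of sizes $d_n$ ($d_n<d_{n+1}$) with eigenvalues $\lambda_j(A_n)$ satisfies $\{A_n\}_n\sim_\lambda(f,G)$ (for measurable $f:G\to\mathbb C$, $G\subset\mathbb R^k$ of finite positive measure $\mu_k(G)$) if for every continuous compactly supported $F:\mathbb C\to\mathbb C$, $\lim_{n\to\infty}\frac1{d_n}\sum_{j=1}^{d_n}F(\lambda_j(A_n))=\frac{1}{\mu_k(G)}\int_G F(f(t))\,dt$. *)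

(* Defs.v *)
From HB Require Import structures.
From mathcomp Require Import all_boot all_order all_algebra.
From mathcomp Require Import all_classical all_reals all_analysis.
From mathcomp Require Import complex.

Set Implicit Arguments.
Unset Strict Implicit.
Unset Printing Implicit Defensive.

Import Order.TTheory GRing.Theory Num.Theory.
Import numFieldNormedType.Exports.
Local Open Scope classical_set_scope.
Local Open Scope ring_scope.

Section Defs.
Variable R : realType.

Definition Gamma (s : R) : R :=
  Rintegral (@lebesgue_measure R) `[0, +oo[%classic
    (fun t => powR t (s - 1) * expR (- t)).

Definition fracz (a b : R) : R := if b == 0 then 0 else a / b.

(* knots xi_1 .. xi_{2p+n+1} (1-based; values outside this range are
   extended by the same formula and are never used):
   xi_i = 0 for i <= p+1, xi_{i+p+1} = i/n (0<=i<=n), xi_i = 1 for i >= p+n+1 *)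
Definition knot (p n i : nat) : R :=
  if (i <= p.+1)%N then 0
  else if (i <= p + n + 1)%N then (i - p.+1)%N%:R / n%:R
  else 1.

(* B-splines N^k_i (Cox-de Boor recursion) *)
Fixpoint bspline (p n k i : nat) (x : R) {struct k} : R :=
  match k with
  | 0 => if (knot p n i <= x) && (x < knot p n i.+1) then 1 else 0
  | k'.+1 =>
      fracz (x - knot p n i) (knot p n (i + k) - knot p n i)
        * bspline p n k' i x
      + fracz (knot p n (i + k + 1) - x) (knot p n (i + k + 1) - knot p n i.+1)
        * bspline p n k' i.+1 x
  end.

Definition greville (p n i : nat) : R :=
  (\sum_(1 <= k < p.+1) knot p n (i + k)) / p%:R.

(* left and right Riemann-Liouville fractional derivatives on [0,1],
   1 < alpha < 2 *)
Definition RL_left (alpha : R) (u : R -> R) (x : R) : R :=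
  (Gamma (2 - alpha))^-1 *
  derive1n 2 (fun z => Rintegral (@lebesgue_measure R) `[0, z]%classic
                         (fun y => powR (z - y) (1 - alpha) * u y)) x.

Definition RL_right (alpha : R) (u : R -> R) (x : R) : R :=
  (Gamma (2 - alpha))^-1 *
  derive1n 2 (fun z => Rintegral (@lebesgue_measure R) `[z, 1]%classic
                         (fun y => powR (y - z) (1 - alpha) * u y)) x.

(* The collocation matrix A_n^{p,alpha}, of size n+p-2, with
   0-based indices: (A)_{i,j} (1-based) corresponds to i' = i-1, j' = j-1,
   so the entry is D N^p_{j'+2}(eta_{i'+2}). *)
Definition colloc_matrix (p : nat) (alpha : R) (n : nat) : 'M[R]_(n + p - 2) :=
  \matrix_(i, j)
    ((2 * cos (pi * alpha / 2))^-1 *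
     (RL_left alpha (bspline p n p (j.+2)) (greville p n i.+2)
      + RL_right alpha (bspline p n p (j.+2)) (greville p n i.+2))).

(* eigenvalues (with algebraic multiplicity) of a real square matrix,
   as complex numbers: the roots of its characteristic polynomial *)
Definition eigenvalues (d : nat) (A : 'M[R]_d) : seq R[i] :=
  sval (closed_field_poly_normal (char_poly (map_mx (real_complex R) A))).

Definition cmod (z : R[i]) : R := Num.sqrt (complex.Re z ^+ 2 + complex.Im z ^+ 2).

Definition test_function (F : R[i] -> R[i]) : Prop :=
  (forall z (e : R), 0 < e -> exists2 d : R, 0 < d &
      forall w, cmod (w - z) < d -> cmod (F w - F z) < e)
  /\ (exists M : R, forall z, M < cmod z -> F z = 0).

(* {A_n}_n ~_lambda (f, G) for G a subset of R (k = 1) of finite positive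
   Lebesgue measure, A_n of size d n with d strictly increasing. *)
Definition spectral_distribution (d : nat -> nat) (A : forall n, 'M[R]_(d n))
  (f : R -> R) (G : set R) : Prop :=
  (forall n, (d n < d n.+1)%N) /\
  forall F : R[i] -> R[i], test_function F ->
    let avg n := (d n)%:R^-1 *: \sum_(z <- eigenvalues (A n)) F z in
    let muG := fine (@lebesgue_measure R G) in
    ((fun n => complex.Re (avg n)) @ \oo -->
       (muG^-1 * Rintegral (@lebesgue_measure R) G
                   (fun t => complex.Re (F (real_complex R (f t)))) : R))
    /\
    ((fun n => complex.Im (avg n)) @ \oo -->
       (muG^-1 * Rintegral (@lebesgue_measure R) G
                   (fun t => complex.Im (F (real_complex R (f t)))) : R)).

(* the symbol f^{p,alpha}(theta) = sum_{l in Z} |theta+2l pi|^alpha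
   (sin(theta/2 + l pi)/(theta/2 + l pi))^(p+1); the (absolutely convergent)
   sum over Z is taken as sum over l >= 0 of the terms for l and -(l+1). *)
Definition symbol_term (p : nat) (alpha theta : R) (l : int) : R :=
  powR `|theta + 2 * l%:~R * pi| alpha *
  (sin (theta / 2 + l%:~R * pi) / (theta / 2 + l%:~R * pi)) ^+ p.+1.

Definition symbol (p : nat) (alpha theta : R) : R :=
  limn (series (fun l : nat =>
     symbol_term p alpha theta (Posz l) + symbol_term p alpha theta (Negz l))).

End Defs.

(* Main.v *)
Require Import Defs.
From HB Require Import structures.
From mathcomp Require Import all_boot all_order all_algebra.
From mathcomp Require Import all_classical all_reals all_analysis.
From mathcomp Require Import complex measurable_realfun.
From mathcomp Require Import ring lra zify.

(** Put s = 2 - alpha.  After rescaling by n, the B-splines take finitely many shapes, and the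
    entry (i, j) of n^(-alpha) A_n is a value of the Riemann-Liouville derivatives of such a
    shape at a point within bounded distance of i - j, so it is O((1 + |i - j|)^(-2)).  Away
    from O(p) boundary rows and columns all splines are translates of the cardinal B-spline,
    whose fractional derivative is an iterated backward difference of a truncated power; the
    matrix is there exactly the symmetric Toeplitz matrix of a_k = (1/pi) int_0^oo g(w) cos(k w) dw
    with g(w) = w^alpha (2 sin(w/2) / w)^(p+1).  This Fourier representation reduces to
    p = 2 by integrating in the shift parameter, and there to
    int_0^oo w^(-1-s) sin w dw = pi / (2 s Gamma(s) cos(pi s / 2)), obtained from
    int_0^oo t^s / (1 + t^2) dt and the cosine series of cos(q x) at x = 0.
    Unfolding g over the periods of cos(k w) shows that the a_k are the Fourier coefficients of
    the symbol.

    Hence the normalized traces of powers converge to the moments of the symbol, while the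
    antisymmetric part is small in mean square.  By Schur triangularization the imaginary parts
    of the eigenvalues are then small in mean square, and a polynomial approximation turns
    moments into the eigenvalue distribution. *)

Set Implicit Arguments.
Unset Strict Implicit.
Unset Printing Implicit Defensive.

Import Order.TTheory GRing.Theory Num.Theory.
Import numFieldNormedType.Exports.
Local Open Scope classical_set_scope.
Local Open Scope ring_scope.

(** * Polynomial approximation *)

(** Power sums of the eigenvalues only see polynomials in the eigenvalue, and these do not
    approximate continuous functions on the plane; since the collocation matrix is not symmetric,
    this gap is real. An error term quadratic in the imaginary part closes it, which is why the
    antisymmetric part need only be small in mean square. The boundary perturbation is not small in
    norm: what counts is that the sum of the moduli of its entries stays bounded while the size
    grows.

    Boundary splines have repeated knots, and a fractional derivative may fail to exist at a
    collocation point, where [derive1n] returns a default. Entry bounds therefore rest on no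
    smoothness of the splines: near the support there are finitely many pairs of a shape and a grid
    point, and beyond the support the kernel is smooth.

    The decay of [a_k] is not read off its integral: [a_k] is an entry of a large enough matrix and
    inherits the entry bound. The sine integral is evaluated in closed form because [Gamma] and the
    cosine of the Riesz normalization have to cancel exactly. *)

Section CompactModulus.
Variables (R : realType) (T : topologicalType).

(** Near a zero of [phi] the term [e] absorbs [u]; near any other point [phi] stays away from 0 and
    a large [C] wins. Compactness gives one [C]. With [phi] a difference of values at two points
    this replaces a modulus of continuity; with [phi] the imaginary part it yields the off-axis
    error. *)
Lemma compact_modulus (K : set T) (u phi : T -> R) :
  compact K ->
  (forall z, K z -> continuous_at z u) ->
  (forall z, K z -> continuous_at z phi) ->
  (forall z, K z -> phi z = 0 -> u z = 0) ->
  forall e, 0 < e ->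
  exists2 C : R, 0 <= C & forall z, K z -> `|u z| <= e + C * phi z ^+ 2.
Proof.
move=> cK cu cphi u0 e e0.
have /compact_near_coveringP cov := cK.
have : \forall C \near +oo, K `<=` (fun z => `|u z| <= e + C * phi z ^+ 2).
  apply: (cov R (pinfty_nbhs R) (fun C z => `|u z| <= e + C * phi z ^+ 2)) => z Kz.
  have cuz : u x @[x --> z] --> u z by exact: cu.
  have cpz : phi x @[x --> z] --> phi z by exact: cphi.
  have [p0|p0] := eqVneq (phi z) 0.
    have uz : u z = 0 by exact: u0.
    move/cvgrPdist_lt: cuz => /(_ e e0) H.
    exists (([set x | `|u z - u x| < e]), [set C : R | 0 <= C]).
      by split => //; exists 0; split => // x /ltW.
    move=> [x C] /= [H1 C0]; rewrite uz sub0r normrN in H1.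
    by rewrite (le_trans (ltW H1))// lerDl mulr_ge0// sqr_ge0.
  have q0 : 0 < `|phi z| / 2 by rewrite divr_gt0// normr_gt0.
  move/cvgrPdist_lt: cpz => /(_ _ q0) H1.
  move/cvgrPdist_lt: cuz => /(_ _ ltr01) H2.
  (* Nearby [|u|] is at most [|u z| + 1] and [|phi|] at least [|phi z| / 2], so [D], and any larger
     constant, dominates. *)
  set D := (`|u z| + 1) / (`|phi z| / 2) ^+ 2.
  exists ([set x | `|phi z - phi x| < `|phi z| / 2] `&` [set x | `|u z - u x| < 1],
          [set C : R | D <= C]).
    split; first by apply: filterI.
    by exists D; split; [exact: num_real | move=> x /ltW].
  move=> [x C] /= [[h1 h2] DC].
  have a1 : `|u x| <= `|u z| + 1.
    have -> : u x = u z - (u z - u x) by rewrite opprB addrC subrK.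
    by rewrite (le_trans (ler_normB _ _))// lerD2l ltW.
  have a2 : `|phi z| / 2 <= `|phi x|.
    have : `|phi z| <= `|phi z - phi x| + `|phi x|.
      by rewrite -{1}(subrK (phi x) (phi z)) ler_normD.
    move: h1; lra.
  have a3 : `|u z| + 1 = D * (`|phi z| / 2) ^+ 2.
    by rewrite divfK// expf_neq0// gt_eqF.
  have a4 : D * (`|phi z| / 2) ^+ 2 <= C * phi x ^+ 2.
    rewrite ler_pM//; first by rewrite divr_ge0// ?addr_ge0// sqr_ge0.
    by rewrite -(real_normK (num_real (phi x))) lerXn2r// nnegrE// ltW.
  by rewrite (le_trans a1)// a3 (le_trans a4)// lerDr ltW.
move=> [M [_ HM]]; exists (Num.max 0 M + 1).
  by rewrite addr_ge0// le_max lexx.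
move=> z Kz; apply: (HM (Num.max 0 M + 1)) => //.
by rewrite ltr_pwDr// le_max lexx orbT.
Qed.

End CompactModulus.

Section Bernstein.
Variable R : realType.

(** Expectation of [g] at a binomial variable with [n] trials and success probability ['X],
    conditioned on the first trial. With unscaled nodes and no binomial coefficients, monotonicity
    and second moments are plain inductions. *)
Fixpoint bernstein (n : nat) (g : nat -> R) : {poly R} :=
  if n is n'.+1 then 'X * bernstein n' (g \o succn) + (1 - 'X) * bernstein n' g
  else (g 0%N)%:P.

Lemma le_bernstein n (g g' : nat -> R) x : 0 <= x <= 1 ->
  (forall k, (k <= n)%N -> g k <= g' k) ->
  (bernstein n g).[x] <= (bernstein n g').[x].
Proof.
move=> /andP[x0 x1]; elim: n g g' => [|n IH] g g' gg'.
  by rewrite /= !hornerC gg'.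
rewrite /= !hornerE lerD// ler_wpM2l ?subr_ge0//; apply: IH => k kn.
  exact: gg'.
by apply: gg'; exact: leqW.
Qed.

(** Mean [n x] and variance [n x (1 - x)] of the binomial law. The offset [c] serves the induction,
    where a success replaces [c] by [c + 1]. *)
Lemma bernstein_quadratic n (c e K x : R) :
  (bernstein n (fun k => e + K * (k%:R + c) ^+ 2)).[x] =
  e + K * (n%:R * x * (1 - x) + (n%:R * x + c) ^+ 2).
Proof.
elim: n c => [|n IH] c; first by rewrite /= hornerC; ring.
rewrite /= !hornerE IH.
have -> : bernstein n ((fun k => e + K * (k%:R + c) ^+ 2) \o succn) =
    bernstein n (fun k => e + K * (k%:R + (c + 1)) ^+ 2).
  by congr bernstein; apply/funext => k /=; rewrite -natr1; congr (_ + _ * _ ^+ 2); ring.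
by rewrite IH -natr1; ring.
Qed.

(** Bernstein's argument, with the modulus of continuity replaced by [e / 2 + C (phi z - phi z')^2],
    so that only the binomial variance matters. Polynomials in [phi], through which [h] factors,
    cover ordinary polynomials and polynomials in the cosine at once. *)
Lemma weierstrass_along (T : topologicalType) (K : set T) (h phi : T -> R) :
  compact K ->
  (forall z, K z -> continuous_at z h) ->
  (forall z, K z -> continuous_at z phi) ->
  (forall z, K z -> 0 <= phi z <= 1) ->
  (forall u, 0 <= u <= 1 -> exists2 z, K z & phi z = u) ->
  (forall z z', K z -> K z' -> phi z = phi z' -> h z = h z') ->
  forall e, 0 < e -> exists q : {poly R}, forall z, K z -> `|h z - q.[phi z]| < e.
Proof.
move=> cK ch cphi phi01 phis inj e e0.
have e2 : 0 < e / 2 by rewrite divr_gt0.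
have [C C0 HC] : exists2 C : R, 0 <= C & forall z : T * T, (K `*` K) z ->
    `|h z.1 - h z.2| <= e / 2 + C * (phi z.1 - phi z.2) ^+ 2.
  apply: (@compact_modulus R (T * T)%type (K `*` K) (fun z => h z.1 - h z.2)
    (fun z => phi z.1 - phi z.2)) => //.
  - exact: compact_setX.
  - move=> [x y] [/= Kx Ky]; apply: cvgB.
      by apply: (@cvg_comp _ _ _ fst h _ (nbhs x)); [exact: cvg_fst|exact: ch].
    by apply: (@cvg_comp _ _ _ snd h _ (nbhs y)); [exact: cvg_snd|exact: ch].
  - move=> [x y] [/= Kx Ky]; apply: cvgB.
      by apply: (@cvg_comp _ _ _ fst phi _ (nbhs x)); [exact: cvg_fst|exact: cphi].
    by apply: (@cvg_comp _ _ _ snd phi _ (nbhs y)); [exact: cvg_snd|exact: cphi].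
  - by move=> [x y] [/= Kx Ky] /subr0_eq /inj ->//; rewrite subrr.
(* The variance of the nodes contributes at most [C / n] to the error; this [n] makes it less than
   [e / 2]. *)
pose n := (Num.truncn (2 * C / e)).+1.
have n0 : 0 < n%:R :> R by rewrite ltr0n.
have Cn : C / n%:R < e / 2.
  rewrite ltr_pdivrMr// mulrC -ltr_pdivrMr//.
  have -> : C / (e / 2) = 2 * C / e by field; rewrite gt_eqF.
  by rewrite /n; apply: truncnS_gt.
have /choice[t Ht] : forall k : nat, exists z, (k <= n)%N -> K z /\ phi z = k%:R / n%:R.
  move=> k; have [kn|kn] := leqP k n; last first.
    have [|z _ _] := phis 0; first by rewrite lexx ler01.
    by exists z.
  have [|z Kz pz] := phis (k%:R / n%:R); last by exists z.
  by rewrite divr_ge0//= ler_pdivrMr// mul1r ler_nat.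
exists (bernstein n (h \o t)) => z Kz.
have /andP[p0 p1] := phi01 _ Kz.
set x := phi z in p0 p1 *.
have key k : (k <= n)%N -> `|h z - h (t k)| <= e / 2 + C / n%:R ^+ 2 * (k%:R - n%:R * x) ^+ 2.
  move=> kn; have [Kt pt] := Ht k kn.
  apply: (le_trans (HC (z, t k) _)) => //=.
  rewrite pt lerD2l -/x le_eqVlt; apply/orP; left; apply/eqP.
  by field; rewrite gt_eqF.
have fin c K' : (bernstein n (fun k => c + K' / n%:R ^+ 2 * (k%:R - n%:R * x) ^+ 2)).[x] =
    c + K' / n%:R * (x * (1 - x)).
  by rewrite (bernstein_quadratic n (- (n%:R * x))); field; rewrite gt_eqF.
have x1 : x * (1 - x) <= 1 by nra.
have x1' : 0 <= x * (1 - x) by rewrite mulr_ge0// subr_ge0.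
have x01 : 0 <= x <= 1 by rewrite p0 p1.
have bd : C / n%:R * (x * (1 - x)) < e / 2.
  by rewrite (le_lt_trans _ Cn)// ler_piMr// divr_ge0.
have up : (bernstein n (h \o t)).[x] <= h z + e / 2 + C / n%:R * (x * (1 - x)).
  rewrite -fin; apply: le_bernstein => // k /key /=; rewrite ler_norml; lra.
have lo : h z - e / 2 + (- C) / n%:R * (x * (1 - x)) <= (bernstein n (h \o t)).[x].
  by rewrite -fin; apply: le_bernstein => // k /key /=; rewrite ler_norml mulNr; lra.
rewrite mulNr in lo.
by rewrite ltr_norml; lra.
Qed.

Lemma weierstrass (a b : R) (f : R -> R) : a < b ->
  (forall x, a <= x <= b -> continuous_at x f) ->
  forall e, 0 < e -> exists q : {poly R}, forall x, a <= x <= b -> `|f x - q.[x]| < e.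
Proof.
move=> ab cf e e0; have ba : 0 < b - a by rewrite subr_gt0.
have [q Hq] : exists q : {poly R}, forall x, `[a, b]%classic x ->
    `|f x - q.[(b - a)^-1 * (x - a)]| < e.
  apply: (weierstrass_along (phi := fun x => (b - a)^-1 * (x - a))) => //.
  - exact: segment_compact.
  - move=> z _; apply: cvgMr; apply: cvgB; [exact: cvg_id|exact: cvg_cst].
  - move=> z; rewrite /= in_itv /= => /andP[az zb].
    apply/andP; split; first by rewrite mulr_ge0// ?invr_ge0 ?subr_ge0// ltW.
    by rewrite mulrC ler_pdivrMr// mul1r lerD2r.
  - move=> u /andP[u0 u1]; exists (a + u * (b - a)).
      have h1 : 0 <= u * (b - a) by rewrite mulr_ge0// ltW.
      have h2 : u * (b - a) <= 1 * (b - a) by rewrite ler_pM2r.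
      by rewrite /= in_itv /=; apply/andP; split; lra.
    by rewrite addrAC subrr add0r mulrC mulfK// gt_eqF.
  - move=> z z' _ _ /mulfI H; suff -> : z = z' by [].
    by apply: (addIr (- a)); apply: H; rewrite invr_eq0 gt_eqF.
exists (q \Po ((b - a)^-1 *: ('X - a%:P))) => x xab.
by rewrite horner_comp !hornerE; apply: Hq; rewrite /= in_itv.
Qed.

End Bernstein.

(** * Interval integrals and cosine uniqueness *)

Section IntervalIntegral.
Variable R : realType.
Local Notation mu := (@lebesgue_measure R).
Implicit Types (f g F : R -> R) (a b c : R).

(** Two-sided continuity, also at the end points: it is preserved by pointwise algebra without any
    subspace topology and implies continuity within the segment. *)
Definition cont_on a b f := forall x, a <= x <= b -> continuous_at x f.

Lemma cont_on_within a b f : cont_on a b f -> {within `[a, b], continuous f}.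
Proof.
move=> cf; apply: continuous_in_subspaceT => x.
by rewrite inE /= in_itv /= => /cf.
Qed.

Lemma cont_on_integrable a b f : cont_on a b f ->
  mu.-integrable `[a, b] (EFin \o f).
Proof.
move=> cf; apply: continuous_compact_integrable; first exact: segment_compact.
exact: cont_on_within.
Qed.

Lemma cont_onD a b f g : cont_on a b f -> cont_on a b g ->
  cont_on a b (fun x => f x + g x).
Proof. by move=> cf cg x xab; apply: cvgD; [exact: cf|exact: cg]. Qed.

Lemma cont_onB a b f g : cont_on a b f -> cont_on a b g ->
  cont_on a b (fun x => f x - g x).
Proof. by move=> cf cg x xab; apply: cvgB; [exact: cf|exact: cg]. Qed.

Lemma cont_onM a b f g : cont_on a b f -> cont_on a b g ->
  cont_on a b (fun x => f x * g x).
Proof. by move=> cf cg x xab; apply: cvgM; [exact: cf|exact: cg]. Qed.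

Lemma cont_on_cst a b c : cont_on a b (fun=> c).
Proof. by move=> x _; exact: cvg_cst. Qed.

Lemma cont_on_continuous a b f : continuous f -> cont_on a b f.
Proof. by move=> cf x _; exact: cf. Qed.

Lemma cont_onX a b f n : cont_on a b f -> cont_on a b (fun x => f x ^+ n).
Proof.
move=> cf; elim: n => [|n IH]; first exact: cont_on_cst.
by under eq_fun do rewrite exprS; exact: cont_onM.
Qed.

Lemma cont_on_horner a b f (q : {poly R}) : cont_on a b f ->
  cont_on a b (fun x => q.[f x]).
Proof.
move=> cf; elim/poly_ind: q => [|q c IH].
  by under eq_fun do rewrite horner0; exact: cont_on_cst.
under eq_fun do rewrite hornerMXaddC.
by apply: cont_onD; [exact: cont_onM|exact: cont_on_cst].
Qed.

Lemma cont_on_sum a b n (f : nat -> R -> R) : (forall i, cont_on a b (f i)) ->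
  cont_on a b (fun x => \sum_(i < n) f i x).
Proof.
move=> cf; elim: n => [|n IH].
  by under eq_fun do rewrite big_ord0; exact: cont_on_cst.
under eq_fun do rewrite big_ord_recr /=.
exact: cont_onD.
Qed.

Lemma continuous_cosM (k : R) : continuous (fun x => cos (k * x)).
Proof.
move=> x; apply: (@continuous_comp _ _ _ (fun x => k * x) (@cos R)).
  by apply: cvgMr; exact: cvg_id.
exact: continuous_cos.
Qed.

Lemma RintD a b f g : cont_on a b f -> cont_on a b g ->
  \int[mu]_(x in `[a, b]) (f x + g x) =
  \int[mu]_(x in `[a, b]) f x + \int[mu]_(x in `[a, b]) g x.
Proof. by move=> cf cg; apply: RintegralD => //; exact: cont_on_integrable. Qed.

Lemma RintB a b f g : cont_on a b f -> cont_on a b g ->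
  \int[mu]_(x in `[a, b]) (f x - g x) =
  \int[mu]_(x in `[a, b]) f x - \int[mu]_(x in `[a, b]) g x.
Proof. by move=> cf cg; apply: RintegralB => //; exact: cont_on_integrable. Qed.

Lemma RintZl a b c f : cont_on a b f ->
  \int[mu]_(x in `[a, b]) (c * f x) = c * \int[mu]_(x in `[a, b]) f x.
Proof. by move=> cf; apply: RintegralZl => //; exact: cont_on_integrable. Qed.

Lemma Rint_le a b f g : cont_on a b f -> cont_on a b g ->
  (forall x, a <= x <= b -> f x <= g x) ->
  \int[mu]_(x in `[a, b]) f x <= \int[mu]_(x in `[a, b]) g x.
Proof.
by move=> cf cg fg; apply: le_Rintegral => //; exact: cont_on_integrable.
Qed.

Lemma Rint_cst a b c : a <= b -> \int[mu]_(x in `[a, b]) (fun=> c) x = c * (b - a).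
Proof.
move=> ab; rewrite Rintegral_cst//= lebesgue_measure_itv /= lte_fin.
by move: ab; rewrite le_eqVlt => /predU1P[->|ab]; rewrite ?ltxx ?ab//= subrr.
Qed.

Lemma Rint_norm_le a b f (M : R) : a <= b -> cont_on a b f ->
  (forall x, a <= x <= b -> `|f x| <= M) ->
  `|\int[mu]_(x in `[a, b]) f x| <= M * (b - a).
Proof.
move=> ab cf fM; rewrite ler_norml -mulNr -!Rint_cst//.
by apply/andP; split; apply: Rint_le => //; try exact: cont_on_cst;
  move=> x /fM; rewrite ler_norml => /andP[].
Qed.

Lemma Rint_sum a b n (f : nat -> R -> R) : (forall i, cont_on a b (f i)) ->
  \int[mu]_(x in `[a, b]) (\sum_(i < n) f i x) =
  \sum_(i < n) \int[mu]_(x in `[a, b]) f i x.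
Proof.
move=> cf; elim: n => [|n IH].
  rewrite big_ord0; under eq_Rintegral do rewrite big_ord0.
  by rewrite /Rintegral integral0.
rewrite big_ord_recr /= -IH; under [LHS]eq_Rintegral do rewrite big_ord_recr /=.
by rewrite RintD//; exact: cont_on_sum.
Qed.

Lemma Rint_split a b c f : a <= b -> b <= c -> cont_on a c f ->
  \int[mu]_(x in `[a, c]) f x =
  \int[mu]_(x in `[a, b]) f x + \int[mu]_(x in `[b, c]) f x.
Proof.
move=> ab bc cf; have If := cont_on_integrable cf.
have := @Rintegral_itvB R f (BLeft a) (BRight c) b If.
rewrite !bnd_simp => /(_ ab bc) H.
rewrite -(Rintegral_itv_obnd_cbnd (r := b)) -?H; first by rewrite addrC subrK.
by apply: integrableS If => //; apply: subset_itvr; rewrite bnd_simp.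
Qed.

Lemma Rint_FTC a b f F : a <= b -> cont_on a b f ->
  (forall x, a <= x <= b -> is_derive x 1 F (f x)) ->
  \int[mu]_(x in `[a, b]) f x = F b - F a.
Proof.
rewrite le_eqVlt => /predU1P[<- _ _|ab cf dF].
  by rewrite subrr /Rintegral set_itv1 integral_set1.
have cF x : a <= x <= b -> continuous_at x F.
  move=> /dF dx; apply: differentiable_continuous.
  by apply/derivable1_diffP; apply: (@ex_derive _ _ _ _ _ _ _ dx).
rewrite /Rintegral (@continuous_FTC2 _ _ F)//.
- exact: cont_on_within.
- split.
  + move=> x; rewrite in_itv /= => /andP[ax xb].
    by apply: (@ex_derive _ _ _ _ _ _ _ (dF x _)); rewrite !ltW.
  + by apply: cvg_at_right_filter; apply: cF; rewrite lexx ltW.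
  + by apply: cvg_at_left_filter; apply: cF; rewrite lexx ltW.
- move=> x; rewrite in_itv /= => /andP[ax xb].
  by rewrite derive1E; apply: (@derive_val _ _ _ _ _ _ _ (dF x _)); rewrite !ltW.
Qed.

Lemma Rint_eq0 a b f : a < b -> cont_on a b f ->
  (forall x, a <= x <= b -> 0 <= f x) ->
  \int[mu]_(x in `[a, b]) f x = 0 -> forall x, a <= x <= b -> f x = 0.
Proof.
move=> ab cf f0 I0 x xab; apply/eqP/negPn/negP => fx0.
have fx : 0 < f x / 2 by rewrite divr_gt0// lt_neqAle eq_sym fx0 f0.
have /cvgrPdist_lt/(_ _ fx) := cf x xab.
move=> /nbhs_ballP[d /= d0 Hd].
move/andP: (xab) => [ax xb].
pose u := Num.max a (x - d / 2); pose v := Num.min b (x + d / 2).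
have au : a <= u by rewrite le_max lexx.
have vb : v <= b by rewrite ge_min lexx.
have uv : u < v.
  by rewrite /u /v lt_min !gt_max ab /=; apply/andP; split; lra.
have dux : x - d / 2 <= u by rewrite le_max lexx orbT.
have dvx : v <= x + d / 2 by rewrite ge_min lexx orbT.
have big y : u <= y <= v -> f x / 2 <= f y.
  move=> /andP[uy yv]; have : `|f x - f y| < f x / 2.
    by apply: Hd; rewrite /ball /= ltr_norml; lra.
  by rewrite ltr_norml; lra.
have cfS c d' : a <= c -> d' <= b -> cont_on c d' f.
  by move=> ac db y /andP[cy yd]; apply: cf; lra.
have nn c d' : a <= c -> c <= d' -> d' <= b -> 0 <= \int[mu]_(x in `[c, d']) f x.
  move=> ac cd db; apply: Rintegral_ge0 => y; rewrite /= in_itv /= => /andP[cy yd].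
  by apply: f0; lra.
have : f x / 2 * (v - u) <= \int[mu]_(y in `[u, v]) f y.
  rewrite -Rint_cst; last exact: ltW.
  by apply: Rint_le => //; [exact: cont_on_cst|exact: cfS].
have : 0 < f x / 2 * (v - u) by rewrite mulr_gt0// subr_gt0.
have := nn a u (lexx _) au (ltW (lt_le_trans uv vb)).
have := nn v b (le_trans au (ltW uv)) vb (lexx _).
move: I0; rewrite (Rint_split au (ltW (lt_le_trans uv vb)))//.
rewrite (Rint_split (ltW uv) vb); last exact: cfS.
clearbody u v; clear -x; lra.
Qed.

End IntervalIntegral.

Section CosineUniqueness.
Variable R : realType.
Local Notation mu := (@lebesgue_measure R).

(** Product-to-sum formulas turn orthogonality to all [cos (k x)] into orthogonality to all
    polynomials in [cos x]. As the cosine is injective on [[0, pi]], such polynomials approximate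
    [h] uniformly, and then the integral of [h ^ 2] is at most [e] times that of [|h|]. *)
Lemma cosine_uniqueness (h : R -> R) : cont_on 0 pi h ->
  (forall k : nat, \int[mu]_(x in `[0, pi]) (h x * cos (k%:R * x)) = 0) ->
  forall x, 0 <= x <= pi -> h x = 0.
Proof.
move=> ch hk; have pi0 := pi_gt0 R.
have ccos k : cont_on 0 pi (fun x : R => cos (k * x)).
  by apply: cont_on_continuous; exact: continuous_cosM.
have ccos1 : cont_on 0 pi (@cos R).
  by apply: cont_on_continuous; exact: continuous_cos.
have P m k : \int[mu]_(x in `[0, pi]) (h x * cos x ^+ m * cos (k%:R * x)) = 0.
  elim: m k => [|m IH] k.
    by rewrite -[RHS](hk k); apply: eq_Rintegral => x _; rewrite expr0 mulr1.
  have cm : cont_on 0 pi (fun x : R => h x * cos x ^+ m).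
    by apply: cont_onM => //; exact: cont_onX.
  case: k => [|k].
    rewrite -[RHS](IH 1%N); apply: eq_Rintegral => x _.
    by rewrite mul0r cos0 mul1r exprSr mulr1 mulrA.
  transitivity (\int[mu]_(x in `[0, pi]) (2^-1 * (h x * cos x ^+ m * cos (k.+2%:R * x)
     + h x * cos x ^+ m * cos (k%:R * x)))).
    apply: eq_Rintegral => x _.
    have -> : k.+2%:R * x = k.+1%:R * x + x by rewrite -natr1; ring.
    have -> : k%:R * x = k.+1%:R * x - x by rewrite -natr1; ring.
    by rewrite cosD cosB exprS; field.
  rewrite RintZl; last by apply: cont_onD; exact: cont_onM.
  by rewrite RintD ?IH ?addr0 ?mulr0//; exact: cont_onM.
have Q (q : {poly R}) : \int[mu]_(x in `[0, pi]) (h x * q.[cos x]) = 0.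
  under eq_Rintegral do rewrite horner_coef mulr_sumr.
  rewrite (@Rint_sum R 0 pi _ (fun i x => h x * (q`_i * cos x ^+ i))); last first.
    by move=> i; do 2?apply: cont_onM => //; [exact: cont_on_cst|exact: cont_onX].
  rewrite big1// => i _.
  transitivity (\int[mu]_(x in `[0, pi]) (q`_i * (h x * cos x ^+ i))).
    by apply: eq_Rintegral => x _; ring.
  rewrite RintZl; last by apply: cont_onM => //; exact: cont_onX.
  rewrite -[X in _ * X](_ : \int[mu]_(x in `[0, pi]) (h x * cos x ^+ i * cos (0%:R * x)) = _).
    by rewrite P mulr0.
  by apply: eq_Rintegral => x _; rewrite mul0r cos0 mulr1.
have chn : cont_on 0 pi (fun x => `|h x|) by move=> x /ch hx; exact: cvg_norm.
set B := \int[mu]_(x in `[0, pi]) `|h x|.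
have B0 : 0 <= B by apply: Rintegral_ge0.
have chh : cont_on 0 pi (fun x => h x * h x) by exact: cont_onM.
have key e : 0 < e -> \int[mu]_(x in `[0, pi]) (h x * h x) <= e * B.
  move=> e0.
  have [q Hq] : exists q : {poly R}, forall z, `[0, pi]%classic z ->
      `|h z - q.[(1 - cos z) / 2]| < e.
    apply: (weierstrass_along (phi := fun x => (1 - cos x) / 2)) => //.
    - exact: segment_compact.
    - move=> z _; apply: cvgMl; apply: cvgB; first exact: cvg_cst.
      exact: continuous_cos.
    - by move=> z _; have := cos_geN1 z; have := cos_le1 z; lra.
    - move=> u u01; exists (acos (1 - 2 * u)).
        by rewrite /= in_itv /= acos_ge0 ?acos_lepi//; lra.
      by rewrite acosK ?in_itv /=; lra.
    - move=> z z' Hz Hz' E; suff -> : z = z' by [].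
      move: Hz Hz'; rewrite /= !in_itv /= => Hz Hz'.
      by apply: cos_inj; rewrite ?in_itv//; lra.
  have cq : cont_on 0 pi (fun x : R => q.[(1 - cos x) / 2]).
    apply: cont_on_horner; apply: cont_onM; last exact: cont_on_cst.
    by apply: cont_onB => //; exact: cont_on_cst.
  have -> : \int[mu]_(x in `[0, pi]) (h x * h x) =
      \int[mu]_(x in `[0, pi]) (h x * (h x - q.[(1 - cos x) / 2])).
    have := Q (q \Po (2^-1 *: (1%:P - 'X))).
    under eq_Rintegral do rewrite horner_comp !hornerE mulrC.
    under [X in _ -> _ = X]eq_Rintegral do rewrite mulrBr.
    move=> Q0; rewrite RintB//; last exact: cont_onM.
    rewrite -[LHS]subr0; congr (_ - _); rewrite -[LHS]Q0.
    by apply: eq_Rintegral => x _; rewrite mulrC [2^-1 * _]mulrC.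
  rewrite -RintZl//; apply: Rint_le.
  - by apply: cont_onM => //; exact: cont_onB.
  - by apply: cont_onM => //; exact: cont_on_cst.
  move=> x xab; apply: (le_trans (ler_norm _)); rewrite normrM mulrC.
  by apply: ler_wpM2r => //; apply/ltW/Hq; rewrite /= in_itv.
have I0 : \int[mu]_(x in `[0, pi]) (h x * h x) = 0.
  apply/eqP; rewrite eq_le; apply/andP; split; last first.
    by apply: Rintegral_ge0 => x _; rewrite -expr2 sqr_ge0.
  apply/ler_addgt0Pl => e e0; rewrite addr0.
  have B1 : 0 < B + 1 by rewrite ltr_pwDr.
  apply: (le_trans (key (e / (B + 1)) _)); first by rewrite divr_gt0.
  by rewrite mulrAC ler_pdivrMr// ler_pM2l// lerDl.
move=> x xab; apply/eqP; rewrite -sqrf_eq0 expr2; apply/eqP.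
by apply: (@Rint_eq0 R 0 pi (fun x => h x * h x)) => // y _; rewrite -expr2 sqr_ge0.
Qed.

End CosineUniqueness.

(** * Eigenvalues of nearly symmetric matrices *)

Section RealMatrixEigenvalues.
Variable R : realType.
Local Notation C := R[i].
Local Open Scope sesquilinear_scope.

Fixpoint mxpow (F : pzSemiRingType) (n : nat) (A : 'M[F]_n) (k : nat) : 'M[F]_n :=
  if k is k'.+1 then A *m mxpow A k' else 1%:M.

(** [eigenvalues] is a chosen list, known only through the factorization of the characteristic
    polynomial; this identifies it with the diagonal of a triangular form. *)
Lemma perm_eq_prod_XsubC (F : idomainType) (s t : seq F) :
  \prod_(a <- s) ('X - a%:P) = \prod_(a <- t) ('X - a%:P) -> perm_eq s t.
Proof.
elim: s t => [|a s IH] t E.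
  have := congr1 (fun q : {poly F} => size q) E.
  by rewrite big_nil size_poly1 size_prod_XsubC; case: t {E}.
have aT : a \in t by rewrite -root_prod_XsubC -E root_prod_XsubC mem_head.
rewrite perm_sym (perm_trans (perm_to_rem aT))// perm_cons perm_sym IH//.
have /mulfI : 'X - a%:P != 0 :> {poly F} by rewrite polyXsubC_eq0.
apply; move: E; rewrite big_cons => ->.
by rewrite (perm_big _ (perm_to_rem aT)) /= big_cons.
Qed.

Lemma trig_mul (n : nat) (S T : 'M[C]_n) : is_trig_mx S -> is_trig_mx T ->
  is_trig_mx (S *m T) /\ forall i, (S *m T) i i = S i i * T i i.
Proof.
move=> /is_trig_mxP tS /is_trig_mxP tT; split.
  apply/is_trig_mxP => i j ij; rewrite mxE big1// => k _.
  have [ik|ki] := ltnP i k; first by rewrite tS// mul0r.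
  by rewrite tT ?mulr0// (leq_ltn_trans ki).
move=> i; rewrite mxE (bigD1 i)//= big1 ?addr0// => k ki.
have [ik|ki'] := ltnP i k; first by rewrite tS// mul0r.
by rewrite tT ?mulr0// ltn_neqAle ki' andbT.
Qed.

Lemma trig_mxpow (n : nat) (T : 'M[C]_n) k : is_trig_mx T ->
  is_trig_mx (mxpow T k) /\ forall i, (mxpow T k) i i = T i i ^+ k.
Proof.
move=> tT; elim: k => [|k [IH1 IH2]] /=.
  split; last by move=> i; rewrite mxE eqxx expr0.
  apply/is_trig_mxP => i j ij; rewrite mxE; case: eqP ij => // ->.
  by rewrite ltnn.
have [t1 t2] := trig_mul tT IH1; split => // i.
by rewrite t2 IH2 exprS.
Qed.

Lemma map_mxpow (n : nat) (B : 'M[R]_n) k :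
  map_mx (real_complex R) (mxpow B k) = mxpow (map_mx (real_complex R) B) k.
Proof.
elim: k => [|k IH] /=; first by rewrite map_mx1.
by rewrite map_mxM IH.
Qed.

(** A unitary change of basis puts the eigenvalues on a diagonal while preserving the trace and the
    Frobenius norm, the two quantities from which the power sums and the imaginary parts are
    controlled. *)
Lemma Schur_eigenvalues (n : nat) (B : 'M[R]_n) : exists P T : 'M[C]_n,
  [/\ P \is unitarymx, T = P *m map_mx (real_complex R) B *m P^t*, is_trig_mx T
    & perm_eq (eigenvalues B) [seq T i i | i <- enum 'I_n]].
Proof.
have [P uP tT] : trigonalizable_in (@unitarymx C n n) (map_mx (real_complex R) B).
  have [n0|n0] := posnP n; last exact: Schur.
  move: B; rewrite n0 => B; exists 1%:M; first by rewrite qualifE mul1mx trmx1 map_mx1.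
  by apply/is_trig_mxP => -[].
exists P, (P *m map_mx (real_complex R) B *m P^t*).
have eT : conjmx P (map_mx (real_complex R) B) = P *m map_mx (real_complex R) B *m P^t*.
  exact: conjymx.
move: tT; rewrite /similar_to eT; set T := _ *m _ => tT; split => //.
have cpT : char_poly T = char_poly (map_mx (real_complex R) B).
  rewrite /char_poly.
  have -> : char_poly_mx T = map_mx polyC P *m
      char_poly_mx (map_mx (real_complex R) B) *m map_mx polyC (P^t*).
    rewrite /char_poly_mx mulmxBr mulmxBl -!map_mxM -/T; congr (_ - _).
    by rewrite mul_mx_scalar -scalemxAl -map_mxM (unitarymxP _)// map_mx1 scalemx1.
  rewrite !det_mulmx mulrAC -det_mulmx -map_mxM (unitarymxP _)//.
  by rewrite map_mx1 det1 mul1r.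
rewrite /eigenvalues; case: closed_field_poly_normal => r /=.
rewrite (monicP (char_poly_monic _)) scale1r -cpT char_poly_trig// => Er.
apply: perm_eq_prod_XsubC; rewrite -Er big_map.
by rewrite big_enum.
Qed.

Lemma unitary_trace (n : nat) (P A : 'M[C]_n) : P \is unitarymx ->
  \tr (P *m A *m P^t*) = \tr A.
Proof.
move=> uP; rewrite mxtrace_mulC mulmxA.
suff -> : P^t* *m P = 1%:M by rewrite mul1mx.
by apply/mulmx1C/unitarymxP.
Qed.

Lemma frobenius_trace (n : nat) (H : 'M[C]_n) :
  \tr (H *m H^t*) = \sum_i \sum_j `|H i j| ^+ 2.
Proof.
apply: eq_bigr => i _; rewrite mxE; apply: eq_bigr => j _.
by rewrite !mxE normCK.
Qed.

Lemma eigenvalues_power_sum (n : nat) (B : 'M[R]_n) k :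
  \sum_(z <- eigenvalues B) z ^+ k = real_complex R (\tr (mxpow B k)).
Proof.
have [P [T [uP TE tT pT]]] := Schur_eigenvalues B.
rewrite (perm_big _ pT) /= big_map big_enum /=.
have [_ Tk] := trig_mxpow k tT.
under eq_bigr do rewrite -Tk.
have PP : P^t* *m P = 1%:M by apply/mulmx1C/unitarymxP.
have TkE : mxpow T k = P *m mxpow (map_mx (real_complex R) B) k *m P^t*.
  elim: k {Tk} => [|k IH] /=; first by rewrite mulmx1 (unitarymxP _).
  by rewrite IH {1}TE !mulmxA -(mulmxA _ (P^t*) P) PP mulmx1.
transitivity (\tr (mxpow T k)) => //.
rewrite TkE unitary_trace// -map_mxpow.
by rewrite -(trace_map_mx (real_complex R)).
Qed.

(** The skew-Hermitian parts of [T] and [B] are unitarily equivalent, hence have the same Frobenius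
    norm, and the diagonal of the former carries [2 i] times the imaginary parts of the eigenvalues.
    The factor 4 gained is dropped. *)
Lemma sum_Im_eigenvalues (n : nat) (B : 'M[R]_n) :
  \sum_(z <- eigenvalues B) complex.Im z ^+ 2 <=
  \sum_i \sum_j (B i j - B j i) ^+ 2.
Proof.
have [P [T [uP TE tT pT]]] := Schur_eigenvalues B.
rewrite (perm_big _ pT) /= big_map big_enum /=.
pose A := map_mx (real_complex R) B; pose H := A - A^t*.
have HE : T - T^t* = P *m H *m P^t*.
  have Tt : T^t* = P *m A^t* *m P^t*.
    rewrite TE !trmx_mul !map_mxM /= mulmxA; congr (_ *m _ *m _).
    by apply/matrixP => i j; rewrite !mxE conjCK.
  by rewrite Tt TE /H mulmxBr mulmxBl.
have frob : \sum_i \sum_j `|(T - T^t*) i j| ^+ 2 = \sum_i \sum_j `|H i j| ^+ 2.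
  rewrite -!frobenius_trace HE -(unitary_trace (H *m H^t*) uP).
  rewrite !trmx_mul !map_mxM /=.
  have -> : (P^t* ^T) ^ (Num.conj_op : C -> C) = P.
    by apply/matrixP => i j; rewrite !mxE conjCK.
  have PP : P^t* *m P = 1%:M by apply/mulmx1C/unitarymxP.
  by rewrite !mulmxA -(mulmxA _ (P^t*) P) PP mulmx1.
have Hij i j : `|H i j| ^+ 2 = real_complex R ((B i j - B j i) ^+ 2).
  have -> : H i j = real_complex R (B i j - B j i).
    by rewrite !mxE; apply/eqP; rewrite eq_complex /=; apply/andP; split; apply/eqP; ring.
  by rewrite normc_def /= expr0n addr0 sqrtr_sqr -!rmorphXn /= real_normK ?num_real.
have Tii i : `|(T - T^t*) i i| ^+ 2 = real_complex R (4 * complex.Im (T i i) ^+ 2).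
  rewrite !mxE; case: (T i i) => a b /=.
  have -> : (a +i* b)%C - (a -i* b)%C = (0 +i* (2 * b))%C.
    by apply/eqP; rewrite eq_complex /= subrr eqxx opprK mulr_natl mulr2n eqxx.
  rewrite normc_def /= expr0n add0r sqrtr_sqr -rmorphXn /= real_normK ?num_real//.
  by congr (real_complex R _); ring.
have : \sum_i real_complex R (4 * complex.Im (T i i) ^+ 2) <=
       \sum_i \sum_j real_complex R ((B i j - B j i) ^+ 2).
  under [leRHS]eq_bigr do under eq_bigr do rewrite -Hij.
  rewrite -frob; apply: ler_sum => i _; rewrite -Tii (bigD1 i)//= lerDl.
  by apply: sumr_ge0 => j _; rewrite exprn_ge0.
under [leRHS]eq_bigr do rewrite -rmorph_sum.
rewrite -!rmorph_sum /= lecR -mulr_sumr; apply: le_trans.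
by rewrite ler_peMl ?ler1n// sumr_ge0// => i _; exact: sqr_ge0.
Qed.

(** Eigenvectors are rows multiplied from the left, so the eigenvalue equation at a coordinate of
    largest modulus involves one column of [B]; hence column sums. *)
Lemma cmod_eigenvalue (n : nat) (B : 'M[R]_n) (M : R) :
  (forall j, \sum_i `|B i j| <= M) ->
  forall z, z \in eigenvalues B -> cmod z <= M.
Proof.
move=> BM z zB.
have rz : root (char_poly (map_mx (real_complex R) B)) z.
  move: zB; rewrite /eigenvalues; case: closed_field_poly_normal => r /= Er zr.
  by rewrite Er (monicP (char_poly_monic _)) scale1r root_prod_XsubC.
have normE (w : C) : `|w| = real_complex R (cmod w) by rewrite normc_def.
have /eigenvalueP[v vE v0] : eigenvalue (map_mx (real_complex R) B) z.
  by rewrite eigenvalue_root_char.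
have [j0 vj0] : exists j, v 0 j != 0.
  by move/rV0Pn: v0.
have := @arg_maxP _ _ _ j0 xpredT (fun j => cmod (v 0 j)) isT.
case: arg_maxP => // j _ Hj _.
have vj : 0 < cmod (v 0 j).
  apply: lt_le_trans (Hj j0 isT).
  by rewrite -ltcR -normE rmorph0 normr_gt0.
rewrite -(ler_pM2r vj).
have : `|z * v 0 j| <= real_complex R (M * cmod (v 0 j)).
  have := congr1 (fun w : 'rV_n => w 0 j) vE; rewrite !mxE => <-.
  apply: (le_trans (ler_norm_sum _ _ _)).
  apply: (@le_trans _ _ (\sum_i real_complex R (`|B i j| * cmod (v 0 j)))).
    apply: ler_sum => i _; rewrite normrM !mxE mulrC rmorphM /=.
    apply: ler_pM => //; first by rewrite normc_def /= expr0n addr0 sqrtr_sqr.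
    by rewrite normE lecR; exact: Hj.
  by rewrite -rmorph_sum /= lecR -mulr_suml ler_wpM2r// ltW.
by rewrite normrM !normE -rmorphM lecR.
Qed.

End RealMatrixEigenvalues.

(** * From moments to the eigenvalue distribution *)

Section MomentMethod.
Variable R : realType.
Local Notation C := R[i].
Local Notation mu := (@lebesgue_measure R).
Local Notation rc := (real_complex R).

Lemma cvg_sum_ord (m : nat) (u : nat -> nat -> R) (l : nat -> R) :
  (forall k, u k n @[n --> \oo] --> l k) ->
  \sum_(k < m) u k n @[n --> \oo] --> \sum_(k < m) l k.
Proof.
move=> ul; elim: m => [|m IH].
  by rewrite big_ord0; under eq_fun do rewrite big_ord0; exact: cvg_cst.
rewrite big_ord_recr; under eq_fun do rewrite big_ord_recr.
exact: cvgD.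
Qed.

Lemma size_eigenvalues (n : nat) (B : 'M[R]_n) : size (eigenvalues B) = n.
Proof.
by have [P [T [_ _ _ /perm_size->]]] := Schur_eigenvalues B; rewrite size_map size_enum_ord.
Qed.

Lemma ReD (x y : C) : complex.Re (x + y) = complex.Re x + complex.Re y.
Proof. by case: x y => [a b] [c d]. Qed.

Lemma ImD (x y : C) : complex.Im (x + y) = complex.Im x + complex.Im y.
Proof. by case: x y => [a b] [c d]. Qed.

Lemma Re_sum (I : Type) (s : seq I) (F : I -> C) :
  complex.Re (\sum_(i <- s) F i) = \sum_(i <- s) complex.Re (F i).
Proof. by apply: (big_morph _ ReD). Qed.

Lemma Im_sum (I : Type) (s : seq I) (F : I -> C) :
  complex.Im (\sum_(i <- s) F i) = \sum_(i <- s) complex.Im (F i).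
Proof. by apply: (big_morph _ ImD). Qed.

Lemma Re_le_cmod (z : C) : `|complex.Re z| <= cmod z.
Proof. by rewrite /cmod -sqrtr_sqr ler_wsqrtr// lerDl sqr_ge0. Qed.

Lemma Im_le_cmod (z : C) : `|complex.Im z| <= cmod z.
Proof. by rewrite /cmod -sqrtr_sqr ler_wsqrtr// lerDr sqr_ge0. Qed.

Lemma cmod_le (a b : R) : cmod (a +i* b)%C <= `|a| + `|b|.
Proof.
rewrite /cmod /= -(ger0_norm (addr_ge0 (normr_ge0 a) (normr_ge0 b))) -sqrtr_sqr.
rewrite ler_wsqrtr// sqrrD !real_normK ?num_real// -addrA lerD2l lerDr.
by rewrite mulrn_wge0// mulr_ge0.
Qed.

(** Points of the plane are pairs of reals here, so that compactness and continuity come from the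
    product topology. *)
Lemma continuous_complex_poly (q : {poly R}) (w : R * R) :
  continuous_at w (fun z : R * R => complex.Re (map_poly rc q).[(z.1 +i* z.2)%C]) /\
  continuous_at w (fun z : R * R => complex.Im (map_poly rc q).[(z.1 +i* z.2)%C]).
Proof.
have c1 : continuous_at w (fun z : R * R => z.1) by exact: cvg_fst.
have c2 : continuous_at w (fun z : R * R => z.2) by exact: cvg_snd.
elim/poly_ind: q => [|q c [IH1 IH2]].
  by split; under eq_fun do rewrite rmorph0 horner0 /=; exact: cvg_cst.
have E (z : R * R) : (map_poly rc (q * 'X + c%:P)).[(z.1 +i* z.2)%C] =
    (map_poly rc q).[(z.1 +i* z.2)%C] * (z.1 +i* z.2)%C + rc c.
  by rewrite rmorphD rmorphM /= map_polyX map_polyC /= !hornerE.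
split.
  have -> : (fun z : R * R => complex.Re (map_poly rc (q * 'X + c%:P)).[(z.1 +i* z.2)%C]) =
    (fun z => complex.Re (map_poly rc q).[(z.1 +i* z.2)%C] * z.1 -
              complex.Im (map_poly rc q).[(z.1 +i* z.2)%C] * z.2 + c).
    by apply/funext => z; rewrite E; case: (map_poly rc q).[_].
  by apply: cvgD; [apply: cvgB; exact: cvgM|exact: cvg_cst].
have -> : (fun z : R * R => complex.Im (map_poly rc (q * 'X + c%:P)).[(z.1 +i* z.2)%C]) =
  (fun z => complex.Re (map_poly rc q).[(z.1 +i* z.2)%C] * z.2 +
            complex.Im (map_poly rc q).[(z.1 +i* z.2)%C] * z.1).
  by apply/funext => z; rewrite E; case: (map_poly rc q).[_] => a b /=; rewrite addr0.
by apply: cvgD; exact: cvgM.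
Qed.

(** The continuity clause of [test_function] for one real component: the real and imaginary parts of
    a test function are treated separately. *)
Definition cmod_continuous (G : C -> R) := forall z (e : R), 0 < e ->
  exists2 d : R, 0 < d & forall w, cmod (w - z) < d -> `|G w - G z| < e.

Lemma cmod_continuous_at (G : C -> R) (w : R * R) : cmod_continuous G ->
  continuous_at w (fun z : R * R => G (z.1 +i* z.2)%C).
Proof.
move=> cG; apply/cvgrPdist_lt => e e0.
have [d d0 Hd] := cG (w.1 +i* w.2)%C e e0.
have d2 : 0 < d / 2 by rewrite divr_gt0.
have c1 : z.1 @[z --> w] --> w.1 by exact: cvg_fst.
have c2 : z.2 @[z --> w] --> w.2 by exact: cvg_snd.
near=> z; rewrite distrC; apply: Hd.
have -> : (z.1 +i* z.2)%C - (w.1 +i* w.2)%C = ((z.1 - w.1) +i* (z.2 - w.2))%C by [].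
apply: (le_lt_trans (cmod_le _ _)); rewrite (splitr d) ltrD//.
  by rewrite distrC; near: z; move/cvgrPdist_lt: c1; apply.
by rewrite distrC; near: z; move/cvgrPdist_lt: c2; apply.
Unshelve. all: by end_near. Qed.

Lemma cmod_continuous_real (G : C -> R) (x : R) : cmod_continuous G ->
  continuous_at x (fun t => G (rc t)).
Proof.
move=> cG; apply/cvgrPdist_lt => e e0.
have [d d0 Hd] := cG (rc x) e e0.
have c1 : z @[z --> x] --> x by exact: cvg_id.
near=> z; rewrite distrC; apply: Hd.
have -> : rc z - rc x = ((z - x) +i* 0)%C by apply/eqP; rewrite eq_complex /= subrr !eqxx.
apply: (le_lt_trans (cmod_le _ _)); rewrite normr0 addr0 distrC.
by near: z; move/cvgrPdist_lt: c1; apply.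
Unshelve. all: by end_near. Qed.

(* The eigenvalues are close to the real axis only in quadratic mean, so the error allowed off
   the axis has to be quadratic in [Im z]. *)
Lemma approx_by_polynomial (G : C -> R) (M : R) : cmod_continuous G -> 0 < M ->
  forall e, 0 < e -> exists (q : {poly R}) (K : R), [/\ 0 <= K,
    forall x, `|x| <= M -> `|G (rc x) - q.[x]| <= e &
    forall z, cmod z <= M ->
      `|G z - complex.Re (map_poly rc q).[z]| <= e + K * complex.Im z ^+ 2].
Proof.
move=> cG M0 e e0; have e2 : 0 < e / 2 by rewrite divr_gt0.
have MM : - M < M by rewrite gtrN.
have cGr x : - M <= x <= M -> continuous_at x (fun t => G (rc t)).
  by move=> _; exact: cmod_continuous_real.
have [q Hq] := weierstrass MM cGr e2.
(* [q] was fitted on the real axis only. [u] compares the error at a point with the error at its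
   projection onto the axis, so it vanishes with the imaginary part, as [compact_modulus]
   requires. *)
pose u (w : R * R) := G (w.1 +i* w.2)%C - complex.Re (map_poly rc q).[(w.1 +i* w.2)%C]
  - (G (rc w.1) - q.[w.1]).
have [K K0 HK] : exists2 K : R, 0 <= K & forall w : R * R,
    (`[- M, M]%classic `*` `[- M, M]%classic) w -> `|u w| <= e / 2 + K * w.2 ^+ 2.
  apply: (@compact_modulus R (R * R)%type _ u (fun w => w.2)) => //.
  - by apply: compact_setX; exact: segment_compact.
  - move=> w _; have c1 : continuous_at w (fun z : R * R => z.1) by exact: cvg_fst.
    have [cq _] := continuous_complex_poly q w.
    apply: cvgB; first by apply: cvgB; [exact: cmod_continuous_at|exact: cq].
    apply: cvgB.
      apply: (@continuous_comp _ _ _ (fun z : R * R => z.1) (fun t => G (rc t))) => //.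
      exact: cmod_continuous_real.
    apply: (@continuous_comp _ _ _ (fun z : R * R => z.1) (fun t : R => q.[t])) => //.
    exact: continuous_horner.
  - by move=> w _; exact: cvg_snd.
  - move=> [x y] _ /= ->; rewrite /u /=.
    have -> : (x +i* 0)%C = rc x by [].
    rewrite horner_map /=; ring.
exists q, K; split => // [x|[x y] zM].
  by rewrite ler_norml => /Hq /ltW; move: e2; lra.
have xM : `|x| <= M := le_trans (Re_le_cmod (x +i* y)%C) zM.
have yM : `|y| <= M := le_trans (Im_le_cmod (x +i* y)%C) zM.
have := HK (x, y); rewrite /= !in_itv /= -!ler_norml => /(_ (conj xM yM)).
rewrite /u /= => H1; move: xM; rewrite ler_norml => /Hq H2.
have -> : G (x +i* y)%C - complex.Re (map_poly rc q).[(x +i* y)%C] =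
   u (x, y) + (G (rc x) - q.[x]) by rewrite /u /=; ring.
apply: (le_trans (ler_normD _ _)); rewrite /u /=; move: H1 (ltW H2); lra.
Qed.

Lemma Re_horner_eigenvalues (n : nat) (B : 'M[R]_n) (q : {poly R}) :
  \sum_(z <- eigenvalues B) complex.Re (map_poly rc q).[z] =
  \sum_(k < size q) q`_k * \tr (mxpow B k).
Proof.
rewrite -Re_sum.
have -> : \sum_(z <- eigenvalues B) (map_poly rc q).[z] =
    rc (\sum_(k < size q) q`_k * \tr (mxpow B k)); last by [].
rewrite rmorph_sum /=.
under eq_bigr do rewrite horner_coef size_map_poly.
rewrite exchange_big /=; apply: eq_bigr => k _.
under eq_bigr do rewrite coef_map /=.
by rewrite -mulr_sumr eigenvalues_power_sum rmorphM.
Qed.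

(** The error splits into four quarters of [e]: [G] against [q] along the range of [f], [G] against
    [q] at the eigenvalues, the quadratic term in the imaginary parts, and the convergence of the
    mean of [q], which the moments give. *)
Lemma moment_method (d : nat -> nat) (A : forall n, 'M[R]_(d n)) (f : R -> R) (M : R)
    (G : C -> R) :
  0 < M -> cmod_continuous G ->
  (\forall n \near \oo, (0 < d n)%N) ->
  cont_on (- pi) pi f -> (forall t, - pi <= t <= pi -> `|f t| <= M) ->
  (\forall n \near \oo, forall j, \sum_i `|A n i j| <= M) ->
  (forall k, (d n)%:R^-1 * \tr (mxpow (A n) k) @[n --> \oo] -->
     (2 * pi)^-1 * \int[mu]_(t in `[- pi, pi]) (f t ^+ k)) ->
  ((d n)%:R^-1 * (\sum_i \sum_j (A n i j - A n j i) ^+ 2) @[n --> \oo] --> (0 : R)) ->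
  (d n)%:R^-1 * (\sum_(z <- eigenvalues (A n)) G z) @[n --> \oo] -->
     (2 * pi)^-1 * \int[mu]_(t in `[- pi, pi]) G (rc (f t)).
Proof.
move=> M0 cG dpos cf fM colM mom asym.
have pi0 := pi_gt0 R.
apply/cvgrPdist_le => e e0.
have e4 : 0 < e / 4 by rewrite divr_gt0.
have [q [K [K0 HG Hz]]] := approx_by_polynomial cG M0 e4.
have momq : (d n)%:R^-1 * (\sum_(z <- eigenvalues (A n)) complex.Re (map_poly rc q).[z])
    @[n --> \oo] --> (2 * pi)^-1 * \int[mu]_(t in `[- pi, pi]) q.[f t].
  have -> : (2 * pi)^-1 * \int[mu]_(t in `[- pi, pi]) q.[f t] =
      \sum_(k < size q) q`_k * ((2 * pi)^-1 * \int[mu]_(t in `[- pi, pi]) (f t ^+ k)).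
    under eq_Rintegral do rewrite horner_coef.
    rewrite (@Rint_sum R (- pi) pi _ (fun i x => q`_i * f x ^+ i)); last first.
      by move=> i; apply: cont_onM; [exact: cont_on_cst|exact: cont_onX].
    rewrite mulr_sumr; apply: eq_bigr => i _.
    by rewrite RintZl; [ring|exact: cont_onX].
  have -> : (fun n => (d n)%:R^-1 * (\sum_(z <- eigenvalues (A n)) complex.Re (map_poly rc q).[z])) =
      (fun n => \sum_(k < size q) q`_k * ((d n)%:R^-1 * \tr (mxpow (A n) k))).
    apply/funext => n; rewrite Re_horner_eigenvalues mulr_sumr.
    by apply: eq_bigr => k _; ring.
  apply: (@cvg_sum_ord _ (fun k n => q`_k * ((d n)%:R^-1 * \tr (mxpow (A n) k)))
    (fun k => q`_k * ((2 * pi)^-1 * \int[mu]_(t in `[- pi, pi]) (f t ^+ k)))) => k.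
  by apply: cvgMr; exact: mom.
have cGf : cont_on (- pi) pi (fun t => G (rc (f t))).
  move=> x /cf cfx; apply: (@continuous_comp _ _ _ f (fun t => G (rc t))) => //.
  exact: cmod_continuous_real.
have cqf : cont_on (- pi) pi (fun t => q.[f t]) by exact: cont_on_horner.
have dI : `|(2 * pi)^-1 * \int[mu]_(t in `[- pi, pi]) G (rc (f t)) -
            (2 * pi)^-1 * \int[mu]_(t in `[- pi, pi]) q.[f t]| <= e / 4.
  rewrite -mulrBr -RintB// normrM ger0_norm; last by rewrite invr_ge0 mulr_ge0// ltW.
  rewrite mulrC ler_pdivrMr ?mulr_gt0//.
  apply: (le_trans (Rint_norm_le (M := e / 4) _ _ _)).
  - lra.
  - exact: cont_onB.
  - by move=> x /fM /HG.
  by rewrite opprK; lra.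
(* [q] and [K] depend on [e] only, so for large [n] the mean square of the imaginary parts is small
   against [K]; [K + 1] avoids dividing by 0. *)
have K1 : 0 < e / 4 / (K + 1) by rewrite divr_gt0// ltr_pwDr.
near=> n.
have dn : 0 < (d n)%:R :> R by rewrite ltr0n; near: n.
have Im2 : K * ((d n)%:R^-1 * \sum_(z <- eigenvalues (A n)) complex.Im z ^+ 2) <= e / 4.
  have H : (d n)%:R^-1 * (\sum_i \sum_j (A n i j - A n j i) ^+ 2) <= e / 4 / (K + 1).
    apply: (le_trans (ler_norm _)); rewrite -[X in `|X|]subr0 distrC.
    by near: n; move/cvgrPdist_le: asym; apply.
  have H2 : (d n)%:R^-1 * \sum_(z <- eigenvalues (A n)) complex.Im z ^+ 2 <= e / 4 / (K + 1).
    apply: le_trans H; rewrite ler_pM2l ?invr_gt0//; exact: sum_Im_eigenvalues.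
  apply: (@le_trans _ _ (K * (e / 4 / (K + 1)))); first exact: ler_wpM2l.
  by rewrite mulrA ler_pdivrMr ?ltr_pwDr// mulrC ler_pM2l// lerDl.
have dS : `|(d n)%:R^-1 * (\sum_(z <- eigenvalues (A n)) G z) -
    (d n)%:R^-1 * (\sum_(z <- eigenvalues (A n)) complex.Re (map_poly rc q).[z])| <= e / 4 + e / 4.
  rewrite -mulrBr -sumrB normrM ger0_norm ?invr_ge0 ?ler0n//.
  apply: (@le_trans _ _ ((d n)%:R^-1 * \sum_(z <- eigenvalues (A n)) (e / 4 + K * complex.Im z ^+ 2))).
    rewrite ler_pM2l ?invr_gt0//; apply: (le_trans (ler_norm_sum _ _ _)).
    rewrite big_seq [leRHS]big_seq; apply: ler_sum => z zA; apply: Hz.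
    by apply: cmod_eigenvalue zA; near: n.
  rewrite big_split /=.
  have -> : \sum_(z <- eigenvalues (A n)) e / 4 = (d n)%:R * (e / 4).
    by rewrite big_const_seq count_predT size_eigenvalues iter_addr_0 mulr_natl.
  by rewrite -mulr_sumr mulrDr mulKf ?gt_eqF// lerD2l mulrCA.
have dM : `|(2 * pi)^-1 * \int[mu]_(t in `[- pi, pi]) q.[f t] -
   (d n)%:R^-1 * (\sum_(z <- eigenvalues (A n)) complex.Re (map_poly rc q).[z])| <= e / 4.
  by near: n; move/cvgrPdist_le: momq; apply.
move: dI dS dM; rewrite !ler_norml; lra.
Unshelve. all: by end_near. Qed.

Lemma spectral_distribution_moments (d : nat -> nat) (A : forall n, 'M[R]_(d n))
    (f : R -> R) (M : R) :
  (forall n, (d n < d n.+1)%N) -> 0 < M ->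
  cont_on (- pi) pi f -> (forall t, - pi <= t <= pi -> `|f t| <= M) ->
  (\forall n \near \oo, forall j, \sum_i `|A n i j| <= M) ->
  (forall k, (d n)%:R^-1 * \tr (mxpow (A n) k) @[n --> \oo] -->
     (2 * pi)^-1 * \int[mu]_(t in `[- pi, pi]) (f t ^+ k)) ->
  ((d n)%:R^-1 * (\sum_i \sum_j (A n i j - A n j i) ^+ 2) @[n --> \oo] --> (0 : R)) ->
  spectral_distribution A f `[- pi, pi].
Proof.
move=> dS M0 cf fM colM mom asym; split => // F [cF _] /=.
have pi0 := pi_gt0 R.
have dpos : \forall n \near \oo, (0 < d n)%N.
  by exists 1%N => // -[//|n] _; apply: leq_ltn_trans (dS n).
have -> : fine (mu `[- pi, pi]) = 2 * pi.
  rewrite lebesgue_measure_itv /= lte_fin gtrN// /=; lra.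
split.
- have -> : (fun n => complex.Re ((d n)%:R^-1 *: \sum_(z <- eigenvalues (A n)) F z)) =
      (fun n => (d n)%:R^-1 * \sum_(z <- eigenvalues (A n)) complex.Re (F z)).
    apply/funext => n; rewrite -Re_sum.
    by case: (\sum_(z <- _) _) => a b; rewrite -(rmorph_nat rc) -fmorphV /= mul0r subr0.
  apply: (moment_method (G := fun z => complex.Re (F z)) (M := M)) => // z e e0.
  have [r r0 Hr] := cF z e e0; exists r => // w /Hr; apply: le_lt_trans.
  have -> : complex.Re (F w) - complex.Re (F z) = complex.Re (F w - F z).
    by case: (F w) (F z) => a b [].
  exact: Re_le_cmod.
- have -> : (fun n => complex.Im ((d n)%:R^-1 *: \sum_(z <- eigenvalues (A n)) F z)) =
      (fun n => (d n)%:R^-1 * \sum_(z <- eigenvalues (A n)) complex.Im (F z)).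
    apply/funext => n; rewrite -Im_sum.
    by case: (\sum_(z <- _) _) => a b; rewrite -(rmorph_nat rc) -fmorphV /= mul0r addr0.
  apply: (moment_method (G := fun z => complex.Im (F z)) (M := M)) => // z e e0.
  have [r r0 Hr] := cF z e e0; exists r => // w /Hr; apply: le_lt_trans.
  have -> : complex.Im (F w) - complex.Im (F z) = complex.Im (F w - F z).
    by case: (F w) (F z) => a b [].
  exact: Im_le_cmod.
Qed.

End MomentMethod.

(** * Moments of perturbed Toeplitz matrices *)

Section ToeplitzMoments.
Variable R : realType.
Local Notation mu := (@lebesgue_measure R).

Lemma sin_natpi (k : nat) : sin (k%:R * pi : R) = 0.
Proof.
elim: k => [|k IH]; first by rewrite mul0r sin0.
by rewrite -natr1 mulrDl mul1r sinDpi IH oppr0.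
Qed.

Lemma is_derive_linear (k x : R) : is_derive x 1 (fun t => k * t) k.
Proof.
have H : is_derive x 1 (k *: (@id R)) (k *: 1) by apply: is_deriveZ.
by rewrite /GRing.scale /= mulr1 in H.
Qed.

Lemma is_derive_sinM (k x : R) :
  is_derive x 1 (fun t => sin (k * t)) (k * cos (k * x)).
Proof.
rewrite mulrC.
exact: (@is_derive1_comp _ (@sin R) (fun t => k * t) x _ _ _ (is_derive_linear k x)).
Qed.

Lemma integral_cos_nat (k : nat) :
  \int[mu]_(t in `[- pi, pi]) cos (k%:R * t) = if k == 0%N then 2 * pi else 0.
Proof.
have pi0 := pi_gt0 R; have pp : - pi <= pi :> R by lra.
case: k => [|k] /=.
  under eq_Rintegral do rewrite mul0r cos0.
  by rewrite Rint_cst//; ring.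
have k0 : k.+1%:R != 0 :> R by rewrite pnatr_eq0.
transitivity ((fun t => k.+1%:R^-1 * sin (k.+1%:R * t)) (pi : R) -
    (fun t => k.+1%:R^-1 * sin (k.+1%:R * t)) (- pi : R)); last first.
  by rewrite mulrN sinN sin_natpi oppr0 mulr0 subrr.
apply: (@Rint_FTC R (- pi) pi (fun t => cos (k.+1%:R * t)) (fun t => k.+1%:R^-1 * sin (k.+1%:R * t))) => //.
- by apply: cont_on_continuous; exact: continuous_cosM.
- move=> t _.
  have -> : cos (k.+1%:R * t) = k.+1%:R^-1 *: (k.+1%:R * cos (k.+1%:R * t)).
    by rewrite /GRing.scale /= mulKf.
  by apply: is_deriveZ; exact: is_derive_sinM.
Qed.

Definition dist (i j : nat) := ((i - j) + (j - i))%N.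

Lemma cos_dist (i j : nat) (t : R) : cos ((i%:R - j%:R) * t) = cos ((dist i j)%:R * t).
Proof.
have [ij|ji] := leqP i j.
  rewrite /dist (eqP ij) add0n natrB// -(opprB j%:R) mulNr cosN.
  by [].
by rewrite /dist (eqP (ltnW ji)) addn0 natrB// ltnW.
Qed.

Lemma integral_cos_dist (i j : nat) :
  \int[mu]_(t in `[- pi, pi]) cos ((i%:R - j%:R) * t) = if i == j then 2 * pi else 0.
Proof.
under eq_Rintegral do rewrite cos_dist.
rewrite integral_cos_nat; congr (if _ then _ else _).
rewrite /dist; lia.
Qed.

Variables (a t : nat -> R) (f : R -> R) (M : R).
Hypothesis M0 : 0 < M.
Hypothesis cf : cont_on (- pi) pi f.
Hypothesis fM : forall x, - pi <= x <= pi -> `|f x| <= M.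
Hypothesis t0 : forall N, 0 <= t N.
Hypothesis ft : forall N x, - pi <= x <= pi ->
  `|f x - (a 0%N + \sum_(r < N) 2 * a r.+1 * cos (r.+1%:R * x))| <= t N.
Hypothesis at_ : forall N N', (N <= N')%N -> \sum_(N <= r < N') `|a r.+1| <= t N.

(** Fourier coefficient of [f ^+ k] at frequency [m]: the expected entry of the [k]-th matrix power
    at offset [m] from the diagonal. *)
Let mu_ k (m : R) := (2 * pi)^-1 * \int[mu]_(x in `[- pi, pi]) (f x ^+ k * cos (m * x)).

(** Row [i] is a convolution cut off [i] places to the left and [d.-1 - i] places to the right. Its
    part symmetric about the diagonal sums, by [cos (c - u) + cos (c + u) = 2 cos c cos u], to a
    partial sum of the series of [f] times [cos c]; what remains on either side is a tail. This
    makes three errors [t N], with [N] the shorter side. *)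
Lemma toeplitz_row (d : nat) (i : 'I_d) (j : nat) x : - pi <= x <= pi ->
  `|f x * cos ((i%:R - j%:R) * x) -
    \sum_(m < d) a (dist i m) * cos ((m%:R - j%:R) * x)| <= 3 * (t i + t (d.-1 - i)).
Proof.
move=> xpi; set c := (i%:R - j%:R) * x.
set P := (i : nat); set Q := (d.-1 - i)%N.
have di : d = (P + Q.+1)%N by rewrite /P /Q; have := ltn_ord i; lia.
have S1 : \sum_(m < d) a (dist i m) * cos ((m%:R - j%:R) * x) =
    \sum_(0 <= r < P) a r.+1 * cos (c - r.+1%:R * x) + (a 0%N * cos c +
    \sum_(0 <= r < Q) a r.+1 * cos (c + r.+1%:R * x)).
  rewrite -(big_mkord xpredT (fun m => a (dist i m) * cos ((m%:R - j%:R) * x))).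
  rewrite (@big_cat_nat _ _ _ P) ?di ?leq_addr//=.
  congr (_ + _).
    rewrite big_nat_rev /= add0n; apply: eq_big_nat => r rP.
    have -> : dist i (P - r.+1) = r.+1 by rewrite /dist -/P; lia.
    congr (_ * cos _); rewrite /c natrB; last by lia.
    by rewrite -/P; ring.
  have -> (F : nat -> R) : \sum_(P <= m < d) F m = \sum_(0 <= r < Q.+1) F (r + P)%N.
    by rewrite -{1}(add0n P) big_addn di addKn.
  rewrite big_nat_recl//=; congr (_ + _).
    have -> : dist i (0 + P) = 0%N by rewrite /dist -/P; lia.
    by rewrite add0n.
  apply: eq_big_nat => r rP.
  have -> : dist i (r.+1 + P) = r.+1 by rewrite /dist -/P; lia.
  by congr (_ * cos _); rewrite /c natrD -/P; ring.
set N := minn P Q.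
have tail s L : (N <= L)%N -> `|\sum_(0 <= r < L) a r.+1 * cos (c + s * (r.+1%:R * x)) -
    \sum_(0 <= r < N) a r.+1 * cos (c + s * (r.+1%:R * x))| <= t N.
  move=> NL; rewrite (@big_cat_nat _ _ _ N 0 L)//= addrAC subrr add0r.
  apply: (le_trans (ler_norm_sum _ _ _)); apply: (le_trans _ (at_ NL)).
  apply: ler_sum => r _; rewrite normrM ler_piMr//.
  by rewrite ler_norml cos_geN1 cos_le1.
have tP := tail (-1) P (geq_minl _ _); have tQ := tail 1 Q (geq_minr _ _).
have e1 L : \sum_(0 <= r < L) a r.+1 * cos (c + -1 * (r.+1%:R * x)) =
    \sum_(0 <= r < L) a r.+1 * cos (c - r.+1%:R * x).
  by apply: eq_bigr => r _; rewrite mulN1r.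
have e2 L : \sum_(0 <= r < L) a r.+1 * cos (c + 1 * (r.+1%:R * x)) =
    \sum_(0 <= r < L) a r.+1 * cos (c + r.+1%:R * x).
  by apply: eq_bigr => r _; rewrite mul1r.
rewrite !e1 in tP; rewrite !e2 in tQ.
have fN : `|f x * cos c - (a 0%N * cos c + \sum_(0 <= r < N) a r.+1 * cos (c - r.+1%:R * x)
    + \sum_(0 <= r < N) a r.+1 * cos (c + r.+1%:R * x))| <= t N.
  have -> : a 0%N * cos c + \sum_(0 <= r < N) a r.+1 * cos (c - r.+1%:R * x)
    + \sum_(0 <= r < N) a r.+1 * cos (c + r.+1%:R * x) =
    (a 0%N + \sum_(r < N) 2 * a r.+1 * cos (r.+1%:R * x)) * cos c.
    rewrite mulrDl -addrA; congr (_ + _); rewrite -big_split /= mulr_suml big_mkord.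
    by apply: eq_bigr => r _; rewrite cosB cosD; ring.
  rewrite -mulrBl normrM; apply: le_trans (ft N xpi).
  by rewrite ler_piMr// ler_norml cos_geN1 cos_le1.
have tN : t N <= t P + t Q.
  by rewrite /N; case: (leqP P Q) => _; rewrite ?lerDl ?lerDr.
rewrite S1; move: tP tQ fN tN; rewrite !ler_norml.
move: (\sum_(0 <= r < P) _) (\sum_(0 <= r < Q) _) (\sum_(0 <= r < N) _).
move: (\sum_(0 <= r < N) _) => s1 s2 s3 s4; lra.
Qed.

Lemma toeplitz_moment_step (d : nat) k (i : 'I_d) (j : nat) :
  `|mu_ k.+1 (i%:R - j%:R) - \sum_(m < d) a (dist i m) * mu_ k (m%:R - j%:R)|
  <= M ^+ k * (3 * (t i + t (d.-1 - i))).
Proof.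
have pi0 := pi_gt0 R; have pp : - pi <= pi :> R by lra.
have cc m : cont_on (- pi) pi (fun x : R => cos (m * x)).
  by apply: cont_on_continuous; exact: continuous_cosM.
have cfk k' : cont_on (- pi) pi (fun x => f x ^+ k') by exact: cont_onX.
have -> : mu_ k.+1 (i%:R - j%:R) - \sum_(m < d) a (dist i m) * mu_ k (m%:R - j%:R) =
  (2 * pi)^-1 * \int[mu]_(x in `[- pi, pi]) (f x ^+ k * (f x * cos ((i%:R - j%:R) * x) -
    \sum_(m < d) a (dist i m) * cos ((m%:R - j%:R) * x))).
  under [in RHS]eq_Rintegral do rewrite mulrBr mulrA -exprSr mulr_sumr.
  rewrite RintB; first last.
  - apply: (@cont_on_sum _ _ _ _ (fun m x => f x ^+ k * (a (dist i m) * cos ((m%:R - j%:R) * x)))).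
    by move=> m; do 2!apply: cont_onM => //; exact: cont_on_cst.
  - exact: cont_onM.
  rewrite mulrBr; congr (_ - _).
  rewrite (@Rint_sum _ _ _ _ (fun m x => f x ^+ k * (a (dist i m) * cos ((m%:R - j%:R) * x)))); last first.
    by move=> m; do 2!apply: cont_onM => //; exact: cont_on_cst.
  rewrite mulr_sumr; apply: eq_bigr => m _; rewrite /mu_ mulrCA -RintZl; last exact: cont_onM.
  by congr (_ * _); apply: eq_Rintegral => x _; ring.
rewrite normrM ger0_norm; last by rewrite invr_ge0 mulr_ge0// ltW.
rewrite mulrC ler_pdivrMr ?mulr_gt0//.
have -> : 2 * pi = pi - - pi :> R by ring.
apply: Rint_norm_le => //.
  apply: cont_onM => //; apply: cont_onB; first exact: cont_onM.
  apply: (@cont_on_sum _ _ _ _ (fun m x => a (dist i m) * cos ((m%:R - j%:R) * x))) => m.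
  by apply: cont_onM => //; exact: cont_on_cst.
move=> x xpi; rewrite normrM; apply: ler_pM => //; last exact: toeplitz_row.
by rewrite normrX lerXn2r ?nnegrE ?fM// ltW.
Qed.

Lemma mu_le k m : `|mu_ k m| <= M ^+ k.
Proof.
have pi0 := pi_gt0 R; have pp : - pi <= pi :> R by lra.
rewrite normrM ger0_norm; last by rewrite invr_ge0 mulr_ge0// ltW.
rewrite mulrC ler_pdivrMr ?mulr_gt0//.
have -> : 2 * pi = pi - - pi :> R by ring.
apply: Rint_norm_le => //.
  apply: cont_onM; first exact: cont_onX.
  by apply: cont_on_continuous; exact: continuous_cosM.
move=> x xpi; rewrite normrM -[leRHS]mulr1; apply: ler_pM => //.
  by rewrite normrX lerXn2r ?nnegrE ?fM// ltW.
by rewrite ler_norml cos_geN1 cos_le1.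
Qed.

(** Errors are kept per row, uniformly in the column, and summed over the rows: one more factor [A]
    on the left costs a column sum of moduli, at most [M]. The constant [c] does not depend on the
    size [d]. *)
Lemma toeplitz_power_defect k : exists2 c : R, 0 <= c &
  forall (d : nat) (A : 'M[R]_d), (forall j, \sum_i `|A i j| <= M) ->
  exists e : 'I_d -> R,
    (forall i j, `|mxpow A k i j - mu_ k (i%:R - j%:R)| <= e i) /\
    \sum_i e i <= c * (\sum_(i < d) \sum_(j < d) `|A i j - a (dist i j)| + \sum_(i < d) 3 * (t i + t (d.-1 - i))).
Proof.
elim: k => [|k [c c0 IH]].
  exists 0 => // d A _; exists (fun=> 0); split; last by rewrite big1// mul0r.
  move=> i j /=; rewrite mxE /mu_.
  under eq_Rintegral do rewrite expr0 mul1r.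
  rewrite integral_cos_dist; have [->|ij] := eqVneq i j.
    by rewrite eqxx mulVf ?subrr ?normr0// mulf_neq0 ?gt_eqF ?pi_gt0.
  by rewrite (negbTE (_ : nat_of_ord i != j)) ?mulr0 ?subrr ?normr0.
exists (M * c + M ^+ k) => [|d A AM]; first by rewrite addr_ge0 ?mulr_ge0 ?exprn_ge0// ltW.
have [e [He Se]] := IH d A AM.
set W1 := \sum_i \sum_j _ in Se *; set W2 := \sum_i 3 * _ in Se *.
exists (fun i => \sum_m `|A i m| * e m + M ^+ k *
  (\sum_m `|A i m - a (dist i m)| + 3 * (t i + t (d.-1 - i)))); split.
  move=> i j; rewrite /= mxE.
  have -> : \sum_m A i m * mxpow A k m j - mu_ k.+1 (i%:R - j%:R) =
     \sum_m A i m * (mxpow A k m j - mu_ k (m%:R - j%:R)) +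
     (\sum_m (A i m - a (dist i m)) * mu_ k (m%:R - j%:R) -
     (mu_ k.+1 (i%:R - j%:R) - \sum_(m < d) a (dist i m) * mu_ k (m%:R - j%:R))).
    have -> : \sum_m A i m * mxpow A k m j = \sum_m A i m * (mxpow A k m j - mu_ k (m%:R - j%:R)) +
        (\sum_m (A i m - a (dist i m)) * mu_ k (m%:R - j%:R) +
        \sum_(m < d) a (dist i m) * mu_ k (m%:R - j%:R)).
      by rewrite -!big_split /=; apply: eq_bigr => m _; ring.
    by ring.
  apply: (le_trans (ler_normD _ _)); apply: lerD.
    apply: (le_trans (ler_norm_sum _ _ _)); apply: ler_sum => m _.
    by rewrite normrM ler_wpM2l.
  apply: (le_trans (ler_normB _ _)); rewrite mulrDr; apply: lerD; last exact: toeplitz_moment_step.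
  apply: (le_trans (ler_norm_sum _ _ _)); rewrite mulr_sumr; apply: ler_sum => m _.
  by rewrite normrM mulrC ler_wpM2r// mu_le.
have e0 m : 0 <= e m by apply: le_trans (He m m).
rewrite big_split /= -mulr_sumr big_split /= -/W1 -/W2 mulrDl lerD2r.
rewrite exchange_big /=; apply: (@le_trans _ _ (\sum_m M * e m)).
  by apply: ler_sum => m _; rewrite -mulr_suml ler_wpM2r.
by rewrite -mulr_sumr -mulrA ler_wpM2l// ltW.
Qed.

(** Reversing the rows exchanges the two boundary terms, so the average is 6 times a Cesaro mean of
    [t]. The shift to [n.+1] makes the size positive. *)
Lemma cesaro_tail (d : nat -> nat) : (forall n, (d n < d n.+1)%N) ->
  t N @[N --> \oo] --> (0 : R) ->
  (d n)%:R^-1 * (\sum_(i < d n) 3 * (t i + t ((d n).-1 - i))) @[n --> \oo] --> (0 : R).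
Proof.
move=> dS tt; have := cesaro tt; rewrite /arithmetic_mean => H.
have E n : (d n.+1)%:R^-1 * (\sum_(i < d n.+1) 3 * (t i + t ((d n.+1).-1 - i))) =
    6 * ((((d n.+1).-1).+1)%:R^-1 * \sum_(i < ((d n.+1).-1).+1) t i).
  have -> : ((d n.+1).-1).+1 = d n.+1 by rewrite prednK// (leq_ltn_trans _ (dS n)).
  rewrite -mulr_sumr big_split /=.
  have -> : \sum_(i < d n.+1) t ((d n.+1).-1 - i) = \sum_(i < d n.+1) t i.
    rewrite (reindex_inj rev_ord_inj) /=; apply: eq_bigr => i _; congr t.
    by have := ltn_ord i; lia.
  by ring.
rewrite -(cvg_shiftS (fun n => (d n)%:R^-1 * (\sum_(i < d n) 3 * (t i + t ((d n).-1 - i))))) /=.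
under eq_fun do rewrite E.
suff S0 : (((d n.+1).-1).+1)%:R^-1 * (\sum_(i < ((d n.+1).-1).+1) t i) @[n --> \oo] --> (0 : R).
  have S6 : 6 * ((((d n.+1).-1).+1)%:R^-1 * (\sum_(i < ((d n.+1).-1).+1) t i)) @[n --> \oo] --> 6 * (0 : R).
    exact: cvgMr.
  by rewrite mulr0 in S6.
have dinf : (d n.+1).-1 @[n --> \oo] --> \oo.
  have dn n : (n <= (d n.+1).-1)%N.
    elim: n => [//|n IH]; have := dS n.+1; have := leq_ltn_trans (leq0n _) (dS n); lia.
  move=> S [N _ NS]; exists N => // n /= Nn; apply: NS => /=.
  exact: leq_trans (dn n).
apply: (@cvg_comp _ _ _ (fun n => (d n.+1).-1) (fun m => m.+1%:R^-1 * \sum_(i < m.+1) t i) _ \oo) => //.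
rewrite [X in X @ _ --> _](_ : _ = [sequence n.+1%:R^-1 * series (fun i => t i) n.+1]_n) //.
by apply/funext => m; rewrite /series /= big_mkord.
Qed.

(** The normalized trace averages diagonal entries that should be [mu_ k 0]. Single rows near the
    boundary may be far off, but the row errors sum to [o(d)]. *)
Lemma toeplitz_moments (d : nat -> nat) (A : forall n, 'M[R]_(d n)) :
  (forall n, (d n < d n.+1)%N) -> t N @[N --> \oo] --> (0 : R) ->
  (\forall n \near \oo, forall j, \sum_i `|A n i j| <= M) ->
  ((d n)%:R^-1 * (\sum_(i < d n) \sum_(j < d n) `|A n i j - a (dist i j)|) @[n --> \oo] --> (0 : R)) ->
  forall k, (d n)%:R^-1 * \tr (mxpow (A n) k) @[n --> \oo] -->
     (2 * pi)^-1 * \int[mu]_(x in `[- pi, pi]) (f x ^+ k).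
Proof.
move=> dS tt AM Aa k; have [c c0 Hc] := toeplitz_power_defect k.
have tl := cesaro_tail dS tt.
have W0 : (d n)%:R^-1 * (\sum_(i < d n) \sum_(j < d n) `|A n i j - a (dist i j)|) +
  (d n)%:R^-1 * (\sum_(i < d n) 3 * (t i + t ((d n).-1 - i))) @[n --> \oo] --> (0 : R) + 0.
  exact: cvgD.
rewrite addr0 in W0; move: W0 => /cvgrPdist_le W0.
have c1 : 0 < c + 1 by rewrite ltr_pwDr.
apply/cvgrPdist_le => e e0.
have ec : 0 < e / (c + 1) by rewrite divr_gt0.
near=> n.
have dn : 0 < (d n)%:R :> R.
  rewrite ltr0n; near: n; exists 1%N => // -[//|n] _; exact: leq_ltn_trans (dS n).
have [|ee [He Se]] := Hc _ (A n); first by near: n.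
have -> : (2 * pi)^-1 * \int[mu]_(x in `[- pi, pi]) (f x ^+ k) = mu_ k 0.
  by rewrite /mu_; congr (_ * _); apply: eq_Rintegral => x _; rewrite mul0r cos0 mulr1.
have -> : mu_ k 0 - (d n)%:R^-1 * \tr (mxpow (A n) k) =
    (d n)%:R^-1 * \sum_(i < d n) (mu_ k (i%:R - i%:R) - mxpow (A n) k i i).
  rewrite sumrB mulrBr; congr (_ - _).
  under eq_bigr do rewrite subrr.
  by rewrite sumr_const card_ord -[mu_ k 0 *+ _]mulr_natl mulKf ?gt_eqF.
rewrite normrM ger0_norm ?invr_ge0 ?ler0n//.
apply: (@le_trans _ _ ((d n)%:R^-1 * \sum_i ee i)).
  rewrite ler_pM2l ?invr_gt0//; apply: (le_trans (ler_norm_sum _ _ _)).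
  by apply: ler_sum => i _; rewrite distrC.
apply: (@le_trans _ _ (c * (e / (c + 1)))); last first.
  by rewrite mulrA ler_pdivrMr// mulrC ler_pM2l// lerDl.
apply: (@le_trans _ _ ((d n)%:R^-1 * (c * (\sum_(i < d n) \sum_(j < d n) `|A n i j - a (dist i j)| + \sum_(i < d n) 3 * (t i + t ((d n).-1 - i)))))).
  by rewrite ler_pM2l ?invr_gt0.
rewrite mulrCA ler_wpM2l// mulrDr; apply: (le_trans (ler_norm _)).
rewrite -[X in `|X|]subr0 distrC; near: n.
exact: W0.
Unshelve. all: by end_near. Qed.

End ToeplitzMoments.

(** * Cosine series *)

Section NormalSeries.
Variable R : realType.
Local Notation mu := (@lebesgue_measure R).

Lemma summable_tail (b : nat -> R) (B : R) : (forall n, 0 <= b n) ->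
  (forall N, \sum_(0 <= r < N) b r <= B) ->
  exists t : nat -> R, [/\ forall N, 0 <= t N, t N @[N --> \oo] --> (0 : R) &
    forall N N', (N <= N')%N -> \sum_(N <= r < N') b r <= t N].
Proof.
move=> b0 bB; pose S N := \sum_(0 <= r < N) b r.
have ndS : nondecreasing_seq S.
  move=> m n mn; rewrite /S [leRHS](@big_cat_nat _ _ _ m)//= lerDl.
  by apply: sumr_ge0 => r _.
have cS : cvgn S by apply: nondecreasing_is_cvgn => //; exists B => _ [N _ <-]; exact: bB.
have Sl N : S N <= limn S by apply: nondecreasing_cvgn_le.
exists (fun N => limn S - S N); split.
- by move=> N; rewrite subr_ge0.
- have H : limn S - S N @[N --> \oo] --> limn S - limn S by apply: cvgB => //; exact: cvg_cst.
  by rewrite subrr in H.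
- move=> N N' NN'; rewrite lerBrDl; apply: le_trans (Sl N').
  by rewrite /S [leRHS](@big_cat_nat _ _ _ N)//=.
Qed.

(** When [u] depends on a parameter while [b] and [t] do not, this bound is uniform in the
    parameter. *)
Lemma normal_series (u : nat -> R) (b t : nat -> R) :
  (forall r, `|u r| <= b r) -> t N @[N --> \oo] --> (0 : R) ->
  (forall N N', (N <= N')%N -> \sum_(N <= r < N') b r <= t N) ->
  forall N, `|limn (series u) - \sum_(0 <= r < N) u r| <= t N.
Proof.
move=> ub tt bt N.
have tail N1 N2 : (N1 <= N2)%N -> `|\sum_(0 <= r < N2) u r - \sum_(0 <= r < N1) u r| <= t N1.
  move=> h; rewrite (@big_cat_nat _ _ _ N1)//= addrAC subrr add0r.
  apply: (le_trans (ler_norm_sum _ _ _)); apply: le_trans (bt _ _ h).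
  by apply: ler_sum => r _.
have cu : cvgn (series u).
  apply: normed_cvg; apply: nondecreasing_is_cvgn.
    move=> m n mn; rewrite /series /= [leRHS](@big_cat_nat _ _ _ m)//= lerDl.
    by apply: sumr_ge0 => r _.
  exists (t 0%N) => _ [n _ <-]; rewrite /series /=; apply: le_trans (bt 0%N n _) => //.
  by apply: ler_sum => r _.
apply/ler_addgt0Pl => e e0.
move/cvgrPdist_le: cu => /(_ e e0) [N1 _ H].
have := H (maxn N N1); rewrite /= leq_maxr => /(_ isT); rewrite {1}/series /= => h1.
rewrite -[_ - _](subrKA (\sum_(0 <= r < maxn N N1) u r)).
by apply: (le_trans (ler_normD _ _)); apply: lerD => //; apply: tail; exact: leq_maxl.
Qed.

Lemma uniform_limit_continuous_at (S : nat -> R -> R) (F : R -> R) (t : nat -> R) (x : R) :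
  (forall N, continuous_at x (S N)) -> t N @[N --> \oo] --> (0 : R) ->
  (\forall y \near x, forall N, `|F y - S N y| <= t N) -> continuous_at x F.
Proof.
move=> cS tt FS; apply/cvgrPdist_lt => e e0.
have e3 : 0 < e / 3 by rewrite divr_gt0.
move/cvgrPdist_lt: tt => /(_ _ e3) [N _ /(_ N (leqnn N))] /=; rewrite sub0r normrN => tN.
have tN' : t N < e / 3 := le_lt_trans (ler_norm _) tN.
have FSx := nbhs_singleton FS N.
near=> y.
have h1 : `|S N x - S N y| < e / 3 by near: y; move/cvgrPdist_lt: (cS N); apply.
have h2 : `|F y - S N y| <= t N by near: y; apply: filterS FS => y; exact.
move: h1 h2 FSx; rewrite !ltr_norml !ler_norml; lra.
Unshelve. all: by end_near. Qed.

(** The series converges normally to a continuous [F] with the same cosine coefficients as [f], and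
    [cosine_uniqueness] identifies the two. *)
Lemma cosine_series (f : R -> R) (a t : nat -> R) : cont_on 0 pi f ->
  t N @[N --> \oo] --> (0 : R) ->
  (forall N N', (N <= N')%N -> \sum_(N <= r < N') `|a r.+1| <= t N) ->
  (forall k : nat, \int[mu]_(x in `[0, pi]) (f x * cos (k%:R * x)) = pi * a k) ->
  forall N x, 0 <= x <= pi ->
    `|f x - (a 0%N + \sum_(r < N) 2 * a r.+1 * cos (r.+1%:R * x))| <= 2 * t N.
Proof.
move=> cf tt at_ fk; have pi0 := pi_gt0 R.
pose u x r := 2 * a r.+1 * cos (r.+1%:R * x).
pose F x := a 0%N + limn (series (u x)).
pose S N x := a 0%N + \sum_(r < N) u x r.
have FS N x : `|F x - S N x| <= 2 * t N.
  rewrite /F /S opprD addrACA subrr add0r -(big_mkord xpredT (u x)).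
  apply: (@normal_series (u x) (fun r => 2 * `|a r.+1|) (fun N => 2 * t N)).
  - move=> r; rewrite /u normrM normrM ger0_norm// ler_piMr ?mulr_ge0//.
    by rewrite ler_norml cos_geN1 cos_le1.
  - by rewrite -(mulr0 2); apply: cvgMr.
  - by move=> N1 N2 h; rewrite -mulr_sumr ler_pM2l// at_.
have t2 : 2 * t N @[N --> \oo] --> (0 : R) by rewrite -(mulr0 2); apply: cvgMr.
have cu r : continuous (u ^~ r).
  move=> x; apply: cvgMr; exact: continuous_cosM.
have cS N : continuous (S N).
  move=> x; apply: cvgD; first exact: cvg_cst.
  have := @cont_on_sum R x x N (fun r x => u x r); apply; last by rewrite !lexx.
  by move=> r; apply: cont_on_continuous.
have cF : continuous F.
  move=> x.
  have H : \forall y \near x, forall N, `|F y - S N y| <= 2 * t N.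
    by exists 1 => //= y _ N; exact: FS.
  by apply: (@uniform_limit_continuous_at S F (fun N => 2 * t N)) H => // N; exact: cS.
have ccos k : cont_on 0 pi (fun x : R => cos (k%:R * x)).
  by apply: cont_on_continuous; exact: continuous_cosM.
have Icos k : \int[mu]_(x in `[0, pi]) cos (k%:R * x) = if k == 0%N then pi else 0.
  have := integral_cos_nat R k.
  rewrite (@Rint_split _ _ 0) ?oppr_le0 ?ltW//; last first.
    by apply: cont_on_continuous; exact: continuous_cosM.
  have -> : \int[mu]_(t in `[- pi, 0]) cos (k%:R * t) = \int[mu]_(x in `[0, pi]) cos (k%:R * x).
    rewrite /Rintegral -{1}oppr0 (@integration_by_substitution_oppr _ (fun t => cos (k%:R * t))).
    - by congr fine; apply: eq_integral => x _; rewrite /= mulrN cosN.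
    - exact: ltW.
    - by apply: continuous_subspaceT; exact: continuous_cosM.
  by case: eqP => _; lra.
have Icc r k : \int[mu]_(x in `[0, pi]) (u x r * cos (k%:R * x)) =
    if k == r.+1 then pi * a k else 0.
  transitivity (\int[mu]_(x in `[0, pi]) (a r.+1 * (cos ((r.+1 + k)%:R * x) + cos ((dist r.+1 k)%:R * x)))).
    apply: eq_Rintegral => x _; rewrite -cos_dist mulrDl mulNr.
    by rewrite natrD mulrDl cosB cosD /u; ring.
  rewrite RintZl; last exact: cont_onD.
  rewrite RintD// !Icos /=.
  have -> : (dist r.+1 k == 0)%N = (k == r.+1) by rewrite /dist; lia.
  by case: eqP => [->|_]; rewrite ?addr0 ?add0r ?mulr0 1?mulrC.
have IS N k : (k <= N)%N -> \int[mu]_(x in `[0, pi]) (S N x * cos (k%:R * x)) = pi * a k.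
  move=> kN; rewrite /S.
  under eq_Rintegral do rewrite mulrDl mulr_suml.
  rewrite RintD; first last.
  - apply: (@cont_on_sum _ _ _ _ (fun r x => u x r * cos (k%:R * x))) => r.
    by apply: cont_onM => //; exact: cont_on_continuous.
  - by apply: cont_onM => //; exact: cont_on_cst.
  rewrite RintZl// Icos (@Rint_sum _ _ _ _ (fun r x => u x r * cos (k%:R * x))); last first.
    by move=> r; apply: cont_onM => //; exact: cont_on_continuous.
  under eq_bigr do rewrite Icc.
  case: k kN => [|k] kN /=; first by rewrite big1// addr0 mulrC.
  rewrite mulr0 add0r (bigD1 (Ordinal kN))//= eqxx big1 ?addr0// => i ik.
  case: eqP => // -[ki]; move/eqP: ik; case.
  by apply: val_inj => /=.
have IF k : \int[mu]_(x in `[0, pi]) (F x * cos (k%:R * x)) = pi * a k.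
  apply/eqP; rewrite -subr_eq0 -normr_le0; apply/ler_addgt0Pl => e e0; rewrite addr0.
  have ep : 0 < e / pi by rewrite divr_gt0.
  move/cvgrPdist_lt: t2 => /(_ _ ep) [N _ HN].
  have := HN (maxn N k) (leq_maxl _ _); rewrite /= sub0r normrN => tN.
  rewrite -(IS (maxn N k)) ?leq_maxr// -RintB; last first.
    by apply: cont_onM => //; exact: cont_on_continuous.
    by apply: cont_onM => //; exact: cont_on_continuous.
  under eq_Rintegral do rewrite -mulrBl.
  apply: (@le_trans _ _ (e / pi * (pi - 0))); last by rewrite subr0 divfK// gt_eqF.
  apply: Rint_norm_le; first exact: ltW.
    by apply: cont_onM => //; apply: cont_onB; exact: cont_on_continuous.
  move=> x _; rewrite normrM.
  apply: (@le_trans _ _ `|F x - S (maxn N k) x|).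
    by rewrite ler_piMr// ler_norml cos_geN1 cos_le1.
  by apply: (le_trans (FS _ _)); apply: (le_trans (ler_norm _)); exact: ltW.
have fF x : 0 <= x <= pi -> f x = F x.
  move=> xpi; apply/eqP; rewrite -subr_eq0; apply/eqP.
  apply: (@cosine_uniqueness R (fun x => f x - F x)) => //.
    by apply: cont_onB => //; exact: cont_on_continuous.
  move=> k; under eq_Rintegral do rewrite mulrBl.
  rewrite RintB ?fk ?IF ?subrr//; apply: cont_onM => //; exact: cont_on_continuous.
by move=> N x xpi; rewrite fF//; exact: FS.
Qed.

End NormalSeries.

(** * Improper integrals *)

Section ImproperIntegrals.
Variable R : realType.
Local Notation mu := (@lebesgue_measure R).

(** One formulation for []0, +oo[], [[c, +oo[] and []0, c]]: results on segments pass to [D] by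
    monotone convergence along growing segments. *)
Definition exhausts (D : set R) (a b : nat -> R) :=
  [/\ forall n, a n <= b n, forall m n, (m <= n)%N -> a n <= a m /\ b m <= b n &
      D = \bigcup_n `[a n, b n]%classic].

Lemma exhausts_measurable D a b : exhausts D a b -> measurable D.
Proof. by move=> [_ _ ->]; apply: bigcup_measurable => n _. Qed.

Lemma exhausts_sub D a b n x : exhausts D a b -> a n <= x <= b n -> D x.
Proof. by move=> [_ _ ->] axb; exists n => //=; rewrite in_itv. Qed.

Lemma exhausts_nd D a b : exhausts D a b -> nondecreasing_seq (fun n => `[a n, b n]%classic).
Proof.
move=> [_ ndab _] m n mn; rewrite subsetEset => x /=; rewrite !in_itv /= => /andP[ax xb].
by have [h1 h2] := ndab _ _ mn; rewrite (le_trans h1)//= (le_trans xb).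
Qed.

Lemma exhausts_cont D a b f n : exhausts D a b ->
  (forall x, D x -> continuous_at x f) -> cont_on (a n) (b n) f.
Proof. by move=> eD cf x xab; apply: cf; exact: exhausts_sub eD xab. Qed.

Lemma exhausts_measurable_fun D a b (f : R -> R) : exhausts D a b ->
  (forall x, D x -> continuous_at x f) -> measurable_fun D f.
Proof.
move=> eD cf; have [_ _ DE] := eD; rewrite DE.
apply/measurable_fun_bigcup => // n.
have := cont_on_integrable (exhausts_cont (n := n) eD cf).
by move=> /integrableP[/measurable_EFinP].
Qed.

Lemma FTC_exhausts_ge0 D a b (f F : R -> R) (A B : R) : exhausts D a b ->
  (forall x, D x -> continuous_at x f) -> (forall x, D x -> 0 <= f x) ->
  (forall x, D x -> is_derive x 1 F (f x)) ->
  F (a n) @[n --> \oo] --> A -> F (b n) @[n --> \oo] --> B ->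
  (\int[mu]_(x in D) (f x)%:E = (B - A)%:E)%E.
Proof.
move=> eD cf f0 dF FA FB; have [ab _ DE] := eD.
have mf := exhausts_measurable_fun eD cf.
have cv : (\int[mu]_(x in `[a n, b n]) (f x)%:E @[n --> \oo] --> \int[mu]_(x in D) (f x)%:E)%E.
  rewrite DE; apply: ge0_nondecreasing_set_cvg_integral.
  - exact: exhausts_nd eD.
  - by move=> n; exact: measurable_itv.
  - move=> n; apply/measurable_EFinP; apply: measurable_funS mf; first exact: exhausts_measurable eD.
    by move=> x; rewrite /= in_itv /=; exact: exhausts_sub.
  - by move=> n x /=; rewrite in_itv /= lee_fin => xab; apply: f0; exact: exhausts_sub eD xab.
apply: (cvg_unique _ cv) => //.
have -> : (fun n => \int[mu]_(x in `[a n, b n]) (f x)%:E)%E = (fun n => (F (b n) - F (a n))%:E).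
  apply/funext => n; have cfn := exhausts_cont (n := n) eD cf.
  have <- : \int[mu]_(x in `[a n, b n]) f x = F (b n) - F (a n).
    by apply: Rint_FTC => // x xab; apply: dF; exact: exhausts_sub eD xab.
  by rewrite /Rintegral fineK//; apply: integrable_fin_num => //; exact: cont_on_integrable.
by apply: cvg_EFin; [exact: nearW|exact: cvgB].
Qed.

(** For a nonnegative integrand, finite limits of an antiderivative already yield integrability; for
    a signed one, [FTC_exhausts] assumes it. *)
Lemma FTC_exhausts_integrable D a b (f F : R -> R) (A B : R) : exhausts D a b ->
  (forall x, D x -> continuous_at x f) -> (forall x, D x -> 0 <= f x) ->
  (forall x, D x -> is_derive x 1 F (f x)) ->
  F (a n) @[n --> \oo] --> A -> F (b n) @[n --> \oo] --> B ->
  mu.-integrable D (EFin \o f) /\ \int[mu]_(x in D) f x = B - A.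
Proof.
move=> eD cf f0 dF FA FB; have E := FTC_exhausts_ge0 eD cf f0 dF FA FB.
split; last by rewrite /Rintegral E.
apply/integrableP; split.
  by apply/measurable_EFinP; exact: exhausts_measurable_fun eD cf.
rewrite (_ : (\int[mu]_(x in D) `|(EFin \o f) x|)%E = (B - A)%:E) ?ltry// -E.
by apply: eq_integral => x; rewrite inE => Dx; rewrite /= ger0_norm// f0.
Qed.

Lemma cvg_exhausts D a b (f : R -> R) : exhausts D a b ->
  mu.-integrable D (EFin \o f) ->
  \int[mu]_(x in `[a n, b n]) f x @[n --> \oo] --> \int[mu]_(x in D) f x.
Proof.
move=> eD If; have [ab ndab DE] := eD; have mD := exhausts_measurable eD.
have sub n : `[a n, b n]%classic `<=` D.
  by move=> x /=; rewrite in_itv /=; exact: exhausts_sub.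
have mf := measurable_int mu If.
have key (g : R -> \bar R) : measurable_fun D g -> (forall x, 0 <= g x)%E ->
    (\int[mu]_(x in `[a n, b n]) g x @[n --> \oo] --> \int[mu]_(x in D) g x)%E.
  move=> mg g0; rewrite DE; apply: ge0_nondecreasing_set_cvg_integral => //.
  - exact: exhausts_nd eD.
  - by move=> n; apply: measurable_funS mg.
have Ip : mu.-integrable D ((EFin \o f)^\+)%E by exact: integrable_funepos.
have In : mu.-integrable D ((EFin \o f)^\-)%E by exact: integrable_funeneg.
have fp : (\int[mu]_(x in D) ((EFin \o f)^\+)%E x)%E \is a fin_num.
  exact: integrable_fin_num.
have fn : (\int[mu]_(x in D) ((EFin \o f)^\-)%E x)%E \is a fin_num.
  exact: integrable_fin_num.
rewrite /Rintegral; apply: fine_cvg; rewrite fineK; last exact: integrable_fin_num.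
rewrite integralE; under eq_fun do rewrite integralE.
apply: cvgeB; first by apply: fin_num_adde_defl; rewrite fin_numN; exact: fn.
  by apply: key => //; exact: measurable_funepos.
by apply: key => //; exact: measurable_funeneg.
Qed.


Lemma FTC_exhausts D a b (f F : R -> R) (A B : R) : exhausts D a b ->
  (forall x, D x -> continuous_at x f) -> mu.-integrable D (EFin \o f) ->
  (forall x, D x -> is_derive x 1 F (f x)) ->
  F (a n) @[n --> \oo] --> A -> F (b n) @[n --> \oo] --> B ->
  \int[mu]_(x in D) f x = B - A.
Proof.
move=> eD cf If dF FA FB; have [ab _ _] := eD.
apply: (cvg_unique _ (cvg_exhausts eD If)) => //.
have -> : (fun n => \int[mu]_(x in `[a n, b n]) f x) = (fun n => F (b n) - F (a n)).
  apply/funext => n; apply: Rint_FTC => //; first exact: exhausts_cont eD cf.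
  by move=> x xab; apply: dF; exact: exhausts_sub eD xab.
exact: cvgB.
Qed.

Lemma exhausts_oy : exhausts `]0, +oo[ (fun n => n.+1%:R^-1) (fun n => n.+1%:R).
Proof.
split.
- by move=> n; rewrite (@le_trans _ _ 1)// ?invf_le1 ?ltr0n// ler1n.
- by move=> m n mn; rewrite lef_pV2 ?posrE ?ltr0n// !ler_nat ltnS.
- apply/seteqP; split => x /=.
    rewrite in_itv /= andbT => x0.
    have [n nx] : exists n, x + x^-1 < n.+1%:R.
      by exists (Num.truncn (x + x^-1)); exact: truncnS_gt.
    exists n => //=; rewrite in_itv /=.
    have x'0 : 0 < x^-1 by rewrite invr_gt0.
    apply/andP; split; last by lra.
    by rewrite -[leRHS]invrK lef_pV2 ?posrE ?ltr0n//; lra.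
  move=> [n _] /=; rewrite !in_itv /= => /andP[nx _].
  by rewrite andbT (lt_le_trans _ nx)// invr_gt0 ltr0n.
Qed.

Lemma exhausts_cy (c : R) : exhausts `[c, +oo[ (fun=> c) (fun n => c + n%:R).
Proof.
split.
- by move=> n; rewrite lerDl.
- by move=> m n mn; rewrite lexx lerD2l ler_nat.
- apply/seteqP; split => x /=.
    rewrite in_itv /= andbT => cx.
    exists (Num.truncn (x - c)).+1 => //=; rewrite in_itv /= cx /= -lerBlDl.
    by apply/ltW/truncnS_gt.
  by move=> [n _] /=; rewrite !in_itv /= andbT => /andP[].
Qed.

Lemma exhausts_oc (c : R) : 0 < c -> exhausts `]0, c] (fun n => c / n.+1%:R) (fun=> c).
Proof.
move=> c0; split.
- by move=> n; rewrite ler_pdivrMr ?ltr0n// ler_peMr ?ler1n// ltW.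
- by move=> m n mn; rewrite lexx ler_pM2l// lef_pV2 ?posrE ?ltr0n// ler_nat ltnS.
- apply/seteqP; split => x /=.
    rewrite in_itv /= => /andP[x0 xc].
    exists (Num.truncn (c / x)) => //=; rewrite in_itv /= xc andbT.
    by rewrite ler_pdivrMr ?ltr0n// mulrC -ler_pdivrMr//; apply/ltW/truncnS_gt.
  move=> [n _] /=; rewrite !in_itv /= => /andP[nx ->]; rewrite andbT.
  by rewrite (lt_le_trans _ nx)// divr_gt0// ltr0n.
Qed.

Lemma continuous_at_powR (e x : R) : 0 < x -> continuous_at x (fun t => t `^ e).
Proof.
move=> x0; apply: differentiable_continuous; apply/derivable1_diffP.
by apply: derivable_powR; rewrite in_itv /= x0.
Qed.

Lemma cvg_powR_harmonic (e : R) : 0 < e -> (n.+1%:R^-1) `^ e @[n --> \oo] --> (0 : R).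
Proof.
move=> e0; have := @powR_cvg0 R e e0 => /cvg_at_rightP; apply; split.
  by move=> n; rewrite invr_gt0 ltr0n.
exact: cvg_harmonic.
Qed.

Lemma powRV (x e : R) : 0 < x -> x^-1 `^ e = x `^ (- e).
Proof.
by move=> x0; rewrite -powR_inv1 ?ltW// -powRrM mulN1r.
Qed.

Lemma cvg_powR_nat (e : R) : 0 < e -> n.+1%:R `^ (- e) @[n --> \oo] --> (0 : R).
Proof.
move=> e0; have := cvg_powR_harmonic e0.
by under eq_fun do rewrite powRV ?ltr0n//.
Qed.

Lemma is_derive_powR_antiderivative (e x : R) : e + 1 != 0 -> 0 < x ->
  is_derive x 1 (fun t => (e + 1)^-1 * t `^ (e + 1)) (x `^ e).
Proof.
move=> e1 x0.
have H : is_derive x 1 ((e + 1)^-1 *: (fun t : R => t `^ (e + 1)))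
    ((e + 1)^-1 *: ((e + 1) * x `^ (e + 1 - 1))).
  by apply: is_deriveZ; exact: is_derive1_powR.
by move: H; rewrite /GRing.scale /= mulKf// addrK.
Qed.

Lemma integral_powR_oc (e c : R) : -1 < e -> 0 < c ->
  mu.-integrable `]0, c] (EFin \o (fun x => x `^ e)) /\
  \int[mu]_(x in `]0, c]) (x `^ e) = c `^ (e + 1) / (e + 1).
Proof.
move=> e1 c0; have e1' : 0 < e + 1 by lra.
rewrite -[_ / _]subr0 mulrC.
apply: (FTC_exhausts_integrable (F := fun t => (e + 1)^-1 * t `^ (e + 1)) (exhausts_oc c0)).
- by move=> x /=; rewrite in_itv /= => /andP[x0 _]; exact: continuous_at_powR.
- by move=> x _; exact: powR_ge0.
- move=> x /=; rewrite in_itv /= => /andP[x0 _].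
  by apply: is_derive_powR_antiderivative => //; rewrite gt_eqF.
- rewrite -[X in _ --> X](mulr0 ((e + 1)^-1 * c `^ (e + 1))).
  under eq_fun do rewrite powRM ?invr_ge0 ?ler0n// ?mulrA ?ltW//.
  by apply: cvgMr; exact: cvg_powR_harmonic.
- exact: cvg_cst.
Qed.

Lemma integral_powR_cy (e : R) : 1 < e ->
  mu.-integrable `[1, +oo[ (EFin \o (fun x => x `^ (- e))) /\
  \int[mu]_(x in `[1, +oo[) (x `^ (- e)) = (e - 1)^-1.
Proof.
move=> e1; have e1' : 0 < e - 1 by lra.
have -> : (e - 1)^-1 = 0 - (- e + 1)^-1 * 1 `^ (- e + 1).
  by rewrite powR1 mulr1 sub0r -invrN opprD opprK.
apply: (FTC_exhausts_integrable (F := fun t => (- e + 1)^-1 * t `^ (- e + 1)) (exhausts_cy 1)).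
- by move=> x /=; rewrite in_itv /= andbT => x1; apply: continuous_at_powR; lra.
- by move=> x _; exact: powR_ge0.
- move=> x /=; rewrite in_itv /= andbT => x1.
  by apply: is_derive_powR_antiderivative; [rewrite lt_eqF//; lra|lra].
- exact: cvg_cst.
- rewrite -(mulr0 (- e + 1)^-1); apply: cvgMr.
  have -> : - e + 1 = - (e - 1) by ring.
  by under eq_fun do rewrite nat1r; exact: cvg_powR_nat.
Qed.

Lemma measurable_oy (f : R -> R) : (forall x : R, 0 < x -> continuous_at x f) ->
  measurable_fun (`]0, +oo[%classic : set R) f.
Proof.
move=> cf; apply: (exhausts_measurable_fun exhausts_oy) => x /=.
by rewrite in_itv /= andbT; exact: cf.
Qed.

(** The integrability test on the half line: domination by a power above -1 at 0 and by a power
    below -1 at infinity. *)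
Lemma integrable_oy (f : R -> R) (e1 e2 C : R) : -1 < e1 -> 1 < e2 ->
  (forall x : R, 0 < x -> continuous_at x f) ->
  (forall x, 0 < x <= 1 -> `|f x| <= C * x `^ e1) ->
  (forall x, 1 <= x -> `|f x| <= C * x `^ (- e2)) ->
  mu.-integrable `]0, +oo[ (EFin \o f).
Proof.
move=> h1 h2 cf f1 f2; have mf := measurable_oy cf.
have C0 : 0 <= C by have := f2 1 (lexx _); rewrite powR1 mulr1; apply: le_trans.
have dom (D : set R) e : measurable D -> D `<=` `]0, +oo[%classic ->
    mu.-integrable D (EFin \o (fun x => x `^ e)) ->
    (forall x, D x -> `|f x| <= C * x `^ e) -> mu.-integrable D (EFin \o f).
  move=> mD Dsub ip fp.
  apply: (@le_integrable _ _ _ mu _ mD (EFin \o f) (EFin \o (fun x => C * x `^ e))).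
  - by apply/measurable_EFinP; exact: measurable_funS mf.
  - move=> x Dx; rewrite /= lee_fin (ger0_norm (mulr_ge0 C0 (powR_ge0 _ _))).
    exact: fp.
  - have := @integrableZl _ _ _ mu D mD C _ ip; rewrite /comp.
    by under [X in _ -> mu.-integrable _ X]eq_fun do rewrite EFinM.
have i1 : mu.-integrable `]0, 1] (EFin \o f).
  apply: (dom _ e1) => //; first by move=> x /=; rewrite !in_itv /= andbT => /andP[].
    by have [] := integral_powR_oc h1 ltr01.
have i2 : mu.-integrable `[1, +oo[ (EFin \o f).
  apply: (dom _ (- e2)) => //; first by move=> x /=; rewrite !in_itv /= !andbT; lra.
    by have [] := integral_powR_cy h2.
  by move=> x /=; rewrite in_itv /= andbT; exact: f2.
have i2' : mu.-integrable `]1, +oo[ (EFin \o f).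
  by apply: integrableS i2 => // x /=; rewrite !in_itv /= !andbT; exact: ltW.
apply/integrableP; split; first exact/measurable_EFinP.
move/integrableP: i1 => [m1 l1]; move/integrableP: i2' => [m2 l2].
have E : `]0, +oo[%classic = `]0, 1]%classic `|` `]1, +oo[%classic :> set R.
  apply/seteqP; split => x /=; rewrite !in_itv /= !andbT.
    by move=> x0; have [x1|x1] := leP x 1; [left; rewrite x0|right].
  by case=> [/andP[]//|x1]; rewrite (lt_trans ltr01).
rewrite E ge0_integral_setU//=; last 2 first.
- by rewrite -E; apply/measurable_EFinP; exact: measurableT_comp.
- apply/disj_setPS => y [/=]; rewrite !in_itv /= andbT => /andP[_ y1].
  by rewrite ltNge y1.
by rewrite lte_add_pinfty.
Qed.

Lemma FTC_oy (f F : R -> R) (A B : R) :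
  (forall x : R, 0 < x -> continuous_at x f) -> mu.-integrable `]0, +oo[ (EFin \o f) ->
  (forall x : R, 0 < x -> is_derive x 1 F (f x)) ->
  F (n.+1%:R^-1) @[n --> \oo] --> A -> F n.+1%:R @[n --> \oo] --> B ->
  \int[mu]_(x in `]0, +oo[) f x = B - A.
Proof.
move=> cf If dF FA FB; apply: (FTC_exhausts exhausts_oy) FA FB => // x /=.
  by rewrite in_itv /= andbT; exact: cf.
by rewrite in_itv /= andbT; exact: dF.
Qed.

End ImproperIntegrals.

(** * Affine changes of variable *)

Section AffineChange.
Variable R : realType.
Local Notation mu := (@lebesgue_measure R).
Local Notation mR := (measurableTypeR R).

Section Fixed.
Variables (c d : R).
Hypothesis c0 : c != 0.
Let phi : mR -> mR := fun x => c * x + d.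

Let mphi : measurable_fun [set: mR] phi.
Proof.
apply: measurable_funD => //; apply: measurable_funM => //; exact: measurable_cst.
Qed.

HB.instance Definition _ := isMeasurableFun.Build _ _ _ _ phi mphi.

Let k : {nonneg R} := NngNum (normr_ge0 c).

Let nu := measure_function_pushforward__canonical__measure_function_Measure mu mphi.

(** Both measures agree on half-open intervals, where a negative [c] swaps the closed end, and such
    values determine Lebesgue measure. Substitution then holds on any measurable domain. *)
Lemma lebesgue_measure_affine (A : set R) : measurable A -> mscale k nu A = mu A.
Proof.
move=> mA; apply/esym/lebesgue_measure_unique => //= _ [[a b]] _ <-.
rewrite /mscale /= /nu /= /pushforward.
have [cp|cn] : 0 < c \/ c < 0 by move: c0; rewrite neq_lt => /orP[]; [right|left].
  have -> : phi @^-1` `]a, b] = `](a - d) / c, (b - d) / c]%classic.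
    apply/seteqP; split => x /=; rewrite !in_itv /= /phi;
      by rewrite ltr_pdivrMr// ler_pdivlMr// ltrBlDr lerBrDr mulrC.
  rewrite !lebesgue_measure_itv /= !lte_fin ltr_pM2r ?invr_gt0// ltrD2r.
  case: ifP => _; last by rewrite mule0.
  rewrite -!EFinB -EFinM gtr0_norm// -mulrBl mulrC divfK ?gt_eqF//.
  by congr EFin; ring.
have -> : phi @^-1` `]a, b] = `[(b - d) / c, (a - d) / c[%classic.
  apply/seteqP; split => x /=; rewrite !in_itv /= /phi;
    by rewrite ler_ndivrMr// ltr_ndivlMr// ltrBlDr lerBrDr mulrC andbC.
rewrite !lebesgue_measure_itv /= !lte_fin ltr_nM2r ?invr_lt0// ltrD2r.
case: ifP => _; last by rewrite mule0.
rewrite -!EFinB -EFinM ltr0_norm// -mulrBl mulrC mulrN divfK ?lt_eqF//.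
by congr EFin; ring.
Qed.

Lemma ge0_integral_affine (D : set R) (f : R -> \bar R) : measurable D ->
  measurable_fun D f -> (forall x, D x -> (0 <= f x)%E) ->
  (\int[mu]_(x in D) f x = `|c|%:E * \int[mu]_(x in (fun x => (c * x + d)%R) @^-1` D) f (c * x + d)%R)%E.
Proof.
move=> mD mf f0.
transitivity (\int[mscale k nu]_(x in D) f x)%E.
  by apply: eq_measure_integral => A mA _; rewrite -[LHS]lebesgue_measure_affine.
rewrite ge0_integral_mscale//; congr (_ * _)%E.
by rewrite ge0_integral_pushforward// => x; rewrite inE; exact: f0.
Qed.

(** Positive and negative parts scale separately. If one is infinite, it is infinite on both sides,
    and [fine] returns 0 on both. *)
Lemma Rintegral_affine (D : set R) (f : R -> R) : measurable D -> measurable_fun D f ->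
  \int[mu]_(x in D) f x = `|c| * \int[mu]_(x in (fun x => c * x + d) @^-1` D) f (c * x + d).
Proof.
move=> mD mf; have mf' : measurable_fun D (EFin \o f) by exact/measurable_EFinP.
have cp : 0 < `|c| by rewrite normr_gt0.
rewrite /Rintegral integralE [in RHS]integralE.
have P (g : R -> \bar R) : measurable_fun D g -> (forall x, (0 <= g x)%E) ->
    (\int[mu]_(x in D) g x = `|c|%:E * \int[mu]_(x in (fun x => (c * x + d)%R) @^-1` D) g (c * x + d)%R)%E.
  by move=> mg g0; apply: ge0_integral_affine.
rewrite (P (fun x => ((fun x => (f x)%:E)^\+)%E x))//; last exact: measurable_funepos.
rewrite (P (fun x => ((fun x => (f x)%:E)^\-)%E x))//; last exact: measurable_funeneg.
set A := (\int[mu]_(x in _) _)%E; set B := (\int[mu]_(x in _) _)%E.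
have A0 : (0 <= A)%E by exact: integral_ge0.
have B0 : (0 <= B)%E by exact: integral_ge0.
have -> : (\int[mu]_(x in (fun x => (c * x + d)%R) @^-1` D) ((fun x => (f (c * x + d))%:E)^\+ x) = A)%E.
  by apply: eq_integral => x _; rewrite !funeposE.
have -> : (\int[mu]_(x in (fun x => (c * x + d)%R) @^-1` D) ((fun x => (f (c * x + d))%:E)^\- x) = B)%E.
  by apply: eq_integral => x _; rewrite !funenegE.
move: A B A0 B0 => [a| |] [b| |] //= _ _; rewrite ?gt0_muley ?lte_fin//= ?mulr0//.
by rewrite mulrBr.
Qed.

End Fixed.
End AffineChange.

(** * The Gamma function and the Mellin transform of the sine *)

Section SecantIntegral.
Variable R : realType.
Local Notation mu := (@lebesgue_measure R).

(** Telescoping: [1 / y^2 <= 2 / y - 2 / (y + 1)] for [y >= 1]. *)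
Lemma sum_inv_square (N N' : nat) : (N <= N')%N ->
  \sum_(N <= r < N') (r.+1%:R ^- 2 : R) <= 2 / N.+1%:R.
Proof.
move=> /subnK <-; move: (N' - N)%N => n.
suff H : \sum_(N <= r < n + N) (r.+1%:R ^- 2 : R) <= 2 / N.+1%:R - 2 / (n + N).+1%:R.
  by apply: (le_trans H); rewrite gerBl divr_ge0.
elim: n => [|n IH]; first by rewrite add0n big_geq// subrr.
rewrite addSn big_nat_recr ?leq_addl//=; apply: (le_trans (lerD IH (lexx _))).
rewrite -addrA lerD2l; move: (n + N)%N => m.
have m0 : 1 <= m.+1%:R :> R by rewrite ler1n.
have -> : m.+2%:R = m.+1%:R + 1 :> R by rewrite -natr1.
move: (m.+1%:R : R) m0 => y y1.
rewrite -subr_ge0.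
have -> : - (2 / (y + 1)) - (- (2 / y) + y ^- 2) = (y - 1) / (y ^+ 2 * (y + 1)).
  by field; apply/andP; split; rewrite gt_eqF//; lra.
by rewrite divr_ge0 ?subr_ge0// mulr_ge0 ?sqr_ge0//; lra.
Qed.

End SecantIntegral.

Section GammaFunction.
Variable R : realType.
Local Notation mu := (@lebesgue_measure R).

(** From [exp (t / k) >= t / k], raised to the power [k]. *)
Lemma expRN_le_invX (k : nat) (t : R) : (0 < k)%N -> 0 < t -> expR (- t) <= (k%:R / t) ^+ k.
Proof.
move=> k0 t0; have k0' : 0 < k%:R :> R by rewrite ltr0n.
rewrite expRN -invf_div exprVn lef_pV2 ?posrE ?expR_gt0 ?exprn_gt0 ?divr_gt0//.
have {2}-> : t = k%:R * (t / k%:R) by rewrite mulrC divfK// gt_eqF.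
rewrite expRM_natl; have tk : 0 <= t / k%:R by rewrite divr_ge0// ltW.
rewrite lerXn2r ?nnegrE ?expR_ge0//.
by apply: le_trans (expR_ge1Dx _); rewrite lerDr.
Qed.

Definition gamma_fun (e t : R) := t `^ e * expR (- t).

Lemma gamma_fun_ge0 e t : 0 <= gamma_fun e t.
Proof. by rewrite mulr_ge0 ?powR_ge0 ?expR_ge0. Qed.

(** [27 = 3 ^ 3]: the bound on the exponential with [k = 3], one power of [t] being spent on
    [t ^ e]. *)
Lemma gamma_fun_le e t : e <= 1 -> 1 <= t -> gamma_fun e t <= 27 * t `^ (- 2).
Proof.
move=> e1 t1; have t0 : 0 < t by lra.
have h1 : t `^ e <= t by exact: ler1_powR.
have h2 := @expRN_le_invX 3 t isT t0.
apply: (@le_trans _ _ (t * (3%:R / t) ^+ 3)).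
  by apply: ler_pM => //; rewrite ?powR_ge0 ?expR_ge0.
rewrite powR_invn; last exact: ltW.
by rewrite le_eqVlt; apply/orP; left; apply/eqP; field; rewrite gt_eqF.
Qed.

Lemma continuous_gamma_fun e (t : R) : 0 < t -> continuous_at t (gamma_fun e).
Proof.
move=> t0; apply: cvgM; first exact: continuous_at_powR.
apply: (@continuous_comp _ _ _ (fun x => - x) (@expR R)); last exact: continuous_expR.
exact: cvgN.
Qed.

Lemma integrable_gamma_fun e : -1 < e -> e <= 1 ->
  mu.-integrable `]0, +oo[ (EFin \o gamma_fun e).
Proof.
move=> e1 e2; apply: (@integrable_oy R _ e 2 27) => //; first by rewrite ltr1n.
- by move=> x x0; exact: continuous_gamma_fun.
- move=> x /andP[x0 x1]; rewrite ger0_norm ?gamma_fun_ge0// mulrC /gamma_fun.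
  rewrite ler_wpM2l ?powR_ge0//; apply: (@le_trans _ _ 1); last lra.
  by rewrite -expR0 ler_expR oppr_le0 ltW.
- by move=> x x1; rewrite ger0_norm ?gamma_fun_ge0//; exact: gamma_fun_le.
Qed.

(** This is [Gamma (e + 1)], over the open half line, where the integrand is continuous. *)
Definition gammaI e := \int[mu]_(t in `]0, +oo[) gamma_fun e t.

Lemma GammaE s : 0 < s -> s <= 1 -> Gamma s = gammaI (s - 1).
Proof.
move=> s0 s1; rewrite /gammaI /Gamma -Rintegral_itv_obnd_cbnd//.
by apply: integrable_gamma_fun; lra.
Qed.

Lemma gammaI_gt0 e : -1 < e -> e <= 1 -> 0 < gammaI e.
Proof.
move=> e1 e2; have Ig := integrable_gamma_fun e1 e2.
have cg : cont_on 1 2 (gamma_fun e).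
  by move=> x /andP[x1 x2]; apply: continuous_gamma_fun; lra.
have h : \int[mu]_(t in `[1, 2]) gamma_fun e t <= gammaI e.
  rewrite /gammaI /Rintegral fine_le//.
  - by apply: integrable_fin_num => //; exact: cont_on_integrable.
  - exact: integrable_fin_num.
  - apply: ge0_subset_integral => //=.
    + exact: (measurable_int mu Ig).
    + by move=> x _; rewrite lee_fin gamma_fun_ge0.
    + by move=> x; rewrite /= !in_itv /= andbT; lra.
rewrite lt_neqAle eq_sym; apply/andP; split; last first.
  by apply: Rintegral_ge0 => x _; exact: gamma_fun_ge0.
apply/eqP => g0; rewrite g0 in h.
have I0 : \int[mu]_(t in `[1, 2]) gamma_fun e t = 0.
  apply/eqP; rewrite eq_le h; apply: Rintegral_ge0 => x _; exact: gamma_fun_ge0.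
have := @Rint_eq0 R 1 2 (gamma_fun e) _ cg _ I0 1.
rewrite /gamma_fun powR1 mul1r => H.
have : expR (- 1) = 0 :> R.
  by apply: H; [lra|move=> x _; exact: gamma_fun_ge0|lra].
by move/eqP; rewrite gt_eqF ?expR_gt0.
Qed.

(** Integration by parts, as the fundamental theorem for [- t^s exp (- t)], which tends to 0 at both
    ends. *)
Lemma gammaI_succ s : 0 < s -> s < 1 -> gammaI s = s * gammaI (s - 1).
Proof.
move=> s0 s1.
have I1 : mu.-integrable `]0, +oo[ (EFin \o gamma_fun s) by apply: integrable_gamma_fun; lra.
have I2 : mu.-integrable `]0, +oo[ (EFin \o gamma_fun (s - 1)) by apply: integrable_gamma_fun; lra.
have I3 : mu.-integrable `]0, +oo[ (EFin \o (fun t => s * gamma_fun (s - 1) t)).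
  have mD : measurable (`]0, +oo[%classic : set R) by [].
  have := @integrableZl _ _ _ mu _ mD s _ I2; rewrite /comp.
  by under [X in _ -> mu.-integrable _ X]eq_fun do rewrite EFinM.
apply/eqP; rewrite -subr_eq0 /gammaI -RintegralZl// -RintegralB//; apply/eqP.
rewrite -[RHS](subr0 0).
apply: (@FTC_oy R _ (fun t => - (t `^ s * expR (- t)))).
- move=> x x0; apply: cvgB; first exact: continuous_gamma_fun.
  by apply: cvgMr; exact: continuous_gamma_fun.
- have mD : measurable (`]0, +oo[%classic : set R) by [].
  have H : mu.-integrable `]0, +oo[ (fun t => (gamma_fun s t)%:E - (s * gamma_fun (s - 1) t)%:E)%E.
    exact: integrableB.
  by apply: eq_integrable H.
- move=> x x0.
  have d1 := is_derive1_powR s x0.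
  have dN : is_derive x 1 (fun t : R => - t) (- 1) by apply: is_deriveN.
  have d2 : is_derive x 1 (fun t : R => expR (- t)) (expR (- x) * - 1).
    exact: (@is_derive1_comp _ (@expR R) (fun t => - t) x _ _ _ dN).
  have := is_deriveN (is_deriveM d1 d2).
  rewrite /gamma_fun /GRing.scale /=; set X := (X in is_derive _ _ _ X -> _).
  move=> H; rewrite (_ : _ - _ = X)//; rewrite /X; ring.
- rewrite -oppr0; apply: cvgN.
  apply: (@squeeze_cvgr _ _ _ _ (fun=> 0) (fun n => n.+1%:R^-1 `^ s)).
  + apply: nearW => n; rewrite mulr_ge0 ?powR_ge0 ?expR_ge0//=.
    by rewrite ler_piMr ?powR_ge0// -expR0 ler_expR oppr_le0 invr_ge0.
  + exact: cvg_cst.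
  + exact: cvg_powR_harmonic.
- rewrite -oppr0; apply: cvgN.
  apply: (@squeeze_cvgr _ _ _ _ (fun=> 0) (fun n => 27 * n.+1%:R `^ (- 2))).
  + apply: nearW => n; rewrite mulr_ge0 ?powR_ge0 ?expR_ge0//=.
    by apply: gamma_fun_le; [lra|rewrite ler1n].
  + exact: cvg_cst.
  + by rewrite -(mulr0 27); apply: cvgMr; exact: cvg_powR_nat.
Qed.

(** Writes [w ^ (- 1 - e)] as a Laplace transform; the extended-real form fits the iterated
    integrals of the Fubini argument. *)
Lemma integral_gamma_fun_scaled e (w : R) : -1 < e -> e <= 1 -> 0 < w ->
  (\int[mu]_(t in `]0%R, +oo[) (t `^ e * expR (- (w * t)))%:E)%E =
  (w `^ (- 1 - e) * gammaI e)%:E.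
Proof.
move=> e1 e2 w0; have Ig := integrable_gamma_fun e1 e2.
have -> : (w `^ (- 1 - e) * gammaI e)%:E =
    ((w `^ (- 1 - e))%:E * \int[mu]_(t in `]0%R, +oo[) (gamma_fun e t)%:E)%E.
  by rewrite EFinM /gammaI /Rintegral fineK//; exact: integrable_fin_num.
rewrite [X in _ = (_ * X)%E](@ge0_integral_affine R w 0)//; first last.
- by move=> x _; rewrite lee_fin gamma_fun_ge0.
- exact: (measurable_int mu Ig).
- by rewrite gt_eqF.
rewrite muleA -EFinM gtr0_norm//.
have -> : (fun x : R => w * x + 0) @^-1` `]0, +oo[ = `]0, +oo[%classic.
  by apply/seteqP; split => x /=; rewrite !in_itv /= !andbT addr0 pmulr_rgt0.
have mg : measurable_fun (`]0, +oo[%classic : set R) (fun t : R => gamma_fun e (w * t + 0)).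
  apply: measurable_oy => x x0.
  apply: (@continuous_comp _ _ _ (fun x => w * x + 0) (gamma_fun e)).
    by apply: cvgD; [apply: cvgMr; exact: cvg_id|exact: cvg_cst].
  by apply: continuous_gamma_fun; rewrite addr0 mulr_gt0.
rewrite -ge0_integralZl//; first last.
- by rewrite lee_fin mulr_ge0 ?powR_ge0// ltW.
- by move=> x _; rewrite lee_fin gamma_fun_ge0.
- exact/measurable_EFinP.
apply: eq_integral => t; rewrite inE /= in_itv /= andbT => t0.
rewrite -EFinM addr0 /gamma_fun powRM ?ltW//; congr EFin.
have -> : w `^ (- 1 - e) * w * (w `^ e * t `^ e * expR (- (w * t))) =
  (w `^ (- 1 - e) * w `^ e * w) * (t `^ e * expR (- (w * t))) by ring.
rewrite -powRD; last by rewrite (gt_eqF w0) implybT.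
have -> : - 1 - e + e = - 1 by ring.
by rewrite powR_inv1 ?ltW// mulVf ?mul1r// gt_eqF.
Qed.

End GammaFunction.

(** * The Mellin transform of the sine *)

Section SineIntegral.
Variable R : realType.
Local Notation mu := (@lebesgue_measure R).

Lemma cvg_at_invS (F : R -> R) : continuous_at 0 F ->
  F (n.+1%:R^-1) @[n --> \oo] --> F 0.
Proof. by move=> cF; apply: (cvg_comp _ _ (@cvg_harmonic R)). Qed.

Lemma is_derive_expRM (k x : R) : is_derive x 1 (fun w => expR (k * w)) (k * expR (k * x)).
Proof.
rewrite mulrC.
exact: (@is_derive1_comp _ (@expR R) (fun t => k * t) x _ _ _ (is_derive_linear k x)).
Qed.

Let LF (t w : R) := - (expR (- t * w) * (t * sin w + cos w)) / (1 + t ^+ 2).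

Lemma is_derive_laplace_sin (t w : R) : is_derive w 1 (LF t) (expR (- t * w) * sin w).
Proof.
have t2 : 1 + t ^+ 2 != 0 by rewrite gt_eqF// ltr_pwDl// sqr_ge0.
have d1 := is_derive_expRM (- t) w.
have ds : is_derive w 1 (t *: (@sin R)) (t *: cos w) by apply: is_deriveZ.
have d2 := is_deriveM d1 (is_deriveD ds (is_derive_cos w)).
have e2 : (t *: (@sin R) + @cos R) w = t * sin w + cos w by [].
rewrite e2 in d2.
have d3 := is_deriveZ (- (1 + t ^+ 2)^-1) d2.
move: d3; rewrite /GRing.scale /=; set X := (X in is_derive _ _ _ X -> _); move=> H.
have -> : expR (- t * w) * sin w = X by rewrite /X; field.
have -> : LF t = (fun x : R => - (1 + t ^+ 2)^-1 * (expR (- t * x) * (t * sin x + cos x))).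
  by apply/funext => x; rewrite /LF; field.
exact: H.
Qed.

Lemma laplace_sin (t : R) : 0 < t ->
  mu.-integrable `]0, +oo[ (EFin \o (fun w => expR (- t * w) * sin w)) /\
  \int[mu]_(w in `]0, +oo[) (expR (- t * w) * sin w) = (1 + t ^+ 2)^-1.
Proof.
move=> t0; have t2 : 0 < 1 + t ^+ 2 by rewrite ltr_pwDl// sqr_ge0.
have cf : forall x : R, 0 < x -> continuous_at x (fun w => expR (- t * w) * sin w).
  move=> x _; apply: cvgM; last exact: continuous_sin.
  apply: (@continuous_comp _ _ _ (fun w => - t * w) (@expR R)); last exact: continuous_expR.
  by apply: cvgMr; exact: cvg_id.
have s1 (x : R) : `|sin x| <= 1 by rewrite ler_norml sin_geN1 sin_le1.
have fle (w : R) : `|expR (- t * w) * sin w| <= expR (- t * w).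
  by rewrite normrM ger0_norm ?expR_ge0// ler_piMr ?expR_ge0.
have dec (w : R) : 0 < w -> expR (- t * w) <= (2 / (t * w)) ^+ 2.
  by move=> w0; rewrite mulNr; apply: expRN_le_invX => //; rewrite mulr_gt0.
have If : mu.-integrable `]0, +oo[ (EFin \o (fun w => expR (- t * w) * sin w)).
  apply: (@integrable_oy R _ 0 2 (1 + 4 / t ^+ 2)) => //.
  - by lra.
  - move=> x /andP[x0 x1]; rewrite powRr0 mulr1; apply: (le_trans (fle x)).
    apply: (@le_trans _ _ 1); last by rewrite lerDl divr_ge0// sqr_ge0.
    by rewrite -expR0 ler_expR mulNr oppr_le0 mulr_ge0// ltW.
  - move=> x x1; have x0 : 0 < x by lra.
    apply: (le_trans (fle x)); apply: (le_trans (dec x x0)).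
    rewrite powR_invn; last exact: ltW.
    have -> : (2 / (t * x)) ^+ 2 = 4 / t ^+ 2 * x ^- 2.
      by field; rewrite !gt_eqF.
    by rewrite ler_pM2r ?invr_gt0 ?exprn_gt0// lerDr.
split=> //.
rewrite -[RHS]opprK -[RHS]sub0r.
have -> : - (1 + t ^+ 2)^-1 = LF t 0 by rewrite /LF mulr0 expR0 sin0 cos0 mulr0 add0r mulr1 mulN1r.
apply: (@FTC_oy R _ (LF t)) => //.
- by move=> x _; exact: is_derive_laplace_sin.
- apply: cvg_at_invS; apply: differentiable_continuous; apply/derivable1_diffP.
  exact: (@ex_derive _ _ _ _ _ _ _ (is_derive_laplace_sin t 0)).
- apply/cvgrPdist_le => e e0.
  pose D := (2 / t) ^+ 2 * ((t + 1) / (1 + t ^+ 2)).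
  have D0 : 0 <= D.
    by rewrite mulr_ge0 ?sqr_ge0// divr_ge0 ?(ltW t2)//; lra.
  have : D * n.+1%:R `^ (- 1) @[n --> \oo] --> D * 0 by apply: cvgMr; exact: cvg_powR_nat.
  rewrite mulr0 => /cvgrPdist_le/(_ e e0); apply: filterS => n.
  rewrite !sub0r !normrN => H; apply: le_trans H.
  have Dn : 0 <= D * n.+1%:R `^ (- 1) by rewrite mulr_ge0// powR_ge0.
  rewrite (ger0_norm Dn) powR_inv1; last exact: ler0n.
  clear Dn.
  have n1 : 1 <= n.+1%:R :> R by rewrite ler1n.
  move: (n.+1%:R : R) n1 => y y1; have y0 : 0 < y by lra.
  have y2 : y^-1 ^+ 2 <= y^-1.
    by rewrite expr2 ler_piMr ?invr_ge0 ?(ltW y0)// invf_le1.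
  rewrite /LF normrM normrN normrM [`|expR _|]ger0_norm ?expR_ge0//.
  rewrite [`|_^-1|]ger0_norm ?invr_ge0 ?(ltW t2)//.
  have c1 : `|cos y| <= 1 by rewrite ler_norml cos_geN1 cos_le1.
  have tsc : `|t * sin y + cos y| <= t + 1.
    apply: (le_trans (ler_normD _ _)); apply: lerD => //.
    by rewrite normrM gtr0_norm// ler_piMr// ltW.
  apply: (@le_trans _ _ ((2 / (t * y)) ^+ 2 * (t + 1) / (1 + t ^+ 2))).
    rewrite ler_pM2r ?invr_gt0//; apply: ler_pM => //; try exact: expR_ge0.
    exact: dec.
  have -> : (2 / (t * y)) ^+ 2 * (t + 1) / (1 + t ^+ 2) = D * y^-1 ^+ 2.
    by rewrite /D; field; rewrite !gt_eqF.
  by rewrite ler_wpM2l.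
Qed.

Definition sin_mellin (s : R) := \int[mu]_(w in `]0, +oo[) (w `^ (- 1 - s) * sin w).

Lemma normr_sin_le (x : R) : `|sin x| <= `|x|.
Proof.
have H (y : R) : 0 <= y -> `|sin y| <= y.
  move=> y0.
  have : \int[mu]_(t in `[0, y]) cos t = sin y - sin 0.
    apply: Rint_FTC => //; apply: cont_on_continuous; exact: continuous_cos.
  rewrite sin0 subr0 => <-; rewrite -[leRHS]mul1r -[X in _ * X](subr0 y).
  apply: Rint_norm_le => //; first by apply: cont_on_continuous; exact: continuous_cos.
  by move=> t _; rewrite ler_norml cos_geN1 cos_le1.
by have [x0|x0] := ger0P x; [exact: H|rewrite -normrN -sinN H// oppr_ge0 ltW].
Qed.

Lemma continuous_sinM (k : R) : continuous (fun x => sin (k * x)).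
Proof.
move=> x; apply: (@continuous_comp _ _ _ (fun x => k * x) (@sin R)).
  by apply: cvgMr; exact: cvg_id.
exact: continuous_sin.
Qed.

Lemma continuous_expRNM (k : R) : continuous (fun x => expR (- (k * x))).
Proof.
move=> x; apply: (@continuous_comp _ _ _ (fun x => - (k * x)) (@expR R)).
  by apply: cvgN; apply: cvgMr; exact: cvg_id.
exact: continuous_expR.
Qed.

Lemma powR_mulX1 (x e : R) : 0 < x -> x `^ e * x = x `^ (e + 1).
Proof.
by move=> x0; rewrite powRD ?(gt_eqF x0) ?implybT// powRr1// ltW.
Qed.

(** At 0 the sine lowers the singularity to [w ^ (- s)], integrable as [s < 1]; at infinity [s > 0]
    suffices. *)
Lemma integrable_sin_mellin (s c : R) : 0 < s < 1 ->
  mu.-integrable `]0, +oo[ (EFin \o (fun w => w `^ (- 1 - s) * sin (c * w))).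
Proof.
move=> /andP[s0 s1]; apply: (@integrable_oy R _ (- s) (1 + s) (1 + `|c|)).
- lra.
- lra.
- move=> x x0; apply: cvgM; first exact: continuous_at_powR.
  exact: continuous_sinM.
- move=> x /andP[x0 x1]; rewrite normrM ger0_norm ?powR_ge0//.
  apply: (@le_trans _ _ ((1 + `|c|) * (x `^ (- 1 - s) * x))); last first.
    rewrite powR_mulX1// (_ : - 1 - s + 1 = - s)//; ring.
  rewrite mulrCA ler_wpM2l ?powR_ge0//.
  apply: (le_trans (normr_sin_le _)); rewrite normrM (gtr0_norm x0).
  by rewrite ler_wpM2r ?lerDr// ltW.
- move=> x x1; rewrite normrM ger0_norm ?powR_ge0// mulrC.
  have -> : - 1 - s = - (1 + s) by ring.
  rewrite ler_wpM2r ?powR_ge0//; apply: (@le_trans _ _ 1); last by rewrite lerDl.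
  by rewrite ler_norml sin_geN1 sin_le1.
Qed.

Lemma integral_indicM (D : set R) (g : R -> R) :
  (\int[mu]_t (\1_D t * g t)%:E = \int[mu]_(t in D) (g t)%:E)%E.
Proof.
rewrite [RHS]integral_mkcond; apply: eq_integral => t _.
by rewrite patchE indicE; case: (t \in D); rewrite ?mul1r ?mul0r.
Qed.

Let P := (`]0, +oo[%classic : set (measurableTypeR R)).

Let mP : measurable P. Proof. exact: measurable_itv. Qed.

Let inP w : (w \in P) = (0 < w).
Proof. by apply/idP/idP; rewrite inE /P /= in_itv /= andbT. Qed.

(** Indicators extend the integrand by 0, so that measurability and Fubini live on the whole plane;
    [z.1] is [w] and [z.2] is [t]. *)
Let fub (s : R) (z : measurableTypeR R * measurableTypeR R) : R :=
  \1_P z.1 * \1_P z.2 * (z.2 `^ s * expR (- (z.1 * z.2)) * sin z.1).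

Lemma measurable_fub s : measurable_fun setT (fub s).
Proof.
have m1 : measurable_fun setT (fun z : measurableTypeR R * measurableTypeR R => z.1) by exact: measurable_fst.
have m2 : measurable_fun setT (fun z : measurableTypeR R * measurableTypeR R => z.2) by exact: measurable_snd.
have mI : measurable_fun setT (\1_P : measurableTypeR R -> R) by apply: measurable_indic.
apply: measurable_funM.
  by apply: measurable_funM; [exact: (measurableT_comp mI m1)|exact: (measurableT_comp mI m2)].
apply: measurable_funM; last first.
  by apply: (measurableT_comp _ m1); apply: continuous_measurable_fun; exact: continuous_sin.
apply: measurable_funM.
  exact: (measurableT_comp (@measurable_powR R s) m2).
apply: (measurableT_comp (@measurable_expR R)); apply: measurableT_comp => //.
exact: measurable_funM.
Qed.

Lemma integrable_gamma_scaled (s w : R) : 0 < s < 1 -> 0 < w ->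
  mu.-integrable P (EFin \o (fun t => t `^ s * expR (- (w * t)))).
Proof.
move=> /andP[s0 s1] w0; apply/integrableP; split.
  apply/measurable_EFinP; apply: measurable_oy => x x0; apply: cvgM.
    exact: continuous_at_powR.
  exact: continuous_expRNM.
have := @integral_gamma_fun_scaled R s w _ _ w0.
under eq_integral => t _.
  rewrite -[_%:E]gee0_abs; last by rewrite lee_fin mulr_ge0 ?powR_ge0 ?expR_ge0.
  over.
move=> -> //; rewrite ?ltry//; lra.
Qed.

(** The kernel [t^s exp (- w t) sin w] in both orders: over [t] first it gives [w^(- 1 - s)] with
    the Gamma factor, over [w] first the Laplace transform of the sine. *)
Lemma gamma_sin_mellin (s : R) : 0 < s < 1 ->
  gammaI s * sin_mellin s = \int[mu]_(t in `]0, +oo[) (t `^ s / (1 + t ^+ 2)).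
Proof.
move=> s01; have /andP[s0 s1] := s01.
have Is := integrable_sin_mellin 1 s01.
have h1 (w : R) : (\int[mu]_t (fub s (w, t))%:E)%E =
    (\1_P w * (w `^ (- 1 - s) * sin w * gammaI s))%:E.
  rewrite /fub /=.
  under eq_integral do rewrite (mulrC (\1_P w)) -(mulrA (\1_P _) (\1_P w)).
  rewrite (@integral_indicM P (fun t => \1_P w * (t `^ s * expR (- (w * t)) * sin w))).
  rewrite indicE inP; case: (ltP 0 w) => w0; last first.
    by rewrite mul0r; apply: integral0_eq => t _; rewrite mul0r.
  rewrite mul1r; under eq_integral do rewrite mul1r mulrC EFinM.
  rewrite integralZl//; last exact: integrable_gamma_scaled.
  by rewrite integral_gamma_fun_scaled//; [rewrite -EFinM; congr EFin; ring|lra|lra].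
have n1 (x : R) : `|\1_P x| = \1_P x :> R by rewrite indicE ger0_norm.
have h1a (w : R) : (\int[mu]_t `|(fub s (w, t))%:E|)%E =
    (\1_P w * (w `^ (- 1 - s) * `|sin w| * gammaI s))%:E.
  under eq_integral => t _.
    have -> : `|(fub s (w, t))%:E|%E = (\1_P t * (\1_P w * (t `^ s * expR (- (w * t)) * `|sin w|)))%:E.
      rewrite abse_EFin /fub /= !normrM !(ger0_norm (powR_ge0 _ _)) (ger0_norm (expR_ge0 _)).
      by rewrite !n1; congr EFin; ring.
    over.
  rewrite (@integral_indicM P (fun t => \1_P w * (t `^ s * expR (- (w * t)) * `|sin w|))).
  rewrite indicE inP; case: (ltP 0 w) => w0; last first.
    by rewrite mul0r; apply: integral0_eq => t _; rewrite mul0r.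
  rewrite mul1r; under eq_integral do rewrite mul1r mulrC EFinM.
  rewrite integralZl//; last exact: integrable_gamma_scaled.
  by rewrite integral_gamma_fun_scaled//; [rewrite -EFinM; congr EFin; ring|lra|lra].
have h2 (t : R) : (\int[mu]_w (fub s (w, t))%:E)%E = (\1_P t * (t `^ s / (1 + t ^+ 2)))%:E.
  rewrite /fub /=.
  under eq_integral do rewrite -(mulrA (\1_P _) (\1_P t)).
  rewrite (@integral_indicM P (fun w => \1_P t * (t `^ s * expR (- (w * t)) * sin w))).
  rewrite indicE inP; case: (ltP 0 t) => t0; last first.
    by rewrite mul0r; apply: integral0_eq => w _; rewrite mul0r.
  have [Il Vl] := laplace_sin t0.
  rewrite mul1r -Vl; under eq_integral => w _.
    rewrite mul1r -mulrA EFinM (mulrC w) -mulNr; over.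
  rewrite integralZl// EFinM; congr (_ * _)%E.
  by rewrite /Rintegral fineK//; apply: integrable_fin_num.
have mf : measurable_fun setT (EFin \o fub s) by apply/measurable_EFinP; exact: measurable_fub.
(* Absolute integrability by Tonelli: integrating the modulus over [t] leaves [w^(- 1 - s) |sin w|]
   up to a constant. *)
have If : (mu \x mu)%E.-integrable setT (EFin \o fub s).
  apply/integrable12ltyP => //=; under eq_integral do rewrite h1a.
  rewrite (@integral_indicM P (fun w => w `^ (- 1 - s) * `|sin w| * gammaI s)).
  have g0 : 0 <= gammaI s by apply: Rintegral_ge0 => t _; exact: gamma_fun_ge0.
  under eq_integral do rewrite mulrC EFinM.
  rewrite ge0_integralZl//; first last.
  - by move=> w _; rewrite lee_fin mulr_ge0 ?powR_ge0.
  - apply/measurable_EFinP; apply: measurable_oy => x x0; apply: cvgM.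
      exact: continuous_at_powR.
    by apply: cvg_norm; exact: continuous_sin.
  rewrite lte_mul_pinfty// ?lee_fin//.
  move/integrableP: Is => [_]; apply: le_lt_trans; rewrite le_eqVlt; apply/orP; left; apply/eqP.
  apply: eq_integral => w _; rewrite /= mul1r normrM ger0_norm ?powR_ge0//.
have := Fubini If; rewrite /=.
under eq_integral do rewrite h1.
under [X in _ = X -> _]eq_integral do rewrite h2.
rewrite !integral_indicM => /(congr1 fine) E.
rewrite -[RHS]E; rewrite -[RHS]/(\int[mu]_(w in P) (w `^ (- 1 - s) * sin w * gammaI s)).
rewrite RintegralZr//; first by rewrite mulrC.
by move: Is; under [X in mu.-integrable _ (_ \o X) -> _]eq_fun do rewrite mul1r.
Qed.

End SineIntegral.

(** * The integral of [t^s / (1 + t^2)] and the cosecant series *)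

Section SecantIntegral.
Variable R : realType.
Local Notation mu := (@lebesgue_measure R).

(** Unrolling [u k = b k - u k.+1], the remainder is [u N] up to sign. With [u k] the integral of
    [t^(e k) / (1 + t^2)], this is the geometric expansion under the integral without any exchange
    of limits. *)
Lemma alternating_remainder (u b : nat -> R) : (forall k, 0 <= u k <= b k) ->
  (forall k, u k + u k.+1 = b k) ->
  forall N, `|u 0%N - \sum_(k < N) (-1) ^+ k * b k| <= b N.
Proof.
move=> ub ur N.
have -> : u 0%N - \sum_(k < N) (-1) ^+ k * b k = (-1) ^+ N * u N.
  elim: N => [|N IH]; first by rewrite big_ord0 subr0 expr0 mul1r.
  by rewrite big_ord_recr /= opprD addrA IH -ur exprS; ring.
have /andP[u0 uN] := ub N.
by rewrite normrM normrX normrN1 expr1n mul1r ger0_norm.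
Qed.

Lemma continuous_inv_1Dsqr (x : R) : continuous_at x (fun t => (1 + t ^+ 2)^-1).
Proof.
apply: cvgV; first by rewrite gt_eqF// ltr_pwDl// sqr_ge0.
by apply: cvgD; [exact: cvg_cst|apply: cvgM; exact: cvg_id].
Qed.

Lemma powR_div_recurrence (D : set R) (a b : nat -> R) (e : nat -> R) (c : nat -> R) :
  exhausts D a b -> (forall x, D x -> 0 < x) ->
  (forall k, mu.-integrable D (EFin \o (fun t => t `^ (e k)))) ->
  (forall k, \int[mu]_(t in D) (t `^ (e k)) = c k) ->
  (forall k t, D t -> t `^ (e k) / (1 + t ^+ 2) <= t `^ (e k)) ->
  forall k, mu.-integrable D (EFin \o (fun t => t `^ (e k) / (1 + t ^+ 2))) /\
    0 <= \int[mu]_(t in D) (t `^ (e k) / (1 + t ^+ 2)) <= c k.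
Proof.
move=> eD D0 Ie Ic le k; have mD := exhausts_measurable eD.
have q0 (t : R) : 0 <= t `^ e k / (1 + t ^+ 2).
  by rewrite divr_ge0 ?powR_ge0// addr_ge0// sqr_ge0.
have I1 : mu.-integrable D (EFin \o (fun t => t `^ (e k) / (1 + t ^+ 2))).
  apply: (@le_integrable _ _ _ mu _ mD _ (EFin \o (fun t => t `^ (e k)))) => //.
    apply/measurable_EFinP; apply: (exhausts_measurable_fun eD) => x Dx.
    apply: cvgM; first by apply: continuous_at_powR; exact: D0.
    exact: continuous_inv_1Dsqr.
  by move=> x Dx; rewrite /= lee_fin !ger0_norm ?powR_ge0// le.
split=> //; apply/andP; split; first by apply: Rintegral_ge0 => t _.
by rewrite -Ic; apply: le_Rintegral => // t; exact: le.
Qed.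

Lemma sqr_div_le1 (t : R) : (1 + t ^+ 2)^-1 <= 1.
Proof. by rewrite invf_le1 ?lerDl ?sqr_ge0// ltr_pwDl// sqr_ge0. Qed.

Lemma alternating_oc (s : R) : -1 < s -> forall N,
  `|\int[mu]_(t in `]0, 1]) (t `^ s / (1 + t ^+ 2)) -
    \sum_(k < N) (-1) ^+ k * (s + 2 * k%:R + 1)^-1| <= (s + 2 * N%:R + 1)^-1.
Proof.
move=> s1 N; have eD := exhausts_oc (@ltr01 R).
pose e k := s + 2 * k%:R.
have e1 k : -1 < e k by rewrite (lt_le_trans s1)// lerDl mulr_ge0.
have D0 (x : R) : `]0, 1]%classic x -> 0 < x by rewrite /= in_itv /= => /andP[].
have Ie k := integral_powR_oc (e1 k) (@ltr01 R).
have H := @powR_div_recurrence _ _ _ e (fun k => (e k + 1)^-1) eD D0 (fun k => (Ie k).1).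
have {}H k : mu.-integrable `]0, 1] (EFin \o (fun t => t `^ (e k) / (1 + t ^+ 2))) /\
    0 <= \int[mu]_(t in `]0, 1]) (t `^ (e k) / (1 + t ^+ 2)) <= (e k + 1)^-1.
  apply: H => [j|j t _]; first by rewrite (Ie j).2 powR1 mul1r.
  by rewrite ler_piMr ?powR_ge0// sqr_div_le1.
have -> : s = e 0%N by rewrite /e mulr0 addr0.
have rec k : \int[mu]_(t in `]0, 1]) (t `^ (e k) / (1 + t ^+ 2)) +
    \int[mu]_(t in `]0, 1]) (t `^ (e k.+1) / (1 + t ^+ 2)) = (e k + 1)^-1.
  rewrite -RintegralD//; [|exact: (H k).1|exact: (H k.+1).1].
  have -> : (e k + 1)^-1 = \int[mu]_(t in `]0, 1]) (t `^ (e k)).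
    by rewrite (Ie k).2 powR1 mul1r.
  apply: eq_Rintegral => t; rewrite inE => /D0 t0.
  have -> : e k.+1 = e k + 1 + 1 by rewrite /e -natr1; ring.
  rewrite -!powR_mulX1//; field.
  by rewrite gt_eqF// ltr_pwDl// sqr_ge0.
have := @alternating_remainder (fun k => \int[mu]_(t in `]0, 1]) (t `^ (e k) / (1 + t ^+ 2)))
  (fun k => (e k + 1)^-1) (fun k => (H k).2) rec N.
by rewrite /e mulr0 addr0.
Qed.

(** Mirror image of the expansion on []0, 1]] under [t -> 1 / t], in falling powers. With [- s] for
    [s] it treats the part of the integral beyond 1. *)
Lemma alternating_cy (s : R) : -1 < s -> forall N,
  `|\int[mu]_(t in `[1, +oo[) (t `^ (- s) / (1 + t ^+ 2)) -
    \sum_(k < N) (-1) ^+ k * (s + 2 * k%:R + 1)^-1| <= (s + 2 * N%:R + 1)^-1.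
Proof.
move=> s1 N; have eD := exhausts_cy (1 : R).
pose e k := s + 2 * k%:R.
have e1 k : -1 < e k by rewrite (lt_le_trans s1)// lerDl mulr_ge0.
have D0 (x : R) : `[1, +oo[%classic x -> 0 < x by rewrite /= in_itv /= andbT; apply: lt_le_trans.
have e2 k : 1 < e k + 2 by have := e1 k; lra.
have Ie k := integral_powR_cy (e2 k).
have ce k : e k + 2 - 1 = e k + 1 by ring.
have mD : measurable (`[1, +oo[%classic : set R) by [].
have dom k (t : R) : 0 < t -> t `^ (- e k) / (1 + t ^+ 2) <= t `^ (- (e k + 2)).
  move=> t0; have -> : - e k = - (e k + 2) + 1 + 1 by ring.
  rewrite -!powR_mulX1// -mulrA -mulrA ler_piMr ?powR_ge0//.
  rewrite mulrA -expr2 ler_pdivrMr ?mul1r ?lerDr//.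
  by rewrite ltr_pwDl// sqr_ge0.
have q0 k (t : R) : 0 <= t `^ (- e k) / (1 + t ^+ 2).
  by rewrite divr_ge0 ?powR_ge0// addr_ge0// sqr_ge0.
have Iq k : mu.-integrable `[1, +oo[ (EFin \o (fun t => t `^ (- e k) / (1 + t ^+ 2))).
  apply: (@le_integrable _ _ _ mu _ mD _ (EFin \o (fun t => t `^ (- (e k + 2))))); last exact: (Ie k).1.
    apply/measurable_EFinP; apply: (exhausts_measurable_fun eD) => x Dx.
    apply: cvgM; first by apply: continuous_at_powR; exact: D0.
    exact: continuous_inv_1Dsqr.
  by move=> x Dx; rewrite /= lee_fin !ger0_norm ?powR_ge0//; apply: dom; exact: D0.
have H k : 0 <= \int[mu]_(t in `[1, +oo[) (t `^ (- e k) / (1 + t ^+ 2)) <= (e k + 1)^-1.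
  apply/andP; split; first by apply: Rintegral_ge0.
  rewrite -ce -(Ie k).2; apply: le_Rintegral => //; first exact: (Ie k).1.
  by move=> t /D0; exact: dom.
have -> : s = e 0%N by rewrite /e mulr0 addr0.
have rec k : \int[mu]_(t in `[1, +oo[) (t `^ (- e k) / (1 + t ^+ 2)) +
    \int[mu]_(t in `[1, +oo[) (t `^ (- e k.+1) / (1 + t ^+ 2)) = (e k + 1)^-1.
  rewrite -RintegralD// -ce -(Ie k).2.
  apply: eq_Rintegral => t; rewrite inE => /D0 t0.
  have -> : - e k.+1 = - (e k + 2) by rewrite /e -natr1; ring.
  have -> : - e k = - (e k + 2) + 1 + 1 by ring.
  rewrite -!powR_mulX1//; field.
  by rewrite gt_eqF// ltr_pwDl// sqr_ge0.
have := @alternating_remainder (fun k => \int[mu]_(t in `[1, +oo[) (t `^ (- e k) / (1 + t ^+ 2)))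
  (fun k => (e k + 1)^-1) H rec N.
by rewrite /e mulr0 addr0.
Qed.

Lemma cos_natpi (k : nat) : cos (k%:R * pi : R) = (-1) ^+ k.
Proof.
elim: k => [|k IH]; first by rewrite mul0r cos0.
by rewrite -natr1 mulrDl mul1r cosDpi IH exprS mulN1r.
Qed.

Section Cosecant.
Variable q : R.
Hypothesis q01 : 0 < q < 1.

Let a k := (-1) ^+ k * sin (pi * q) * q / (pi * (q ^+ 2 - k%:R ^+ 2)).

Let qk (k : nat) : q + k%:R != 0 /\ q - k%:R != 0.
Proof.
move/andP: q01 => [q0 q1]; split; first by rewrite gt_eqF// ltr_pwDl.
case: k => [|k]; first by rewrite subr0 gt_eqF.
by rewrite lt_eqF// subr_lt0 (lt_le_trans q1)// ler1n.
Qed.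

Lemma fourier_cosM (k : nat) :
  \int[mu]_(x in `[0, pi]) (cos (q * x) * cos (k%:R * x)) = pi * a k.
Proof.
have [h1 h2] := qk k; have pi0 := pi_gt0 R.
have h3 : q ^+ 2 - k%:R ^+ 2 != 0 by rewrite subr_sqr mulf_neq0.
transitivity (\int[mu]_(x in `[0, pi]) (2^-1 * (cos ((q + k%:R) * x) + cos ((q - k%:R) * x)))).
  by apply: eq_Rintegral => x _; rewrite mulrDl mulrBl cosD cosB; field.
have cc m : cont_on 0 pi (fun x : R => cos (m * x)).
  by apply: cont_on_continuous; exact: continuous_cosM.
have Ic m : m != 0 -> \int[mu]_(x in `[0, pi]) cos (m * x) = sin (m * pi) / m.
  move=> m0; have -> : sin (m * pi) / m = m^-1 * sin (m * pi) - m^-1 * sin (m * 0).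
    by rewrite mulr0 sin0 mulr0 subr0 mulrC.
  apply: (@Rint_FTC R 0 pi (fun x => cos (m * x)) (fun x => m^-1 * sin (m * x))) => //.
    exact: ltW.
  move=> x _.
  have -> : cos (m * x) = m^-1 *: (m * cos (m * x)) by rewrite /GRing.scale /= mulKf.
  by apply: is_deriveZ; exact: is_derive_sinM.
rewrite RintZl ?RintD ?Ic//; last exact: cont_onD.
rewrite mulrDl mulrBl sinD sinB sin_natpi cos_natpi !mulr0 addr0 subr0 /a (mulrC q pi).
rewrite subr_sqr; clear cc Ic; move: (sin (pi * q)) => S; move: (@pi R) pi0 => u u0; field.
by rewrite h1 h2 gt_eqF.
Qed.

(* Evaluating the cosine series of [cos (q x)] at [x = 0]. *)
Lemma cosecant_series :
  a 0%N + \sum_(r < N) 2 * a r.+1 @[N --> \oo] --> (1 : R).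
Proof.
have pi0 := pi_gt0 R; move/andP: (q01) => [q0 q1].
have q2 : q ^+ 2 < 1 by rewrite expr_lt1// ltW.
pose C := `|sin (pi * q) * q / pi| / (1 - q ^+ 2).
have C0 : 0 <= C by rewrite divr_ge0// subr_ge0 ltW.
have aC r : `|a r.+1| <= C * r.+1%:R ^- 2.
  have -> : a r.+1 = (-1) ^+ r.+1 * (sin (pi * q) * q / pi) * (q ^+ 2 - r.+1%:R ^+ 2)^-1.
    by rewrite /a invfM; ring.
  rewrite normrM normrM normrX normrN1 expr1n mul1r /C -[leRHS]mulrA ler_wpM2l//.
  have r1 : 1 <= r.+1%:R ^+ 2 :> R by rewrite exprn_ege1// ler1n.
  rewrite normfV -invfM lef_pV2 ?posrE; first last.
  - by rewrite mulr_gt0 ?subr_gt0//; lra.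
  - by rewrite normr_gt0 subr_eq0 lt_eqF//; lra.
  rewrite ler0_norm; last by rewrite subr_le0; lra.
  rewrite opprB mulrBl mul1r lerB//.
  by rewrite ler_peMr ?sqr_ge0.
pose t N := C * (2 / N.+1%:R).
have tt : t N @[N --> \oo] --> (0 : R).
  rewrite /t -(mulr0 C); apply: cvgMr; rewrite -(mulr0 2); apply: cvgMr.
  exact: cvg_harmonic.
have tail N N' : (N <= N')%N -> \sum_(N <= r < N') `|a r.+1| <= t N.
  move=> NN; apply: (@le_trans _ _ (\sum_(N <= r < N') C * r.+1%:R ^- 2)).
    by apply: ler_sum.
  by rewrite -mulr_sumr ler_wpM2l// sum_inv_square.
have cc : cont_on 0 pi (fun x : R => cos (q * x)).
  by apply: cont_on_continuous; exact: continuous_cosM.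
have H := cosine_series cc tt tail fourier_cosM.
have t2 : 2 * t N @[N --> \oo] --> (0 : R) by rewrite -(mulr0 2); apply: cvgMr.
apply/cvgrPdist_le => e e0.
move/cvgrPdist_le: t2 => /(_ e e0); apply: filterS => N.
rewrite sub0r normrN => h; apply: le_trans (le_trans (ler_norm _) h).
have := H N 0; rewrite lexx ltW// => /(_ isT); rewrite mulr0 cos0.
by under eq_bigr do rewrite mulr0 cos0 mulr1.
Qed.

End Cosecant.

(** Splitting at 1 and expanding produces the alternating sum of [1 / (2 (q + k))] and
    [1 / (2 (k + 1 - q))] with [q = (1 + s) / 2], which is the partial fraction expansion of the
    cosecant of [pi q]. *)
Lemma integral_secant (s : R) : 0 < s < 1 ->
  \int[mu]_(t in `]0, +oo[) (t `^ s / (1 + t ^+ 2)) = pi / (2 * cos (pi * s / 2)).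
Proof.
move=> /andP[s0 s1]; have pi0 := pi_gt0 R.
have If : mu.-integrable `]0, +oo[ (EFin \o (fun t => t `^ s / (1 + t ^+ 2))).
  apply: (@integrable_oy R _ s (2 - s) 1).
  - lra.
  - lra.
  - move=> x x0; apply: cvgM; [exact: continuous_at_powR|exact: continuous_inv_1Dsqr].
  - move=> x _; rewrite mul1r ger0_norm; last by rewrite divr_ge0 ?powR_ge0// addr_ge0// sqr_ge0.
    by rewrite ler_piMr ?powR_ge0// sqr_div_le1.
  - move=> x x1; have x0 : 0 < x by lra.
    rewrite mul1r ger0_norm; last by rewrite divr_ge0 ?powR_ge0// addr_ge0// sqr_ge0.
    have -> : x `^ s = x `^ (- (2 - s)) * x ^+ 2.
      by rewrite expr2 mulrA !powR_mulX1//; congr powR; ring.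
    rewrite -mulrA ler_piMr ?powR_ge0// ler_pdivrMr ?mul1r ?lerDr//.
    by rewrite ltr_pwDl// sqr_ge0.
have E : `]0, +oo[%classic = `]0, 1]%classic `|` `]1, +oo[%classic :> set R.
  apply/seteqP; split => x /=; rewrite !in_itv /= !andbT.
    by move=> x0; have [x1|x1] := leP x 1; [left; rewrite x0|right].
  by case=> [/andP[]//|x1]; rewrite (lt_trans ltr01).
set M := LHS.
have ME : M = \int[mu]_(t in `]0, 1]) (t `^ s / (1 + t ^+ 2)) +
    \int[mu]_(t in `[1, +oo[) (t `^ (- - s) / (1 + t ^+ 2)).
  rewrite opprK /M E Rintegral_setU//; last 2 first.
  - by rewrite -E.
  - apply/disj_setPS => y [/=]; rewrite !in_itv /= andbT => /andP[_ y1].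
    by rewrite ltNge y1.
  congr (_ + _); apply: Rintegral_itv_obnd_cbnd.
  by apply: integrableS If => // x /=; rewrite !in_itv /= !andbT; apply: lt_trans.
pose q := (1 + s) / 2.
have q01 : 0 < q < 1 by rewrite /q; apply/andP; split; lra.
have sq : sin (pi * q) = cos (pi * s / 2).
  have -> : pi * q = pi * s / 2 + pi / 2 by rewrite /q; field.
  by rewrite sinD cos_pihalf sin_pihalf mulr0 mulr1 add0r.
have c0 : 0 < cos (pi * s / 2).
  apply: cos_gt0_pihalf; apply/andP; split; last by rewrite ltr_pM2r// gtr_pMr.
  by apply: (@lt_le_trans _ _ 0); [rewrite oppr_lt0 divr_gt0|rewrite divr_ge0// mulr_ge0// ltW].
pose b k := (-1) ^+ k * ((s + 2 * k%:R + 1)^-1 + (- s + 2 * k%:R + 1)^-1).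
have bM N : `|M - \sum_(k < N) b k| <= (s + 2 * N%:R + 1)^-1 + (- s + 2 * N%:R + 1)^-1.
  have h1 := alternating_oc (_ : -1 < s) N; have h2 := alternating_cy (_ : -1 < - s) N.
  have -> : M - \sum_(k < N) b k =
   (\int[mu]_(t in `]0, 1]) (t `^ s / (1 + t ^+ 2)) - \sum_(k < N) (-1) ^+ k * (s + 2 * k%:R + 1)^-1) +
   (\int[mu]_(t in `[1, +oo[) (t `^ (- - s) / (1 + t ^+ 2)) - \sum_(k < N) (-1) ^+ k * (- s + 2 * k%:R + 1)^-1).
    rewrite ME addrACA -opprD -big_split /=; congr (_ - _).
    by apply: eq_bigr => k _; rewrite /b mulrDr.
  by apply: (le_trans (ler_normD _ _)); apply: lerD; [apply: h1|apply: h2]; lra.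
pose a k := (-1) ^+ k * sin (pi * q) * q / (pi * (q ^+ 2 - k%:R ^+ 2)).
(* As functions of [q], the cosecant series pairs the poles [k] and [- k], whereas [b] pairs [- k]
   and [k + 1]. Regrouping leaves one boundary term, which tends to 0. *)
have ab N : \sum_(k < N) b k = pi / (2 * cos (pi * s / 2)) * (a 0%N + \sum_(r < N) 2 * a r.+1)
    + (-1) ^+ N.+1 / (2 * (q + N%:R)).
  have sE : s = 2 * q - 1 by rewrite /q; field.
  move/andP: q01 => [q0 q1].
  elim: N => [|N IH].
    rewrite !big_ord0 /a expr0 expr1 sq.
    move: (cos (pi * s / 2)) c0 => C cp; move: (@pi R) pi0 => u u0.
    rewrite mulr0n expr0n /= subr0 !addr0; field.
    by rewrite !gt_eqF.
  rewrite !big_ord_recr /= IH.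
  have step : b N = pi / (2 * cos (pi * s / 2)) * (2 * a N.+1)
      + (-1) ^+ N.+2 / (2 * (q + N.+1%:R)) - (-1) ^+ N.+1 / (2 * (q + N%:R)).
    rewrite /a /b sq {IH bM ME}.
    have N0 : 0 <= N%:R :> R by [].
    have -> : N.+1%:R = N%:R + 1 :> R by rewrite -natr1.
    rewrite ![(-1) ^+ _.+1]exprS.
    move: (N%:R : R) N0 => y y0; move: ((-1) ^+ N) => g.
    move: (cos (pi * s / 2)) c0 => C cp; move: (@pi R) pi0 => u u0.
    rewrite sE; clearbody q; field.
    rewrite (gt_eqF cp) (gt_eqF u0) /=.
    have -> : q ^+ 2 - (y + 1) ^+ 2 = (q - y - 1) * (q + y + 1) by ring.
    rewrite mulf_eq0 !negb_or.
    rewrite [q - y - 1 == 0]lt_eqF; last by lra.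
    by rewrite !gt_eqF//; lra.
  by rewrite step [a 0%N + (_ + _)]addrA !mulrDr; ring.
set X := pi / _ in ab *; pose S N := a 0%N + \sum_(r < N) 2 * a r.+1.
(* One summand for each error: the remainders of the two expansions and the boundary term of the
   regrouping, each compared with [1 / N.+1]. *)
pose K := 1 + (1 - s)^-1 + (2 * q)^-1.
have s1' : 0 < 1 - s by rewrite subr_gt0.
move/andP: (q01) => [q0 q1].
have MS N : `|M - X * S N| <= K * N.+1%:R^-1.
  have N0 : 0 <= N%:R :> R by [].
  have NE : N.+1%:R = N%:R + 1 :> R by rewrite -natr1.
  have N1 : 0 < N.+1%:R :> R by rewrite ltr0n.
  have qN : 0 < q + N%:R by rewrite ltr_pwDl.
  have -> : M - X * S N = (M - \sum_(k < N) b k) + (-1) ^+ N.+1 / (2 * (q + N%:R)).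
    by rewrite ab /S; ring.
  apply: (le_trans (ler_normD _ _)); rewrite /K [leRHS]mulrDl.
  apply: lerD; first (apply: (le_trans (bM N)); rewrite [leRHS]mulrDl mul1r; apply: lerD).
  - by rewrite lef_pV2 ?posrE// ?NE; lra.
  - rewrite -invfM lef_pV2 ?posrE ?mulr_gt0// ?NE; last by lra.
    by rewrite -subr_ge0 (_ : _ - _ = N%:R * (1 + s))//; [rewrite mulr_ge0//; lra|ring].
  - rewrite normrM normrX normrN1 expr1n mul1r normfV gtr0_norm ?mulr_gt0//.
    have -> : (2 * q)^-1 / N.+1%:R = (2 * q * N.+1%:R)^-1 by rewrite [RHS]invfM.
    have h : 2 * q * N.+1%:R <= 2 * (q + N%:R).
      rewrite NE -subr_ge0 (_ : _ - _ = 2 * N%:R * (1 - q)); last by ring.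
      by rewrite !mulr_ge0// subr_ge0 ltW.
    have p1 : 0 < 2 * q * N.+1%:R by apply: mulr_gt0 => //; apply: mulr_gt0.
    have p2 : 0 < 2 * (q + N%:R) by apply: mulr_gt0; [by []|exact: qN].
    by rewrite lef_pV2.
have cM : X * S N @[N --> \oo] --> M.
  have KN : K * N.+1%:R^-1 @[N --> \oo] --> K * 0 by apply: cvgMr; exact: cvg_harmonic.
  rewrite mulr0 in KN; apply/cvgrPdist_le => e e0.
  move/cvgrPdist_le: KN => /(_ e e0); apply: filterS => N.
  rewrite sub0r normrN => h; apply: le_trans (le_trans (ler_norm _) h).
  exact: MS.
have cX : X * S N @[N --> \oo] --> X * 1 by apply: cvgMr; exact: cosecant_series.
by rewrite mulr1 in cX; exact: (cvg_unique _ cM cX).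
Qed.

(** The exact constant that later cancels both the [Gamma s] of the fractional derivative and the
    cosine of the Riesz normalization. *)
Lemma sin_mellin_constant (s : R) : 0 < s < 1 ->
  2 * cos (pi * s / 2) * (s * Gamma s) * sin_mellin s = pi.
Proof.
move=> s01; have /andP[s0 s1] := s01.
have := gamma_sin_mellin s01; rewrite integral_secant// gammaI_succ// GammaE//; last exact: ltW.
have pi0 := pi_gt0 R.
have c0 : 0 < cos (pi * s / 2).
  apply: cos_gt0_pihalf; apply/andP; split; last by rewrite ltr_pM2r// gtr_pMr.
  by apply: (@lt_le_trans _ _ 0); [rewrite oppr_lt0 divr_gt0|rewrite divr_ge0// mulr_ge0// ltW].
move=> E; rewrite -mulrA E; field.
by rewrite gt_eqF.
Qed.

End SecantIntegral.

(** * Fourier representation of differences of power functions *)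

Section FractionalDifferences.
Variable R : realType.
Local Notation mu := (@lebesgue_measure R).

(* The library sets [y `^ q = 1] for [y < 0], hence the explicit truncation. *)
Definition pospow (q y : R) : R := if 0 < y then y `^ q else 0.

Definition nabla (g : R -> R) (x : R) : R := g x - g (x - 1).
Definition nablas m (g : R -> R) := iter m nabla g.

Lemma nablasS m g x : nablas m.+1 g x = nablas m g x - nablas m g (x - 1).
Proof. by []. Qed.

Lemma eq_nablas m g h : (forall x, g x = h x) -> forall x, nablas m g x = nablas m h x.
Proof. by move=> gh; elim: m => [//|m IH] x; rewrite !nablasS !IH. Qed.

Lemma nablasSr m g x : nablas m.+1 g x = nablas m (nabla g) x.
Proof. by rewrite /nablas iterSr. Qed.

Lemma nablasD m g h x : nablas m (fun y => g y + h y) x = nablas m g x + nablas m h x.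
Proof. by elim: m x => [//|m IH] x; rewrite !nablasS !IH; ring. Qed.

Lemma nablasZ m c g x : nablas m (fun y => c * g y) x = c * nablas m g x.
Proof. by elim: m x => [//|m IH] x; rewrite !nablasS !IH; ring. Qed.

(** Moves a value at the mirrored point, as the right derivative produces it, back to the same point
    with a reflected function. *)
Lemma nablas_reflect m g x :
  nablas m g (m%:R - x) = (-1) ^+ m * nablas m (fun y => g (- y)) x.
Proof.
elim: m x => [|m IH] x; first by rewrite /= sub0r mul1r.
rewrite [LHS]nablasS [in RHS]nablasS.
have -> : m.+1%:R - x = m%:R - (x - 1) by rewrite -natr1; ring.
have -> : m%:R - (x - 1) - 1 = m%:R - x by ring.
by rewrite !IH exprS; ring.
Qed.

Lemma is_derive_comp_affine (f : R -> R) (k c x df : R) : is_derive (k * x + c) 1 f df ->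
  is_derive x 1 (fun y => f (k * y + c)) (k * df).
Proof.
move=> H; rewrite mulrC.
have H2 : is_derive x 1 (fun y => k * y + c) k.
  by have := is_deriveD (is_derive_linear k x) (is_derive_cst c x 1); rewrite addr0.
exact: (@is_derive1_comp _ f (fun y => k * y + c) x _ _ H H2).
Qed.

Lemma is_derive_shift (f : R -> R) (c x df : R) : is_derive (x - c) 1 f df ->
  is_derive x 1 (fun y => f (y - c)) df.
Proof.
move=> H; have := @is_derive_comp_affine f 1 (- c) x df; rewrite !mul1r => /(_ H).
by under [X in is_derive _ _ X _ -> _]eq_fun do rewrite mul1r.
Qed.

Lemma is_derive_nablas m (g g' : R -> R) : (forall x : R, is_derive x 1 g (g' x)) ->
  forall x : R, is_derive x 1 (nablas m g) (nablas m g' x).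
Proof.
move=> dg; elim: m => [//|m IH] x.
have h := is_derive_shift (IH (x - 1)).
exact: (is_deriveB (IH x) h).
Qed.

Lemma is_derive_pospow (q x : R) : 1 < q ->
  is_derive x 1 (pospow q) (q * pospow (q - 1) x).
Proof.
move=> q1; have [x0|x0|->] := ltgtP x 0.
- have -> : q * pospow (q - 1) x = 0 by rewrite /pospow ltNge ltW// mulr0.
  apply: (@near_eq_is_derive _ _ _ (fun=> 0)); rewrite ?oner_neq0//.
  near=> y; rewrite /pospow ltNge ltW//; near: y.
  exact: lt_nbhsl.
- have -> : q * pospow (q - 1) x = q * x `^ (q - 1) by rewrite /pospow x0.
  apply: (@near_eq_is_derive _ _ _ (fun y => y `^ q)); rewrite ?oner_neq0//; last exact: is_derive1_powR.
  near=> y; rewrite /pospow; have -> // : 0 < y.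
  by near: y; exact: lt_nbhsr.
- have -> : q * pospow (q - 1) 0 = 0 by rewrite /pospow ltxx mulr0.
  have H : h^-1 *: (pospow q (h *: 1 + 0) - pospow q 0) @[h --> (0:R)^'] --> (0 : R).
    apply/cvgrPdist_le => e e0.
    have q0 : 0 < q - 1 by rewrite subr_gt0.
    (* For [h > 0] the difference quotient at 0 is [h ^ (q - 1)], so this is the radius for [e]. *)
    have d0 : 0 < e `^ (q - 1)^-1 by rewrite powR_gt0.
    near=> h; rewrite /pospow ltxx subr0 sub0r normrN addr0.
    have hn : h != 0 by near: h; exact: nbhs_dnbhs_neq.
    have hd : `|h| < e `^ (q - 1)^-1.
      by near: h; apply: dnbhs0_lt.
    rewrite /GRing.scale /= mulr1; case: ifP => [h0|_]; last by rewrite mulr0 normr0 ltW.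
    rewrite -{1}(subrK 1 q) -powR_mulX1// mulrCA mulVf// mulr1.
    rewrite ger0_norm ?powR_ge0//; rewrite gtr0_norm// in hd.
    have := @ge0_ler_powR R (q - 1) (ltW q0) h (e `^ (q - 1)^-1).
    rewrite !nnegrE => /(_ (ltW h0) (ltW d0) (ltW hd)).
    by rewrite -powRrM mulVf ?gt_eqF// powRr1// ltW.
  have D : derivable (pospow q) 0 1 by apply: (cvgP 0).
  by apply: DeriveDef => //; apply: cvg_lim.
Unshelve. all: by end_near. Qed.

Lemma is_derive_cstM (c : R) (f : R -> R) (x df : R) : is_derive x 1 f df ->
  is_derive x 1 (fun y => c * f y) (c * df).
Proof. by move=> H; exact: (is_deriveZ c H). Qed.

Lemma is_derive_reflect (f : R -> R) (x df : R) : is_derive (- x) 1 f df ->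
  is_derive x 1 (fun y => f (- y)) (- df).
Proof.
move=> H; have := @is_derive_comp_affine f (-1) 0 x df; rewrite addr0 !mulN1r => /(_ H).
by under [X in is_derive _ _ X _ -> _]eq_fun do rewrite addr0 mulN1r.
Qed.

Section TrigonometricIntegrals.

Definition sine_pow (e : R) (m : nat) (w : R) : R := w `^ e * (2 * sin (w / 2)) ^+ m.

Lemma continuous_sine_pow e m (w : R) : 0 < w -> continuous_at w (sine_pow e m).
Proof.
move=> w0; apply: cvgM; first exact: continuous_at_powR.
have c : continuous_at w (fun w => 2 * sin (w / 2)).
  have h : continuous_at w (fun w : R => sin (w / 2)).
    have -> : (fun w : R => sin (w / 2)) = (fun w => sin (2^-1 * w)).
      by apply/funext => y; rewrite mulrC.
    exact: continuous_sinM.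
  by apply: cvgMr; exact: h.
exact: (continuous_comp c (@exprn_continuous _ m _)).
Qed.

Lemma sine_pow_le e m (w : R) : 0 < w -> `|sine_pow e m w| <= w `^ (e + m%:R).
Proof.
move=> w0; rewrite /sine_pow normrM ger0_norm ?powR_ge0// powRD ?(gt_eqF w0) ?implybT//.
rewrite ler_wpM2l ?powR_ge0// powR_mulrn ?(ltW w0)// normrX lerXn2r ?nnegrE ?(ltW w0)//.
rewrite normrM gtr0_norm// mulrC -ler_pdivlMr//.
by rewrite (le_trans (normr_sin_le _))// normrM !gtr0_norm.
Qed.

Lemma sine_pow_le_cst e m (w : R) : `|sine_pow e m w| <= 2 ^+ m * w `^ e.
Proof.
rewrite /sine_pow normrM ger0_norm ?powR_ge0// mulrC ler_wpM2r ?powR_ge0//.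
rewrite normrX lerXn2r ?nnegrE// normrM gtr0_norm// ler_piMr//.
by rewrite ler_norml sin_geN1 sin_le1.
Qed.

Lemma integrable_sine_pow e m (u : R -> R) : -1 < e + m%:R -> e < -1 ->
  (forall w : R, 0 < w -> continuous_at w u) -> (forall w : R, `|u w| <= 1) ->
  mu.-integrable `]0, +oo[ (EFin \o (fun w => sine_pow e m w * u w)).
Proof.
move=> e1 e2 cu u1; apply: (@integrable_oy R _ (e + m%:R) (- e) (2 ^+ m)) => //.
- by rewrite ltrNr.
- by move=> x x0; apply: cvgM; [exact: continuous_sine_pow|exact: cu].
- move=> x /andP[x0 _]; rewrite normrM.
  apply: (@le_trans _ _ (1 * x `^ (e + m%:R))).
    rewrite mul1r -[leRHS]mulr1; apply: ler_pM => //; exact: sine_pow_le.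
  by rewrite ler_wpM2r ?powR_ge0// exprn_ege1// ler1n.
- move=> x x1; rewrite opprK normrM -[leRHS]mulr1; apply: ler_pM => //.
  exact: sine_pow_le_cst.
Qed.

(** A backward difference in [y] raises [m] by one and a derivative in [y] raises [e] by one; thanks
    to the centring by [m / 2], both lower the phase [b] by the same [pi / 2]. This is what lets
    differences and derivatives be traded in the induction on the degree. *)
Definition trig e m b (y : R) (w : R) := sine_pow e m w * cos (w * (y - m%:R / 2) - b).
Definition trig_integral e m b (y : R) := \int[mu]_(w in `]0, +oo[) trig e m b y w.

Lemma continuous_cos_affine (c b w : R) : continuous_at w (fun w : R => cos (w * c - b)).
Proof.
apply: (@continuous_comp _ _ _ (fun w : R => w * c - b) (@cos R)); last exact: continuous_cos.
by apply: cvgB; [apply: cvgMl; exact: cvg_id|exact: cvg_cst].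
Qed.

Lemma integrable_trig e m b y : -1 < e + m%:R -> e < -1 ->
  mu.-integrable `]0, +oo[ (EFin \o trig e m b y).
Proof.
move=> e1 e2; apply: integrable_sine_pow => // w; first by move=> _; exact: continuous_cos_affine.
by rewrite ler_norml cos_geN1 cos_le1.
Qed.

Lemma nabla_trig e m b (y w : R) :
  trig e m b y w - trig e m b (y - 1) w = trig e m.+1 (b - pi / 2) y w.
Proof.
rewrite /trig -mulrBr /sine_pow exprSr -!mulrA; congr (_ * (_ * _)).
set z := w * (y - m.+1%:R / 2) - b.
have -> : w * (y - m%:R / 2) - b = z + w / 2 by rewrite /z -natr1; field.
have -> : w * (y - 1 - m%:R / 2) - b = z - w / 2 by rewrite /z -natr1; field.
have -> : w * (y - m.+1%:R / 2) - (b - pi / 2) = z + pi / 2.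
  by rewrite /z; ring.
by clearbody z; rewrite [cos (z + w / 2)]cosD cosB [cos (z + pi / 2)]cosD cos_pihalf sin_pihalf; ring.
Qed.

Lemma nabla_trig_integral e m b y : -1 < e + m%:R -> e < -1 ->
  nabla (trig_integral e m b) y = trig_integral e m.+1 (b - pi / 2) y.
Proof.
move=> e1 e2; rewrite /nabla /trig_integral -RintegralB//; try exact: integrable_trig.
by apply: eq_Rintegral => w _; rewrite nabla_trig.
Qed.

Lemma is_derive_trig e m b (y w : R) : 0 < w ->
  is_derive y 1 (trig e m b ^~ w) (trig (e + 1) m (b - pi / 2) y w).
Proof.
move=> w0; rewrite /trig /sine_pow -powR_mulX1//.
have -> : w `^ e * w * (2 * sin (w / 2)) ^+ m * cos (w * (y - m%:R / 2) - (b - pi / 2)) =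
   w `^ e * (2 * sin (w / 2)) ^+ m * (w * - sin (w * (y - m%:R / 2) - b)).
  have -> : w * (y - m%:R / 2) - (b - pi / 2) = w * (y - m%:R / 2) - b + pi / 2 by ring.
  by rewrite [in LHS]cosD cos_pihalf sin_pihalf; ring.
apply: is_derive_cstM.
have E z : w * (z - m%:R / 2) - b = w * z + (- (w * (m%:R / 2)) - b) by ring.
rewrite E; under eq_fun do rewrite E.
exact: (is_derive_comp_affine (is_derive_cos _)).
Qed.

Lemma is_derive_trig_integral e m b (y : R) : -1 < e + m%:R -> e + 1 < -1 ->
  is_derive y 1 (trig_integral e m b) (trig_integral (e + 1) m (b - pi / 2) y).
Proof.
move=> e1 e2; have e1' : -1 < e + 1 + m%:R by move: e1; lra.
have e2' : e < -1 by move: e2; lra.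
pose G w := `|sine_pow (e + 1) m w * cst 1 w|.
have iG : mu.-integrable `]0, +oo[ (EFin \o G).
  have : mu.-integrable `]0, +oo[ (EFin \o (fun w => sine_pow (e + 1) m w * cst 1 w)).
    apply: integrable_sine_pow => // w; first by move=> _; exact: cvg_cst.
    by rewrite normr1.
  by move/integrable_norm.
have yI : `]y - 1, y + 1[%classic y by rewrite /= in_itv /= ltrBlDr ltrDl ltr01.
have I1 x : `]y - 1, y + 1[%classic x -> mu.-integrable `]0, +oo[ (EFin \o trig e m b x).
  by move=> _; exact: integrable_trig.
have D1 x w : `]y - 1, y + 1[%classic x -> `]0, +oo[%classic w -> derivable (trig e m b ^~ w) x 1.
  by move=> _; rewrite /= in_itv /= andbT => w0; have [] := is_derive_trig e m b x w0.
have DE x w : 0 < w -> (@partial1of2 R _ (trig e m b)) x w = trig (e + 1) m (b - pi / 2) x w.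
  by move=> w0; rewrite partial1of2E; have [_ ->] := is_derive_trig e m b x w0.
have B1 x w : `]y - 1, y + 1[%classic x -> `]0, +oo[%classic w ->
    `|(@partial1of2 R _ (trig e m b)) x w| <= G w.
  move=> _; rewrite /= in_itv /= andbT => w0; rewrite DE// /G /trig !normrM normr1.
  by rewrite ler_wpM2l// ler_norml cos_geN1 cos_le1.
have G0 w : 0 <= G w by exact: normr_ge0.
have mI : measurable (`]0, +oo[%classic : set R) by [].
have Dv := @derivable_under_integral R _ _ mu (trig e m b) _ mI y _ _ yI I1 D1 G G0 iG B1.
apply: DeriveDef => //; rewrite -derive1E.
rewrite (@differentiation_under_integral R _ _ mu (trig e m b) _ mI y _ _ yI I1 D1 G G0 iG B1).
by apply: eq_Rintegral => w; rewrite inE /= in_itv /= andbT => /DE.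
Qed.

End TrigonometricIntegrals.

(** Rescaling by [|y|] and oddness of the sine: the right-hand factor is [|y|^s] with the sign of
    [y]. *)
Lemma integral_sin_scaled (s y : R) : 0 < s < 1 ->
  \int[mu]_(w in `]0, +oo[) (w `^ (- 1 - s) * sin (w * y)) =
  sin_mellin s * (pospow s y - pospow s (- y)).
Proof.
move=> s01; have /andP[s0 s1] := s01.
have pos (c : R) : 0 < c ->
    \int[mu]_(w in `]0, +oo[) (w `^ (- 1 - s) * sin (w * c)) = sin_mellin s * c `^ s.
  move=> c0; rewrite /sin_mellin.
  rewrite (@Rintegral_affine R c 0 (lt0r_neq0 c0) `]0, +oo[ (fun w => w `^ (- 1 - s) * sin w))//; last first.
    apply: measurable_oy => x x0; apply: cvgM; first exact: continuous_at_powR.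
    exact: continuous_sin.
  have -> : (fun x => c * x + 0) @^-1` `]0, +oo[%classic = `]0, +oo[%classic.
    by apply/seteqP; split=> x /=; rewrite !in_itv /= !andbT addr0 pmulr_rgt0.
  rewrite gtr0_norm// -RintegralZl//; last first.
    have := @integrable_sin_mellin R s c s01.
    have/integrableZl := @integrable_sin_mellin R s c s01.
    move=> /(_ (measurable_itv _) (c `^ (- 1 - s))) H _.
    apply: eq_integrable H => // w; rewrite inE /= in_itv /= andbT => w0.
    by rewrite addr0 powRM ?ltW// EFinM -mulrA.
  rewrite -RintegralZr//.
    apply: eq_Rintegral => w; rewrite inE /= in_itv /= andbT => w0.
    rewrite addr0 powRM ?ltW// (mulrC w c).
    have cc : c * c `^ (- 1 - s) * c `^ s = 1.
      rewrite -mulrA -powRD ?(gt_eqF c0) ?implybT//.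
      by rewrite mulrC powR_mulX1// (_ : _ + 1 = 0) ?powRr0//; ring.
    transitivity (c * c `^ (- 1 - s) * c `^ s * (w `^ (- 1 - s) * sin (c * w))); last by ring.
    by rewrite cc mul1r.
  have/integrableZl := @integrable_sin_mellin R s c s01.
  move=> /(_ (measurable_itv _) (c * c `^ (- 1 - s))) H.
  apply: eq_integrable H => // w; rewrite inE /= in_itv /= andbT => w0.
  by rewrite addr0 powRM ?ltW// -EFinM; congr EFin; ring.
have [y0|y0|->] := ltgtP y 0.
- rewrite /pospow oppr_gt0 y0 ltNge (ltW y0) /= sub0r mulrN -pos ?oppr_gt0//.
  rewrite -[RHS]mulN1r -RintegralZl//.
    by apply: eq_Rintegral => w _; rewrite mulrN sinN; ring.
  have := @integrable_sin_mellin R s (- y) s01.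
  by apply: eq_integrable => // w _; rewrite /= (mulrC w).
- by rewrite /pospow oppr_gt0 y0 ltNge (ltW y0) /= subr0 pos.
- rewrite /pospow oppr0 ltxx subrr mulr0; under eq_Rintegral do rewrite mulr0 sin0 mulr0.
  by rewrite /Rintegral integral0.
Qed.

Definition rising (s : R) (n : nat) := \prod_(j < n) (s + j%:R).

Lemma rising_gt0 s n : 0 < s -> 0 < rising s n.
Proof. by move=> s0; apply: prodr_gt0 => i _; rewrite ltr_pwDl. Qed.

Section FourierDifference.
Variable s : R.
Hypothesis s01 : 0 < s < 1.

(** [|y| ^ (s + n)], times the sign of [y] for even [n]. This parity makes [h n] proportional to the
    derivative of [h n.+1], and it is the combination that the left and right derivatives of a
    spline produce. *)
Let h n (y : R) := pospow (s + n%:R) y + (-1) ^+ n.+1 * pospow (s + n%:R) (- y).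

Let is_derive_h n (y : R) : is_derive y 1 (h n.+1) ((s + n.+1%:R) * h n y).
Proof.
have q1 : 1 < s + n.+1%:R by rewrite ltr_pwDl ?ler1n//; case/andP: s01.
have E : s + n.+1%:R - 1 = s + n%:R by rewrite -natr1; ring.
have d1 := is_derive_pospow y q1.
have d2 := is_derive_reflect (is_derive_pospow (- y) q1).
have d3 := is_derive_cstM ((-1) ^+ n.+2) d2.
have d := is_deriveD d1 d3; rewrite E in d; apply: (is_derive_eq d).
by rewrite /h !exprS; ring.
Qed.

Let mellin_gt0 : sin_mellin s != 0.
Proof.
apply/negP => /eqP E; have := sin_mellin_constant s01; rewrite E mulr0.
by move=> /esym/eqP; rewrite gt_eqF// pi_gt0.
Qed.

Lemma nablas_fourier n y : nablas n.+3 (h n) y =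
  - (rising s n.+1 / (s * sin_mellin s)) * trig_integral (- 1 - s - n%:R) n.+3 0 y.
Proof.
have /andP[s0 s1] := s01.
elim: n y => [|n IH] y.
  have E : forall y, h 0%N y = (sin_mellin s)^-1 *
      \int[mu]_(w in `]0, +oo[) (w `^ (- 1 - s) * sin (w * y)).
    move=> z; rewrite integral_sin_scaled// mulKf// /h addr0 expr1 mulN1r//.
  rewrite (eq_nablas _ E) nablasZ !nablasSr.
  (* The first difference is taken by hand: for [m = 0] the two exponent conditions of
     [nabla_trig_integral] exclude each other. *)
  have N1 z : nabla (fun y => \int[mu]_(w in `]0, +oo[) (w `^ (- 1 - s) * sin (w * y))) z =
      trig_integral (- 1 - s) 1 0 z.
    have Is x : mu.-integrable `]0, +oo[ (EFin \o (fun w => w `^ (- 1 - s) * sin (w * x))).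
      have := @integrable_sin_mellin R s x s01.
      by apply: eq_integrable => // w _; rewrite /= (mulrC w).
    rewrite /nabla -RintegralB//.
    apply: eq_Rintegral => w _; rewrite /trig /sine_pow expr1 -mulrBr -mulrA; congr (_ * _).
    set u := w * (z - 1%:R / 2).
    have -> : w * z = u + w / 2 by rewrite /u; field.
    have -> : w * (z - 1) = u - w / 2 by rewrite /u; field.
    by rewrite subr0 sinD sinB; ring.
  have h1 : -1 < - 1 - s + 1%:R by move: s1; lra.
  have h2 : -1 < - 1 - s + 2%:R by move: s1; lra.
  have h3 : - 1 - s < -1 by move: s0; lra.
  have N2 z : nabla (nabla (fun y => \int[mu]_(w in `]0, +oo[) (w `^ (- 1 - s) * sin (w * y)))) z =
      trig_integral (- 1 - s) 2 (0 - pi / 2) z.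
    by rewrite -(nabla_trig_integral _ _ h1 h3) /nabla -!N1.
  rewrite [nablas 0 _]/= /nabla -/(nabla _ _).
  transitivity ((sin_mellin s)^-1 * nabla (trig_integral (- 1 - s) 2 (0 - pi / 2)) y).
    by congr (_ * _); rewrite [RHS]/nabla -!N2.
  rewrite nabla_trig_integral// /rising big_ord_recl big_ord0 !addr0 subr0 mulr1.
  have -> : trig_integral (- 1 - s) 3 (0 - pi / 2 - pi / 2) y = - trig_integral (- 1 - s) 3 0 y.
    rewrite /trig_integral -[RHS]mulN1r -RintegralZl//; last by apply: integrable_trig; move: s0 s1; lra.
    apply: eq_Rintegral => w _; rewrite /trig mulrCA; congr (_ * _).
    have -> : 0 - pi / 2 - pi / 2 = - pi :> R by field.
    by rewrite opprK subr0 cosDpi mulN1r.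
  by field; rewrite mellin_gt0 gt_eqF.
have E3 : - 1 - s - n.+1%:R + 1 = - 1 - s - n%:R by rewrite -natr1; ring.
have N0 : 0 <= n%:R :> R by [].
have NS : n.+1%:R = n%:R + 1 :> R by rewrite -natr1.
have N3 : n.+3%:R = n%:R + 3 :> R by rewrite -(addn3 n) natrD.
have g1 : -1 < - 1 - s - n.+1%:R + n.+3%:R by rewrite NS N3; move: s1; lra.
have g2 : - 1 - s - n.+1%:R < -1 by rewrite NS; move: s0; lra.
have g3 : - 1 - s - n.+1%:R + 1 < -1 by rewrite NS; move: s0; lra.
set c := - (rising s n.+2 / (s * sin_mellin s)).
have cE : c = (s + n.+1%:R) * - (rising s n.+1 / (s * sin_mellin s)).
  by rewrite /c /rising [in LHS]big_ord_recr /=; ring.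
(* By the induction hypothesis both terms have the same derivative, so [D] is constant. Its value is
   never computed: the difference leading from [n.+3] to [n.+4] removes it. *)
pose D y := nablas n.+3 (h n.+1) y - c * trig_integral (- 1 - s - n.+1%:R) n.+3 (pi / 2) y.
have D0 (x : R) : is_derive x 1 D 0.
  have d1 := is_derive_nablas n.+3 (is_derive_h n) x.
  have d2 := is_derive_cstM c (is_derive_trig_integral (pi / 2) x g1 g3).
  apply: (is_derive_eq (is_deriveB d1 d2)).
  by rewrite nablasZ IH E3 subrr {1}cE mulrA subrr.
have Dc : D y = D (y - 1) by apply: is_derive_0_is_cst.
have : nablas n.+4 (h n.+1) y = c * nabla (trig_integral (- 1 - s - n.+1%:R) n.+3 (pi / 2)) y.
  rewrite nablasS /nabla mulrBr; move: Dc; rewrite /D; lra.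
by rewrite nabla_trig_integral// subrr.
Qed.

(** The two summands are the left and the right derivative. Reflection at the centre [n.+3 / 2] of
    the support merges them into differences of [h n], and [sin_mellin_constant] reduces the factor
    to the one that the Riesz normalization divides out. *)
Lemma central_coefficient n (k : R) (w : R -> R) :
  (forall x, w x = (Gamma s * rising s n.+1)^-1 * nablas n.+3 (pospow (s + n%:R)) x) ->
  w (n.+3%:R / 2 + k) + w (n.+3%:R / 2 - k) =
  - (2 * cos (pi * s / 2)) *
  (pi^-1 * \int[mu]_(x in `]0, +oo[) (sine_pow (- 1 - s - n%:R) n.+3 x * cos (x * k))).
Proof.
move=> wE; have /andP[s0 s1] := s01; rewrite !wE -mulrDr.
have -> : n.+3%:R / 2 - k = n.+3%:R - (n.+3%:R / 2 + k) by field.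
rewrite nablas_reflect.
have -> : nablas n.+3 (pospow (s + n%:R)) (n.+3%:R / 2 + k) + (-1) ^+ n.+3 *
    nablas n.+3 (fun y => pospow (s + n%:R) (- y)) (n.+3%:R / 2 + k) =
    nablas n.+3 (h n) (n.+3%:R / 2 + k).
  by rewrite /h nablasD nablasZ !exprS; congr (_ + _); ring.
rewrite nablas_fourier.
have -> : trig_integral (- 1 - s - n%:R) n.+3 0 (n.+3%:R / 2 + k) =
   \int[mu]_(x in `]0, +oo[) (sine_pow (- 1 - s - n%:R) n.+3 x * cos (x * k)).
  by apply: eq_Rintegral => x _; rewrite /trig subr0; congr (_ * cos (_ * _)); ring.
move: (\int[mu]_(x in _) _) => I.
have := sin_mellin_constant s01; have := rising_gt0 n.+1 s0.
have : 0 < Gamma s by rewrite GammaE// ?ltW//; apply: gammaI_gt0; lra.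
have := mellin_gt0; have := pi_gt0 R.
move: (rising s n.+1) (Gamma s) (sin_mellin s) (cos (pi * s / 2)) => r G K C.
move: (@pi R) => u u0 K0 G0 r0 E; rewrite -E; field.
have : 2 * C * (s * G) * K != 0 by rewrite E gt_eqF.
rewrite !mulf_eq0 !negb_or => /andP[/andP[/andP[_ C0] _] _].
by rewrite C0 K0 !gt_eqF.
Qed.

End FourierDifference.
End FractionalDifferences.

(** * The symbol as a periodization *)

Section Periodization.
Variable R : realType.
Local Notation mu := (@lebesgue_measure R).

Lemma exhausts_ray (d : R) : 1 <= d -> exhausts `[0, +oo[ (fun=> 0) (fun n => d * n%:R).
Proof.
move=> d1; have d0 : 0 <= d by rewrite (le_trans ler01).
split.
- by move=> n; rewrite mulr_ge0.
- by move=> m n mn; rewrite lexx ler_wpM2l// ler_nat.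
- apply/seteqP; split => x /=.
    rewrite in_itv /= andbT => cx.
    exists (Num.truncn x).+1 => //=; rewrite in_itv /= cx /=.
    apply: (@le_trans _ _ ((Num.truncn x).+1%:R)); first by apply/ltW/truncnS_gt.
    by rewrite ler_peMl.
  by move=> [n _] /=; rewrite !in_itv /= andbT => /andP[].
Qed.

Lemma Rint_translate (a b d : R) (f : R -> R) : cont_on (a + d) (b + d) f ->
  \int[mu]_(x in `[a + d, b + d]) f x = \int[mu]_(x in `[a, b]) f (x + d).
Proof.
move=> cf; have mf : measurable_fun `[a + d, b + d] f.
  by have /integrableP[/measurable_EFinP] := cont_on_integrable cf.
rewrite (@Rintegral_affine R 1 d (oner_neq0 _))// normr1 mul1r.
have -> : (fun x => 1 * x + d) @^-1` `[a + d, b + d]%classic = `[a, b]%classic.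
  by apply/seteqP; split=> x /=; rewrite !in_itv /= mul1r !lerD2r.
by apply: eq_Rintegral => x _; rewrite mul1r.
Qed.

Lemma Rint_reflect (a b d : R) (f : R -> R) : cont_on (d - b) (d - a) f ->
  \int[mu]_(x in `[d - b, d - a]) f x = \int[mu]_(x in `[a, b]) f (d - x).
Proof.
move=> cf; have mf : measurable_fun `[d - b, d - a] f.
  by have /integrableP[/measurable_EFinP] := cont_on_integrable cf.
have N1 : -1 != 0 :> R by rewrite oppr_eq0 oner_neq0.
rewrite (@Rintegral_affine R (-1) d N1)// normrN1 mul1r.
have -> : (fun x => -1 * x + d) @^-1` `[d - b, d - a]%classic = `[a, b]%classic.
  by apply/seteqP; split=> x /=; rewrite !in_itv /= mulN1r (addrC _ d) !lerD2l !lerN2 andbC.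
by apply: eq_Rintegral => x _; rewrite mulN1r addrC.
Qed.

(** Comparison with the integral of [x ^ (- 1 - s)]; the subtracted term [s^-1 N^(- s)] carries the
    induction. *)
Lemma sum_powR_bound (s : R) N : 0 < s ->
  \sum_(0 <= r < N) r.+1%:R `^ (- 1 - s) <= 1 + s^-1 :> R.
Proof.
move=> s0; have si : 0 < s^-1 by rewrite invr_gt0.
case: N => [|N]; first by rewrite big_geq// addr_ge0// ltW.
suff H : \sum_(0 <= r < N.+1) r.+1%:R `^ (- 1 - s) <= 1 + s^-1 - s^-1 * N.+1%:R `^ (- s).
  by apply: (le_trans H); rewrite lerBlDr lerDl mulr_ge0 ?powR_ge0// ltW.
elim: N => [|N IH]; first by rewrite big_nat1 !powR1 mulr1 addrK.
rewrite big_nat_recr//=; apply: (le_trans (lerD IH (lexx _))).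
have N0 : 0 < N.+1%:R :> R by [].
have NN : N.+1%:R <= N.+2%:R :> R by rewrite ler_nat.
have co : cont_on N.+1%:R N.+2%:R (fun x : R => x `^ (- 1 - s)).
  by move=> x /andP[Nx _]; apply: continuous_at_powR; exact: lt_le_trans Nx.
have sE : - 1 - s + 1 = - s :> R by ring.
have := @Rint_FTC R N.+1%:R N.+2%:R (fun x => x `^ (- 1 - s))
  (fun x => (- 1 - s + 1)^-1 * x `^ (- 1 - s + 1)) NN co.
rewrite sE => H.
have {}H : \int[mu]_(x in `[N.+1%:R, N.+2%:R]) (x `^ (- 1 - s)) =
   (- s)^-1 * N.+2%:R `^ (- s) - (- s)^-1 * N.+1%:R `^ (- s).
  apply: H => x /andP[Nx _].
  have := @is_derive_powR_antiderivative R (- 1 - s) x; rewrite sE; apply.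
    by rewrite oppr_eq0 gt_eqF.
  exact: lt_le_trans Nx.
have := @Rint_le R N.+1%:R N.+2%:R (fun=> N.+2%:R `^ (- 1 - s)) (fun x => x `^ (- 1 - s))
  (@cont_on_cst _ _ _ _) co.
have width : N.+2%:R - N.+1%:R = 1 :> R by rewrite -[N.+2%:R]natr1; ring.
rewrite Rint_cst// H width mulr1 => K.
have : N.+2%:R `^ (- 1 - s) <= (- s)^-1 * N.+2%:R `^ (- s) - (- s)^-1 * N.+1%:R `^ (- s).
  apply: K => x /andP[Nx xN]; have x0 : 0 < x := lt_le_trans N0 Nx.
  have -> : - 1 - s = - (1 + s) by ring.
  rewrite !powRN lef_pV2 ?posrE ?powR_gt0//.
  by apply: ge0_ler_powR; rewrite ?nnegrE ?(ltW x0)// ltW// addr_gt0.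
rewrite invrN !mulNr opprK; lra.
Qed.

Variables (G : R -> R) (C s : R).
Hypothesis s0 : 0 < s.
Hypothesis cG : forall x : R, continuous_at x G.
Hypothesis evenG : forall x, G (- x) = G x.
Hypothesis GC : forall x, `|G x| <= C.
Hypothesis decayG : forall x, 1 <= `|x| -> `|G x| <= C * `|x| `^ (- 1 - s).

(** The terms [l] and [- (l + 1)] of the sum over all integers, grouped as in [symbol]. *)
Definition periodized_term (x : R) (l : nat) :=
  G (x + 2 * l%:R * pi) + G (x - 2 * l.+1%:R * pi).

Definition periodized (x : R) := limn (series (periodized_term x)).

Let C0 : 0 <= C := le_trans (normr_ge0 _) (GC 0).

Let b (l : nat) : R := 2 * C * (if l is l'.+1 then l'.+1%:R `^ (- 1 - s) else 1).

Let decay_nat (l : nat) (x : R) : l.+1%:R <= `|x| -> `|G x| <= C * l.+1%:R `^ (- 1 - s).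
Proof.
move=> lx; have l1 : 1 <= l.+1%:R :> R by rewrite ler1n.
have x1 : 1 <= `|x| := le_trans l1 lx.
apply: (le_trans (decayG x1)); rewrite ler_wpM2l//.
have -> : - 1 - s = - (1 + s) by ring.
rewrite !powRN lef_pV2 ?posrE ?powR_gt0//; first last.
- by rewrite (lt_le_trans ltr01).
by apply: ge0_ler_powR; rewrite ?nnegrE// ltW// addr_gt0.
Qed.

Let b_noninc l : b l.+1 <= b l.
Proof.
rewrite /b ler_wpM2l ?mulr_ge0//; case: l => [|l]; first by rewrite powR1.
have -> : - 1 - s = - (1 + s) by ring.
rewrite !powRN lef_pV2 ?posrE ?powR_gt0//.
by apply: ge0_ler_powR; rewrite ?nnegrE ?ler_nat// ltW// addr_gt0.
Qed.

(** The margin 1 around [[- pi, pi]] provides a full neighbourhood of the end points, as two-sided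
    continuity demands; since [pi >= 2], it still leaves [|x + y| >= l] for positive [l]. *)
Let far (x y : R) (l : nat) : `|x| <= pi + 1 -> `|y| = 2 * l%:R * pi -> `|G (x + y)| <= b l / 2.
Proof.
move=> xp yl; have -> : b l / 2 = C * (if l is l'.+1 then l'.+1%:R `^ (- 1 - s) else 1).
  by rewrite /b; field.
case: l yl => [|l] yl; first by rewrite mulr1.
apply: decay_nat; have p2 := pi_ge2 R.
have l0 : 0 <= l%:R :> R by [].
have l1 : l.+1%:R = l%:R + 1 :> R by rewrite -natr1.
apply: (@le_trans _ _ (`|y| - `|x|)); last first.
  by have := ler_normB (x + y) x; rewrite addrAC subrr add0r; lra.
apply: (@le_trans _ _ (2 * l.+1%:R * pi - (pi + 1))); last by rewrite yl lerD2l lerN2.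
rewrite l1 -subr_ge0 (_ : _ - _ = l%:R * (2 * pi - 1) + (pi - 2)); last by ring.
by rewrite addr_ge0 ?mulr_ge0//; lra.
Qed.

Let norm_period l : `|2 * l%:R * pi| = 2 * l%:R * pi :> R.
Proof. by rewrite ger0_norm// mulr_ge0 ?pi_ge0// mulr_ge0. Qed.

Let term_le (x : R) (l : nat) : `|x| <= pi + 1 -> `|periodized_term x l| <= b l.
Proof.
move=> xp; apply: (le_trans (ler_normD _ _)).
have h1 := far xp (norm_period l).
have h2 : `|G (x - 2 * l.+1%:R * pi)| <= b l.+1 / 2 by apply: far => //; rewrite normrN.
have := b_noninc l; lra.
Qed.

Let term_tail : exists t : nat -> R, [/\ forall N, 0 <= t N, t N @[N --> \oo] --> (0 : R) &
    forall N N', (N <= N')%N -> \sum_(N <= r < N') b r <= t N].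
Proof.
apply: (@summable_tail R b (2 * C * (1 + (1 + s^-1)))).
  by move=> [|l]; rewrite /b mulr_ge0 ?mulr_ge0// ?powR_ge0.
move=> N; rewrite /b -mulr_sumr ler_wpM2l ?mulr_ge0//.
case: N => [|N]; first by rewrite big_geq// !addr_ge0 ?invr_ge0// ltW.
by rewrite big_nat_recl//= lerD2l sum_powR_bound.
Qed.

Let periodized_approx (t : nat -> R) : t N @[N --> \oo] --> (0 : R) ->
  (forall N N', (N <= N')%N -> \sum_(N <= r < N') b r <= t N) ->
  forall N x, `|x| <= pi + 1 ->
  `|periodized x - \sum_(0 <= r < N) periodized_term x r| <= t N.
Proof.
move=> tt bt N x xp; apply: (@normal_series _ _ b t) => // r; exact: term_le.
Qed.

Let continuous_partial N (x : R) :
  continuous_at x (fun y => \sum_(0 <= r < N) periodized_term y r).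
Proof.
elim: N => [|N IH].
  by under eq_fun do rewrite big_geq//; exact: cvg_cst.
under eq_fun do rewrite big_nat_recr//=.
apply: cvgD; [exact: IH|apply: cvgD].
  apply: (@continuous_comp _ _ _ (fun y => y + 2 * N%:R * pi) G); last exact: cG.
  by apply: cvgD; [exact: cvg_id|exact: cvg_cst].
apply: (@continuous_comp _ _ _ (fun y => y - 2 * N.+1%:R * pi) G); last exact: cG.
by apply: cvgB; [exact: cvg_id|exact: cvg_cst].
Qed.

Lemma continuous_periodized : cont_on (- pi) pi periodized.
Proof.
move=> x xpi; have [t [t0 tt bt]] := term_tail.
apply: (uniform_limit_continuous_at (continuous_partial^~ x) tt).
near=> y; have yp : `|y| <= pi + 1.
  have : `|x - y| < 1 by near: y; apply/nbhs_ballP; exists 1 => //=.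
  move: xpi; rewrite ltr_norml ler_norml; lra.
by move=> N; exact: periodized_approx.
Unshelve. all: by end_near. Qed.

Lemma periodized_bounded : exists M, forall x, - pi <= x <= pi -> `|periodized x| <= M.
Proof.
have [t [t0 tt bt]] := term_tail; exists (t 0%N) => x xpi.
have := periodized_approx tt bt 0%N (x := x); rewrite big_geq// subr0; apply.
by move: xpi; rewrite ler_norml; lra.
Qed.

(** The partial sums run over [- N, ..., N - 1], which is not symmetric: reflection exchanges one
    end term for another, and both tend to 0. *)
Lemma periodizedN x : - pi <= x <= pi -> periodized (- x) = periodized x.
Proof.
move=> xpi; have [t [t0 tt bt]] := term_tail.
have xp : `|x| <= pi + 1 by move: xpi; rewrite ler_norml; lra.
have S N : \sum_(0 <= r < N) periodized_term (- x) r + G (x - 2 * N%:R * pi) =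
    \sum_(0 <= r < N) periodized_term x r + G (x + 2 * N%:R * pi).
  elim: N => [|N IH]; first by rewrite !big_geq// mulr0 mul0r subr0 addr0.
  have E : periodized_term (- x) N = G (x - 2 * N%:R * pi) + G (x + 2 * N.+1%:R * pi).
    rewrite /periodized_term; congr (_ + _).
      by rewrite -evenG; congr G; ring.
    by rewrite -evenG; congr G; ring.
  rewrite !big_nat_recr//= E [periodized_term x N]/periodized_term; move: IH; set A := \sum_(_ <= _ < _) _.
  set B := \sum_(_ <= _ < _) _; lra.
apply/eqP; rewrite -subr_eq0 -normr_le0; apply/ler_addgt0Pr => e e0; rewrite add0r.
have e4 : 0 < e / 4 by rewrite divr_gt0.
move/cvgrPdist_le: (tt) => /(_ _ e4) [N _ /(_ N (leqnn N))] /=; rewrite sub0r normrN => tN.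
have {tN}tN : t N <= e / 4 := le_trans (ler_norm _) tN.
have bN : b N <= t N by have := bt N N.+1 (leqnSn _); rewrite big_nat1.
have G1 : `|G (x - 2 * N%:R * pi)| + `|G (x + 2 * N%:R * pi)| <= 2 * t N.
  have h1 := far xp (norm_period N).
  have h2 : `|G (x - 2 * N%:R * pi)| <= b N / 2 by apply: far => //; rewrite normrN.
  have bN0 : 0 <= b N by rewrite /b mulr_ge0 ?mulr_ge0//; case: (N) => // ?; rewrite powR_ge0.
  lra.
have a1 := periodized_approx tt bt N xp.
have a2 := periodized_approx tt bt N (x := - x); rewrite normrN in a2; have {}a2 := a2 xp.
have := S N; move: a1 a2 G1; rewrite !ler_norml.
set A := \sum_(_ <= _ < _) _; set B := \sum_(_ <= _ < _) _.
move: (G _) (G _) => g1 g2.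
have := ler_norm g1; have := ler_norm g2; have := ler_norm (- g1); have := ler_norm (- g2).
rewrite !normrN; lra.
Qed.

(** Each period is halved: the first half is a translate of [[0, pi]], the second a reflection of
    it, where evenness of [G] enters. Neither changes [cos (k x)], so a period contributes exactly
    one [periodized_term]. *)
Lemma fourier_periodized (k : nat) :
  \int[mu]_(x in `[0, pi]) (periodized x * cos (k%:R * x)) =
  \int[mu]_(x in `]0, +oo[) (G x * cos (k%:R * x)).
Proof.
have p0 := pi_gt0 R; have p2 := pi_ge2 R.
pose g (x : R) := G x * cos (k%:R * x).
have cg (x : R) : continuous_at x g by apply: cvgM; [exact: cG|exact: continuous_cosM].
have cog x y : cont_on x y g by move=> z _; exact: cg.
have gC x : `|g x| <= `|G x|.
  by rewrite /g normrM ler_piMr// ler_norml cos_geN1 cos_le1.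
have Ig0 : mu.-integrable `]0, +oo[ (EFin \o g).
  apply: (@integrable_oy R g 0 (1 + s) C).
  - lra.
  - by move: s0; lra.
  - by move=> x _; exact: cg.
  - by move=> x _; rewrite powRr0 mulr1 (le_trans (gC _)).
  - move=> x x1; rewrite (le_trans (gC _))//.
    have := @decayG x; rewrite ger0_norm; last by rewrite (le_trans ler01).
    by have -> : - 1 - s = - (1 + s); [ring|exact].
have d1 : 1 <= 2 * pi :> R by lra.
have eD := exhausts_ray d1.
have mg : measurable_fun (`[0, +oo[%classic : set R) g.
  by apply: (exhausts_measurable_fun eD) => x _; exact: cg.
have Ig : mu.-integrable `[0, +oo[ (EFin \o g).
  apply/integrableP; split; first exact/measurable_EFinP.
  rewrite -integral_itv_obnd_cbnd.
    by move/integrableP: Ig0 => [].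
  apply/measurable_EFinP; apply: measurableT_comp => //.
  by apply: measurable_funS mg => // x /=; rewrite !in_itv /= !andbT; exact: ltW.
have -> : \int[mu]_(x in `]0, +oo[) g x = \int[mu]_(x in `[0, +oo[) g x.
  exact: Rintegral_itv_obnd_cbnd.
have cvgG := cvg_exhausts eD Ig.
have partial N : \int[mu]_(x in `[0, 2 * pi * N%:R]) g x =
    \int[mu]_(x in `[0, pi]) ((\sum_(0 <= r < N) periodized_term x r) * cos (k%:R * x)).
  elim: N => [|N IH].
    rewrite mulr0 /Rintegral set_itv1 integral_set1; under eq_integral do rewrite big_geq// mul0r.
    by rewrite integral0.
  have N0 : 0 <= N%:R :> R by [].
  have NE : N.+1%:R = N%:R + 1 :> R by rewrite -natr1.
  rewrite (@Rint_split R 0 (2 * pi * N%:R) (2 * pi * N.+1%:R)) ?IH; first last.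
  - exact: cog.
  - by rewrite ler_pM2l ?ler_nat//; lra.
  - by rewrite mulr_ge0//; lra.
  rewrite (@Rint_split R (2 * pi * N%:R) (2 * pi * N%:R + pi) (2 * pi * N.+1%:R)); first last.
  - exact: cog.
  - rewrite NE; lra.
  - lra.
  have h1 : \int[mu]_(x in `[(2 * pi * N%:R), (2 * pi * N%:R + pi)]) g x =
      \int[mu]_(x in `[0, pi]) (G (x + 2 * N%:R * pi) * cos (k%:R * x)).
    have -> : 2 * pi * N%:R + pi = pi + 2 * N%:R * pi :> R by ring.
    have -> : 2 * pi * N%:R = 0 + 2 * N%:R * pi :> R by ring.
    rewrite Rint_translate//; apply: eq_Rintegral => x _; rewrite /g; congr (_ * _).
    have -> : k%:R * (x + 2 * N%:R * pi) = k%:R * x + (k * 2 * N)%N%:R * pi by rewrite !natrM; ring.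
    by rewrite cosD cos_natpi sin_natpi mulr0 subr0 -mulnA mulnCA exprM sqrrN expr1n expr1n mulr1.
  have h2 : \int[mu]_(x in `[(2 * pi * N%:R + pi), (2 * pi * N.+1%:R)]) g x =
      \int[mu]_(x in `[0, pi]) (G (x - 2 * N.+1%:R * pi) * cos (k%:R * x)).
    have -> : 2 * pi * N%:R + pi = 2 * N.+1%:R * pi - pi :> R by rewrite NE; ring.
    have -> : 2 * pi * N.+1%:R = 2 * N.+1%:R * pi - 0 :> R by ring.
    rewrite Rint_reflect//; apply: eq_Rintegral => x _; rewrite /g -evenG opprB; congr (_ * _).
    have -> : k%:R * (2 * N.+1%:R * pi - x) = (k * 2 * N.+1)%N%:R * pi - k%:R * x by rewrite !natrM; ring.
    by rewrite cosB cos_natpi sin_natpi mul0r addr0 -mulnA mulnCA exprM sqrrN expr1n expr1n mul1r.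
  have cc1 : cont_on 0 pi (fun x => G (x + 2 * N%:R * pi) * cos (k%:R * x)).
    move=> x _; apply: cvgM; last exact: continuous_cosM.
    apply: (@continuous_comp _ _ _ (fun y => y + 2 * N%:R * pi) G); last exact: cG.
    by apply: cvgD; [exact: cvg_id|exact: cvg_cst].
  have cc2 : cont_on 0 pi (fun x => G (x - 2 * N.+1%:R * pi) * cos (k%:R * x)).
    move=> x _; apply: cvgM; last exact: continuous_cosM.
    apply: (@continuous_comp _ _ _ (fun y => y - 2 * N.+1%:R * pi) G); last exact: cG.
    by apply: cvgB; [exact: cvg_id|exact: cvg_cst].
  rewrite h1 h2 -RintD// -RintD//; last 2 first.
  - by move=> x _; apply: cvgM; [exact: continuous_partial|exact: continuous_cosM].
  - exact: cont_onD.
  by apply: eq_Rintegral => x _; rewrite big_nat_recr//= /periodized_term; ring.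
have [t [t0 tt bt]] := term_tail.
have cvgF : \int[mu]_(x in `[0, 2 * pi * N%:R]) g x @[N --> \oo] -->
    \int[mu]_(x in `[0, pi]) (periodized x * cos (k%:R * x)).
  have tp : pi * t N @[N --> \oo] --> (0 : R) by rewrite -(mulr0 pi); apply: cvgMr.
  apply/cvgrPdist_le => e e0.
  move/cvgrPdist_le: tp => /(_ e e0); apply: filterS => N.
  rewrite sub0r normrN => h; apply: le_trans (le_trans (ler_norm _) h).
  have cP : cont_on 0 pi periodized.
    by move=> x /andP[x0 xp]; apply: continuous_periodized; rewrite xp andbT; lra.
  have cS : cont_on 0 pi (fun y => \sum_(0 <= r < N) periodized_term y r).
    by move=> x _; exact: continuous_partial.
  have cC : cont_on 0 pi (fun x : R => cos (k%:R * x)) by move=> x _; exact: continuous_cosM.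
  rewrite partial -RintB; [|exact: cont_onM..].
  rewrite mulrC -[X in _ * X](subr0 pi); apply: Rint_norm_le; first exact: ltW.
    by apply: cont_onB; exact: cont_onM.
  move=> x /andP[x0 xp]; rewrite -mulrBl normrM -[leRHS]mulr1; apply: ler_pM => //.
    by apply: periodized_approx => //; rewrite ler_norml; apply/andP; split; lra.
  by rewrite ler_norml cos_geN1 cos_le1.
exact: (cvg_unique _ cvgF cvgG).
Qed.

End Periodization.

(** * Continuity, boundedness and Fourier coefficients of the symbol *)

Section Symbol.
Variable R : realType.
Local Notation mu := (@lebesgue_measure R).
Variables (alpha : R) (n : nat).
Hypothesis alpha12 : 1 < alpha < 2.

Let s := 2 - alpha.
Let s0 : 0 < s. Proof. by rewrite /s; case/andP: alpha12; lra. Qed.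
Let e : R := - 1 - s - n%:R.

Let G (y : R) := `|y| `^ alpha * (sin (y / 2) / (y / 2)) ^+ n.+3.

Let expE : e + n.+3%:R = alpha.
Proof. by rewrite /e /s -(addn3 n) natrD; ring. Qed.

Let evenG y : G (- y) = G y.
Proof. by rewrite /G normrN mulNr sinN invrN mulrNN. Qed.

Let G_pos y : 0 < y -> G y = sine_pow e n.+3 y.
Proof.
move=> y0; rewrite /G /sine_pow gtr0_norm// -[in LHS]expE.
rewrite powRD ?(gt_eqF y0) ?implybT// powR_mulrn ?(ltW y0)// -mulrA -exprMn.
by congr (_ * _ ^+ _); field; rewrite gt_eqF.
Qed.

(** At the origin the quotient of the sine takes the default value 0 instead of 1; the factor
    [|y|^alpha] gives the right value either way. *)
Let G0 : G 0 = 0.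
Proof.
by rewrite /G normr0 powR0 ?mul0r// gt_eqF//; case/andP: alpha12; lra.
Qed.

Let sign_cases (P : R -> Prop) : P 0 -> (forall y, 0 < y -> P y) ->
  (forall y, P y -> P (- y)) -> forall y, P y.
Proof.
move=> P0 Pp PN y; have [y0|y0|->//] := ltgtP y 0; last exact: Pp.
by rewrite -(opprK y); apply/PN/Pp; rewrite oppr_gt0.
Qed.

Let G_le y : `|G y| <= `|y| `^ alpha.
Proof.
move: y; apply: sign_cases => [|y y0|y]; last by rewrite evenG normrN.
  by rewrite G0 normr0 powR_ge0.
by rewrite G_pos// (gtr0_norm y0) -expE; exact: sine_pow_le.
Qed.

Let decayG y : 1 <= `|y| -> `|G y| <= 2 ^+ n.+3 * `|y| `^ (- 1 - s).
Proof.
move: y; apply: sign_cases => [|y y0|y]; last by rewrite evenG normrN.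
  by rewrite normr0 ler10.
rewrite (gtr0_norm y0) => y1; rewrite G_pos//.
apply: (le_trans (sine_pow_le_cst _ _ _)); rewrite ler_wpM2l ?exprn_ge0//.
by apply: ler_powR => //; rewrite /e lerBlDr lerDl.
Qed.

Let GC y : `|G y| <= 2 ^+ n.+3.
Proof.
have a0 : 0 <= alpha by case/andP: alpha12; lra.
have [y1|y1] := leP `|y| 1.
  apply: (le_trans (G_le y)); apply: (@le_trans _ _ (1 `^ alpha)).
    by apply: ge0_ler_powR; rewrite ?nnegrE.
  by rewrite powR1 exprn_ege1// ler1n.
apply: (le_trans (decayG (ltW y1))); rewrite -[leRHS]mulr1 ler_wpM2l ?exprn_ge0//.
rewrite -[leRHS](powRr0 `|y|); apply: ler_powR; first exact: ltW.
by have := s0; lra.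
Qed.

Let cG (y : R) : continuous_at y G.
Proof.
have [->|y0] := eqVneq y 0; last first.
  apply: cvgM.
    apply: (@continuous_comp _ _ _ (fun t : R => `|t|) (fun t => t `^ alpha)).
      exact: norm_continuous.
    by apply: continuous_at_powR; rewrite normr_gt0.
  have h : continuous_at y (fun t : R => sin (t / 2) / (t / 2)).
    have h1 : continuous_at y (fun t : R => sin (t / 2)).
      have -> : (fun w : R => sin (w / 2)) = (fun w => sin (2^-1 * w)).
        by apply/funext => z; rewrite mulrC.
      exact: continuous_sinM.
    have h2 : continuous_at y (fun t : R => t / 2) by apply: cvgMl; exact: cvg_id.
    apply: cvgM; first exact: h1.
    by apply: cvgV; [rewrite mulf_neq0// invr_neq0|exact: h2].
  exact: (continuous_comp h (@exprn_continuous _ n.+3 _)).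
apply/cvgrPdist_le => d d0; rewrite G0 {y}; near=> y.
rewrite sub0r normrN; apply: (le_trans (G_le y)).
have y1 : `|y| < 1 by near: y; apply/nbhs_ballP; exists 1 => //= z; rewrite /ball /= sub0r normrN.
have yd : `|y| < d by near: y; apply/nbhs_ballP; exists d => //= z; rewrite /ball /= sub0r normrN.
have a1 : 0 <= alpha - 1 by case/andP: alpha12; lra.
have [->|z0] := eqVneq y 0; first by rewrite normr0 powR0 ?(ltW d0)// gt_eqF//; lra.
rewrite -(subrK 1 alpha) -powR_mulX1 ?normr_gt0//.
apply: (@le_trans _ _ (1 * `|y|)); last by rewrite mul1r ltW.
rewrite ler_wpM2r//; apply: (@le_trans _ _ (1 `^ (alpha - 1))); last by rewrite powR1.
by apply: ge0_ler_powR; rewrite ?nnegrE ?ler01// ltW.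
Unshelve. all: by end_near. Qed.

Let symbolE : symbol n.+2 alpha = periodized G.
Proof.
apply/funext => x; rewrite /symbol /periodized; congr (limn (series _)).
apply/funext => l; rewrite /symbol_term /periodized_term /G; congr (_ * _ + _ * _).
- congr (_ ^+ _); have -> : (x + 2 * l%:R * pi) / 2 = x / 2 + l%:R * pi by field.
  by [].
- by rewrite NegzE mulrNz mulrN mulNr.
- congr (_ ^+ _); have -> : (x - 2 * l.+1%:R * pi) / 2 = x / 2 + (Negz l)%:~R * pi.
    by rewrite NegzE mulrNz; field.
  by [].
Qed.

Lemma continuous_symbol : cont_on (- pi) pi (symbol n.+2 alpha).
Proof. by rewrite symbolE; exact: (continuous_periodized s0 cG GC decayG). Qed.

Lemma symbol_bounded : exists M, forall x, - pi <= x <= pi -> `|symbol n.+2 alpha x| <= M.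
Proof. by rewrite symbolE; exact: (periodized_bounded s0 GC decayG). Qed.

Lemma symbolN x : - pi <= x <= pi -> symbol n.+2 alpha (- x) = symbol n.+2 alpha x.
Proof. by rewrite symbolE; exact: (periodizedN s0 evenG GC decayG). Qed.

Lemma symbol_fourier (k : nat) :
  \int[mu]_(x in `[0, pi]) (symbol n.+2 alpha x * cos (k%:R * x)) =
  \int[mu]_(x in `]0, +oo[) (sine_pow (- 1 - (2 - alpha) - n%:R) n.+3 x * cos (x * k%:R)).
Proof.
rewrite symbolE (fourier_periodized s0 cG evenG GC decayG).
by apply: eq_Rintegral => x; rewrite inE /= in_itv /= andbT => x0; rewrite G_pos// mulrC (mulrC _ x) mulrC.
Qed.

End Symbol.

(** * Riemann-Liouville operators *)

Section FractionalIntegral.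
Variable R : realType.
Local Notation mu := (@lebesgue_measure R).

Lemma derive1_dvg (f : R -> R) (x : R) : ~ derivable f x 1 -> derive1 f x = 0.
Proof. by move=> nd; rewrite derive1E /derive dvgP. Qed.

Lemma is_derive_derive1 (f : R -> R) (x df : R) : is_derive x 1 f df -> derive1 f x = df.
Proof. by move=> H; rewrite derive1E; apply: (@derive_val _ _ _ _ _ _ _ H). Qed.

(* Both sides take the junk value 0 where [f] is not derivable. *)
Lemma derive1_affine (f : R -> R) (k c d x : R) : k != 0 -> c != 0 ->
  derive1 (fun z => k * f (c * z + d)) x = k * c * derive1 f (c * x + d).
Proof.
move=> k0 c0; have [df|nd] := pselect (derivable f (c * x + d) 1).
  have H : is_derive (c * x + d) 1 f (derive1 f (c * x + d)).
    by apply: DeriveDef => //; rewrite derive1E.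
  have := is_derive_cstM k (is_derive_comp_affine H).
  by move/is_derive_derive1 => ->; rewrite mulrA.
rewrite derive1_dvg; first by rewrite derive1_dvg// mulr0.
move=> dg; apply: nd.
set g := (fun z => k * f (c * z + d)) in dg.
have H : is_derive x 1 g (derive1 g x) by apply: DeriveDef => //; rewrite derive1E.
have fE : f = (fun y => k^-1 * g (c^-1 * y + (- d / c))).
  apply/funext => y; rewrite /g mulKf//; congr f.
  by rewrite mulrDr mulVKf// mulrC divfK// subrK.
have H2 : is_derive (c^-1 * (c * x + d) + (- d / c)) 1 g (derive1 g x).
  by have -> : c^-1 * (c * x + d) + (- d / c) = x; [field|exact: H].
rewrite fE; have := is_derive_cstM k^-1 (is_derive_comp_affine H2).
by move=> D; apply: (@ex_derive _ _ _ _ _ _ _ D).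
Qed.

Lemma derive1n2_affine (f : R -> R) (k c d x : R) : k != 0 -> c != 0 ->
  derive1n 2 (fun z => k * f (c * z + d)) x = k * c ^+ 2 * derive1n 2 f (c * x + d).
Proof.
move=> k0 c0; rewrite /derive1n /=.
have -> : derive1 (fun z => k * f (c * z + d)) = (fun z => (k * c) * derive1 f (c * z + d)).
  by apply/funext => z; rewrite derive1_affine.
by rewrite derive1_affine ?mulf_neq0// expr2 !mulrA.
Qed.

Lemma Rintegral_support (A B : set R) (f g : R -> R) :
  (forall x, A x -> ~ B x -> f x = 0) -> (forall x, B x -> ~ A x -> g x = 0) ->
  (forall x, A x -> B x -> f x = g x) ->
  \int[mu]_(x in A) f x = \int[mu]_(x in B) g x.
Proof.
move=> fA gB fg; rewrite Rintegral_mkcond [RHS]Rintegral_mkcond.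
apply: eq_Rintegral => x _; rewrite !patchE.
case: ifPn => [/set_mem Ax|/negP nA]; case: ifPn => [/set_mem Bx|/negP nB] //.
- exact: fg.
- by apply: fA => // /mem_set.
- by apply/esym/gB => // /mem_set.
Qed.

(** Boundedness is asked on left half lines only, so that truncated powers qualify along with
    splines. *)
Definition causal (g : R -> R) := [/\ forall t, t < 0 -> g t = 0, measurable_fun setT g &
  forall A, exists M, forall t, t <= A -> `|g t| <= M].

(* For causal [g] this is [\int_0^w (w - t)^(s - 1) g t dt] for every real [w]; the fixed domain
   of integration makes translations and dilations of [g] immediate. *)
Definition fracint (s : R) (g : R -> R) (w : R) :=
  \int[mu]_(t in `]0, +oo[) (t `^ (s - 1) * g (w - t)).

Lemma measurable_affine (c d : R) : measurable_fun setT (fun y : R => c * y + d).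
Proof.
apply: measurable_funD => //; apply: measurable_funM => //; exact: measurable_cst.
Qed.

Lemma measurable_comp_affine (g : R -> R) (c d : R) : measurable_fun setT g ->
  measurable_fun setT (fun y => g (c * y + d)).
Proof. by move=> mg; apply: measurableT_comp => //; exact: measurable_affine. Qed.

Section Fixed.
Variable s : R.
Hypothesis s01 : 0 < s < 1.

Let s0 : 0 < s. Proof. by case/andP: s01. Qed.
Let s1 : s - 1 != 0. Proof. by rewrite lt_eqF// subr_lt0; case/andP: s01. Qed.

Lemma integrable_fracint g w : causal g ->
  mu.-integrable `]0, +oo[ (EFin \o (fun t => t `^ (s - 1) * g (w - t))).
Proof.
move=> [g0 mg gb]; pose c := Num.max w 1.
have c0 : 0 < c by rewrite lt_max ltr01 orbT.
have [M gM] := gb w.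
have mI : measurable (`]0, c]%classic : set R) by [].
have mf (D : set R) : measurable_fun D (fun t => t `^ (s - 1) * g (w - t)).
  apply: (@measurable_funS _ _ _ _ setT) => //; apply: measurable_funM.
    exact: measurable_powR.
  have := measurable_comp_affine (-1) w mg.
  by under eq_fun do rewrite mulN1r addrC.
have M0 : 0 <= M by have := gM w (lexx _); apply: le_trans.
have e1 : -1 < s - 1 by have := s0; lra.
have I1 : mu.-integrable `]0, c] (EFin \o (fun t => t `^ (s - 1) * g (w - t))).
  have [ip _] := integral_powR_oc e1 c0.
  apply: (@le_integrable _ _ _ mu _ mI _ (EFin \o (fun x => M * x `^ (s - 1)))).
  - by apply/measurable_EFinP; exact: mf.
  - move=> x; rewrite /= in_itv /= => /andP[x0 _].
    rewrite lee_fin [leRHS]ger0_norm ?mulr_ge0 ?powR_ge0//.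
    rewrite normrM ger0_norm ?powR_ge0// mulrC ler_wpM2r ?powR_ge0//.
    by apply: gM; lra.
  - have := @integrableZl _ _ _ mu `]0, c] mI M _ ip; rewrite /comp.
    by under [X in _ -> mu.-integrable _ X]eq_fun do rewrite EFinM.
apply/integrable_mkcond => //; move/integrable_mkcond: I1 => /(_ mI).
congr (mu.-integrable _ _); apply/funext => t; rewrite !patchE.
have [tc|tc] := boolP (t \in `]0, c]%classic).
  rewrite ifT//; move: tc; rewrite !inE /= !in_itv /= andbT.
  by case/andP.
case: ifPn => // t0; rewrite /= g0 ?mulr0//.
move: t0; rewrite inE /= in_itv /= andbT => t0.
rewrite ltNge subr_ge0; apply/negP => tw; move/negP: tc; apply.
by rewrite inE /= in_itv /= t0 /= /c le_max tw.
Qed.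

Lemma left_integral g z : causal g ->
  \int[mu]_(y in `[0, z]) ((z - y) `^ (s - 1) * g y) = fracint s g z.
Proof.
move=> [g0 mg gb].
have N1 : -1 != 0 :> R by rewrite oppr_eq0 oner_neq0.
rewrite (@Rintegral_affine R (-1) z N1)//; last first.
  apply: (@measurable_funS _ _ _ _ setT) => //; apply: measurable_funM => //.
  have := @measurable_comp_affine (fun t => t `^ (s - 1)) (-1) z (measurable_powR _).
  by under eq_fun do rewrite mulN1r addrC.
rewrite normrN1 mul1r; apply: Rintegral_support => x; rewrite /= !in_itv /= ?andbT.
(* The point 0 lies in the closed range but not in []0, +oo[]; [powR0] makes the kernel vanish
   there, as [s - 1] is not 0. *)
- move=> /andP[h1 h2] h3; have -> : -1 * x + z = z - x by ring.
  have x0 : x = 0 by move/negP: h3; rewrite -leNgt; lra.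
  by rewrite x0 subr0 subrr powR0// mul0r.
- by move=> x0 h; rewrite g0 ?mulr0// ltNge; apply/negP => h2; apply: h; lra.
- by move=> _ _; congr (_ `^ _ * g _); ring.
Qed.

Lemma right_integral g z : causal (fun y => g (1 - y)) -> measurable_fun setT g ->
  \int[mu]_(y in `[z, 1]) ((y - z) `^ (s - 1) * g y) = fracint s (fun y => g (1 - y)) (1 - z).
Proof.
move=> [g0 _ gb] mg.
rewrite (@Rintegral_affine R 1 z (oner_neq0 _))//; last first.
  apply: (@measurable_funS _ _ _ _ setT) => //; apply: measurable_funM => //.
  have := @measurable_comp_affine (fun t => t `^ (s - 1)) 1 (- z) (measurable_powR _).
  by under eq_fun do rewrite mul1r.
rewrite normr1 mul1r; apply: Rintegral_support => x; rewrite /= !in_itv /= ?andbT.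
- move=> /andP[h1 h2] h3; have -> : 1 * x + z - z = x by ring.
  have x0 : x = 0 by move/negP: h3; rewrite -leNgt; lra.
  by rewrite x0 powR0// mul0r.
- by move=> x0 h; rewrite g0 ?mulr0// ltNge; apply/negP => h2; apply: h; lra.
- by move=> _ _; congr (_ `^ _ * g _); ring.
Qed.

Lemma causal_scale g (n m : R) : 0 < n -> 0 <= m -> causal g -> causal (fun y => g (n * y - m)).
Proof.
move=> n0 m0 [g0 mg gb]; split.
- by move=> t t0; apply: g0; rewrite ltrBlDr add0r (lt_le_trans _ m0)// pmulr_rlt0.
- exact: measurable_comp_affine.
- move=> A; have [M gM] := gb (n * A - m); exists M => t tA; apply: gM.
  by rewrite lerD2r ler_pM2l.
Qed.

Lemma fracint_scale g (n m z : R) : 0 < n -> 0 <= m -> causal g ->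
  fracint s (fun y => g (n * y - m)) z = n `^ (- s) * fracint s g (n * z - m).
Proof.
move=> n0 m0 cg; have [g0 mg gb] := cg.
rewrite /fracint (@Rintegral_affine R n 0 (lt0r_neq0 n0) _
  (fun t => t `^ (s - 1) * g (n * z - m - t)))//; last first.
  apply: (@measurable_funS _ _ _ _ setT) => //; apply: measurable_funM => //.
    have := measurable_comp_affine (-1) (n * z - m) mg.
  by under eq_fun do rewrite mulN1r addrC.
have -> : (fun x => n * x + 0) @^-1` `]0, +oo[%classic = `]0, +oo[%classic.
  by apply/seteqP; split=> x /=; rewrite !in_itv /= !andbT addr0 pmulr_rgt0.
rewrite gtr0_norm// mulrA powR_mulX1//.
have -> : \int[mu]_(x in `]0, +oo[) ((n * x + 0) `^ (s - 1) * g (n * z - m - (n * x + 0))) =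
   \int[mu]_(x in `]0, +oo[) (n `^ (s - 1) * (x `^ (s - 1) * g (n * (z - x) - m))).
  apply: eq_Rintegral => x; rewrite inE /= in_itv /= andbT => x0.
  by rewrite addr0 powRM ?ltW// mulrA; congr (_ * g _); ring.
have cg' : causal (fun y => g (n * y - m)).
  exact: causal_scale.
rewrite RintegralZl//; last exact: (integrable_fracint z cg').
rewrite mulrA -powRD ?(gt_eqF n0) ?implybT//.
by have -> : - s + 1 + (s - 1) = 0; [ring|rewrite powRr0 mul1r].
Qed.


Lemma derive1_eq0_left (f : R -> R) (w : R) : w < 0 -> (forall t, t < 0 -> f t = 0) ->
  derive1 f w = 0.
Proof.
move=> w0 f0; apply: is_derive_derive1.
apply: (@near_eq_is_derive _ _ _ (fun=> 0)).
near=> y; rewrite f0//; near: y; exact: lt_nbhsl.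
Unshelve. all: by end_near. Qed.

Lemma fracint_causal g w : causal g -> w <= 0 -> fracint s g w = 0.
Proof.
move=> [g0 _ _] w0; rewrite /fracint; transitivity (\int[mu]_(t in `]0, +oo[) (0 : R)); last first.
  by rewrite /Rintegral integral0.
by apply: eq_Rintegral => t; rewrite inE /= in_itv /= andbT => t0; rewrite g0 ?mulr0//; lra.
Qed.

Lemma derive1n2_fracint_causal g w : causal g -> w < 0 -> derive1n 2 (fracint s g) w = 0.
Proof.
move=> cg w0; rewrite /derive1n /=; apply: derive1_eq0_left => // t t0.
by apply: derive1_eq0_left => // u u0; apply: fracint_causal => //; exact: ltW.
Qed.

Section Tail.
Variables (V : R -> R) (L B : R).
Hypothesis L0 : 0 <= L.
Hypothesis cV : causal V.
Hypothesis VL : forall t, L < t -> V t = 0.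
Hypothesis VB : forall t, `|V t| <= B.

Let F e w := \int[mu]_(y in `[0, L]) ((w - y) `^ e * V y).

Let B0 : 0 <= B := le_trans (normr_ge0 _) (VB 0).

Let powR_le (e d x : R) : e <= 0 -> 0 < d -> d <= x -> x `^ e <= d `^ e.
Proof.
move=> e0 d0 dx; have x0 : 0 < x := lt_le_trans d0 dx.
have [e' eE] : exists e', e = - e' by exists (- e); rewrite opprK.
move: e0; rewrite eE oppr_le0 => e0; rewrite !powRN lef_pV2 ?posrE ?powR_gt0//.
by apply: ge0_ler_powR; rewrite ?nnegrE ?(ltW d0) ?(ltW x0).
Qed.

Let kernel_le (e d w y : R) : e <= 0 -> 0 < d -> L + d <= w -> y <= L ->
  `|(w - y) `^ e * V y| <= d `^ e * B.
Proof.
move=> e0 d0 dw yL; rewrite normrM ger0_norm ?powR_ge0//.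
by apply: ler_pM; rewrite ?powR_ge0//; apply: powR_le => //; lra.
Qed.

Let mL : measurable (`[0, L]%classic : set R). Proof. by []. Qed.

Let integrable_cst (c : R) : mu.-integrable `[0, L] (EFin \o cst c).
Proof. exact: cont_on_integrable (@cont_on_cst _ _ _ _). Qed.

Let integrable_kernel e w : e <= 0 -> L < w ->
  mu.-integrable `[0, L] (EFin \o (fun y => (w - y) `^ e * V y)).
Proof.
move=> e0 Lw; have d0 : 0 < w - L by rewrite subr_gt0.
apply: (@le_integrable _ _ _ mu _ mL _ (EFin \o cst ((w - L) `^ e * B))); last exact: integrable_cst.
  apply/measurable_EFinP; apply: (@measurable_funS _ _ _ _ setT) => //; apply: measurable_funM => //.
    have := @measurable_comp_affine (fun t => t `^ e) (-1) w (measurable_powR _).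
    by under eq_fun do rewrite mulN1r addrC.
  by case: cV.
move=> y; rewrite /= in_itv /= => /andP[_ yL]; rewrite lee_fin.
apply: le_trans (ler_norm _); apply: kernel_le => //; lra.
Qed.

(** For [w > L] the domain [[0, L]] no longer moves with [w] and the kernel stays away from its
    singularity. All smoothness comes from the kernel, so a merely bounded measurable [V] will
    do. *)
Let is_derive_kernel_integral (e w : R) : e <= 0 -> L < w ->
  is_derive w 1 (F e) (e * F (e - 1) w).
Proof.
move=> e0 Lw; pose d := (w - L) / 2.
have d0 : 0 < d by rewrite divr_gt0// subr_gt0.
have wI : `]L + d, w + 1[%classic w by rewrite /= in_itv /= /d; apply/andP; split; lra.
have e1 : e - 1 <= 0 by lra.
have I1 x : `]L + d, w + 1[%classic x ->
    mu.-integrable `[0, L] (EFin \o (fun y => (x - y) `^ e * V y)).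
  by rewrite /= in_itv /= => /andP[x1 _]; apply: integrable_kernel => //; lra.
have DD x y : `]L + d, w + 1[%classic x -> `[0, L]%classic y ->
    is_derive x 1 (fun x => (x - y) `^ e * V y) (e * ((x - y) `^ (e - 1) * V y)).
  rewrite /= !in_itv /= => /andP[x1 _] /andP[_ yL].
  have xy : 0 < x - y by lra.
  have := is_derive_cstM (V y) (is_derive_shift (is_derive1_powR e xy)).
  by under [X in is_derive _ _ X _ -> _]eq_fun do rewrite mulrC; rewrite mulrC mulrA.
pose K x y := (x - y) `^ e * V y.
have D1 x y : `]L + d, w + 1[%classic x -> `[0, L]%classic y -> derivable (K ^~ y) x 1.
  by move=> h1 h2; have := DD x y h1 h2 => D; apply: (@ex_derive _ _ _ _ _ _ _ D).
have DE x y : `]L + d, w + 1[%classic x -> `[0, L]%classic y ->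
    (@partial1of2 R _ K) x y = e * ((x - y) `^ (e - 1) * V y).
  by move=> h1 h2; rewrite partial1of2E; have := DD x y h1 h2 => D; apply: (@derive_val _ _ _ _ _ _ _ D).
pose G (y : R) := `|e| * (d `^ (e - 1) * B).
have G0 y : 0 <= G y by rewrite /G !mulr_ge0// powR_ge0.
have B1 x y : `]L + d, w + 1[%classic x -> `[0, L]%classic y ->
    `|(@partial1of2 R _ K) x y| <= G y.
  move=> h1 h2; rewrite DE// normrM ler_wpM2l//; apply: kernel_le => //.
    by move: h1; rewrite /= in_itv /= => /andP[/ltW].
  by move: h2; rewrite /= in_itv /= => /andP[].
have iG : mu.-integrable `[0, L] (EFin \o G) by exact: integrable_cst.
have Dv := @derivable_under_integral R _ _ mu K _ mL w _ _ wI I1 D1 G G0 iG B1.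
apply: DeriveDef => //; rewrite -derive1E.
rewrite (@differentiation_under_integral R _ _ mu K _ mL w _ _ wI I1 D1 G G0 iG B1).
rewrite /F -RintegralZl//; last exact: integrable_kernel.
by apply: eq_Rintegral => y; rewrite inE => yL; rewrite DE.
Qed.

Let fracintE w : L < w -> fracint s V w = F (s - 1) w.
Proof.
move=> Lw; rewrite -left_integral//; apply: Rintegral_support => x; rewrite /= !in_itv /=.
- by move=> /andP[x0 xw]; rewrite x0 /= => /negP; rewrite -ltNge => Lx; rewrite VL ?mulr0.
- by move=> /andP[x0 xL]; rewrite x0 /= => /negP; rewrite -ltNge => wx; lra.
- by [].
Qed.

(** After two derivatives the kernel is [(s - 1) (s - 2) (w - y)^(s - 3)]. As [w - L >= 1], the
    exponent may be weakened to -2, which is summable and free of [s]. *)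
Lemma derive1n2_fracint_tail w : L + 1 <= w ->
  `|derive1n 2 (fracint s V) w| <= 2 * B * L * (w - L) `^ (- 2).
Proof.
move=> Lw; have /andP[s0' s1'] := s01.
have L1 : L < w by lra.
have D1 t : L < t -> derive1 (fracint s V) t = (s - 1) * F (s - 1 - 1) t.
  move=> Lt; apply: is_derive_derive1.
  apply: (@near_eq_is_derive _ _ _ (F (s - 1))); last by apply: is_derive_kernel_integral => //; lra.
  by near=> y; rewrite fracintE//; near: y; exact: lt_nbhsr.
have -> : derive1n 2 (fracint s V) w = (s - 1) * ((s - 1 - 1) * F (s - 1 - 1 - 1) w).
  rewrite /derive1n /=; apply: is_derive_derive1.
  apply: (@near_eq_is_derive _ _ _ (fun t => (s - 1) * F (s - 1 - 1) t)); last first.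
    by apply: is_derive_cstM; apply: is_derive_kernel_integral => //; lra.
  by near=> y; rewrite D1//; near: y; exact: lt_nbhsr.
have e3 : s - 1 - 1 - 1 <= 0 by lra.
have FB : `|F (s - 1 - 1 - 1) w| <= (w - L) `^ (s - 1 - 1 - 1) * B * L.
  have H : `|F (s - 1 - 1 - 1) w| <= \int[mu]_(y in `[0, L]) `|(w - y) `^ (s - 1 - 1 - 1) * V y|.
    by apply: le_normr_Rintegral => //; exact: integrable_kernel.
  apply: (le_trans H).
  apply: (@le_trans _ _ (\int[mu]_(y in `[0, L]) (fun=> (w - L) `^ (s - 1 - 1 - 1) * B) y)).
    apply: le_Rintegral => //; [|exact: integrable_cst|].
      by have/integrable_norm := integrable_kernel e3 L1.
    move=> y; rewrite /= in_itv /= => /andP[_ yL]; apply: kernel_le => //; lra.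
  by rewrite Rint_cst// subr0.
rewrite mulrA normrM; apply: (@le_trans _ _ (2 * ((w - L) `^ (- 2) * B * L))); last first.
  by rewrite le_eqVlt; apply/orP; left; apply/eqP; ring.
apply: ler_pM => //.
  have -> : (s - 1) * (s - 1 - 1) = (1 - s) * (2 - s) by ring.
  rewrite ger0_norm; last by rewrite mulr_ge0//; lra.
  by rewrite -[leRHS]mul1r; apply: ler_pM; lra.
apply: (le_trans FB); rewrite -!mulrA ler_wpM2r ?mulr_ge0//.
by apply: ler_powR; lra.
Unshelve. all: by end_near. Qed.

End Tail.

End Fixed.
End FractionalIntegral.

(** * Fractional derivatives of truncated powers *)

Section TruncatedPowers.
Variable R : realType.
Local Notation mu := (@lebesgue_measure R).

(** The test is [0 <= y], so that [tpow 0] matches the half-open intervals of the B-splines of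
    degree 0. *)
Definition tpow (k : nat) (y : R) : R := if 0 <= y then y ^+ k else 0.

Lemma tpow_ge0 k y : 0 <= y -> tpow k y = y ^+ k.
Proof. by rewrite /tpow => ->. Qed.

Lemma tpow_lt0 k y : y < 0 -> tpow k y = 0.
Proof. by rewrite /tpow leNgt => ->. Qed.

Lemma causal_tpow k : causal (tpow k).
Proof.
split; first exact: tpow_lt0.
- apply: measurable_fun_if => //.
  + apply: (@measurable_fun_bool _ _ _ _ true) => /=.
    rewrite setTI; have -> : (fun y : R => 0 <= y) @^-1` [set true] = `[0, +oo[%classic.
      by apply/seteqP; split=> y /=; rewrite in_itv /= andbT.
    exact: measurable_itv.
- move=> A; exists (`|A| ^+ k) => t tA; rewrite /tpow; case: ifP => t0.
    rewrite normrX lerXn2r ?nnegrE//.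
    by rewrite ger0_norm// (le_trans tA)// ler_norm.
  by rewrite normr0 exprn_ge0.
Qed.

Lemma causal_nabla (g : R -> R) : causal g -> causal (nabla g).
Proof.
move=> [g0 mg gb]; split.
- by move=> t t0; rewrite /nabla !g0 ?subr0//; lra.
- apply: measurable_funB => //.
  by have := measurable_comp_affine 1 (-1) mg; under eq_fun do rewrite mul1r.
- move=> A; have [M gM] := gb A; exists (M + M) => t tA.
  by apply: (le_trans (ler_normB _ _)); apply: lerD; apply: gM; lra.
Qed.

Lemma causal_nablas m (g : R -> R) : causal g -> causal (nablas m g).
Proof. by move=> cg; elim: m => [//|m IH]; exact: causal_nabla. Qed.

(** Leibniz rule for multiplication by [y]; it carries the Cox-de Boor recursion over to differences
    of truncated powers. *)
Lemma nablas_idM m (g : R -> R) x : nablas m.+1 (fun y => y * g y) x =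
  (x - m.+1%:R) * nablas m.+1 g x + m.+1%:R * nablas m g x.
Proof.
elim: m x => [|m IH] x.
  by rewrite !nablasS /=; ring.
rewrite nablasS !IH [nablas m.+2 g x]nablasS.
rewrite ![nablas m.+1 g _]nablasS -!natr1.
by ring.
Qed.

Section Fixed.
Variable s : R.
Hypothesis s01 : 0 < s < 1.

Lemma fracint_nabla (g : R -> R) w : causal g -> fracint s (nabla g) w = nabla (fracint s g) w.
Proof.
move=> cg; rewrite /nabla /fracint -RintegralB//; try exact: integrable_fracint.
by apply: eq_Rintegral => t _; rewrite -mulrBr; congr (_ * (_ - g _)); ring.
Qed.

Lemma fracint_nablas m (g : R -> R) w : causal g ->
  fracint s (nablas m g) w = nablas m (fracint s g) w.
Proof.
move=> cg; elim: m w => [//|m IH] w.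
rewrite [RHS]/= /nabla -!IH; apply: fracint_nabla; exact: causal_nablas.
Qed.

Lemma fracintZ c (g : R -> R) w : causal g -> fracint s (fun y => c * g y) w = c * fracint s g w.
Proof.
move=> cg; rewrite /fracint -RintegralZl//; last exact: integrable_fracint.
by apply: eq_Rintegral => t _; ring.
Qed.

(** The Beta integral with one integer parameter, by induction from [(w - t)^(p + 1) = w (w - t)^p -
    t (w - t)^p]; the Gamma quotient appears as a rising factorial. *)
Lemma integral_beta (w : R) p (e : R) : 0 < w -> -1 < e ->
  mu.-integrable `]0, w] (EFin \o (fun t => t `^ e * (w - t) ^+ p)) /\
  \int[mu]_(t in `]0, w]) (t `^ e * (w - t) ^+ p) =
    p`!%:R / rising (e + 1) p.+1 * w `^ (e + 1 + p%:R).
Proof.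
move=> w0 e1.
have I q d : -1 < d -> mu.-integrable `]0, w] (EFin \o (fun t => t `^ d * (w - t) ^+ q)).
  move=> d1; have [ip _] := integral_powR_oc d1 w0.
  have mI : measurable (`]0, w]%classic : set R) by [].
  apply: (@le_integrable _ _ _ mu _ mI _ (EFin \o (fun x => w ^+ q * x `^ d))).
  - apply/measurable_EFinP; apply: (@measurable_funS _ _ _ _ setT) => //; apply: measurable_funM => //.
    by apply: measurable_funX; apply: measurable_funB.
  - move=> x; rewrite /= in_itv /= => /andP[x0 xw]; rewrite lee_fin.
    rewrite [leRHS]ger0_norm ?mulr_ge0 ?powR_ge0 ?exprn_ge0 ?(ltW w0)//.
    rewrite normrM ger0_norm ?powR_ge0// mulrC ler_wpM2r ?powR_ge0//.
    rewrite normrX lerXn2r ?nnegrE ?(ltW w0)// ger0_norm; lra.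
  - have := @integrableZl _ _ _ mu `]0, w] mI (w ^+ q) _ ip; rewrite /comp.
    by under [X in _ -> mu.-integrable _ X]eq_fun do rewrite EFinM.
split; first exact: I.
elim: p e e1 => [|p IH] e e1.
  under eq_Rintegral do rewrite expr0 mulr1.
  rewrite (integral_powR_oc e1 w0).2 /rising big_ord_recl big_ord0 /= !addr0 mulr1.
  by rewrite fact0 mulrC mul1r.
have e1' : -1 < e + 1 by lra.
have -> : \int[mu]_(t in `]0, w]) (t `^ e * (w - t) ^+ p.+1) =
    w * \int[mu]_(t in `]0, w]) (t `^ e * (w - t) ^+ p) -
    \int[mu]_(t in `]0, w]) (t `^ (e + 1) * (w - t) ^+ p).
  rewrite -RintegralZl//; last exact: I.
  rewrite -RintegralB//; first last.
  - exact: I.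
  - have := @integrableZl _ _ _ mu `]0, w] (measurable_itv _) w _ (I p e e1); rewrite /comp.
    by under [X in _ -> mu.-integrable _ X]eq_fun do rewrite EFinM.
  apply: eq_Rintegral => t; rewrite inE /= in_itv /= => /andP[t0 _].
  by rewrite -powR_mulX1// exprS; ring.
rewrite (IH e e1) (IH _ e1').
have ep : 0 < e + 1 by lra.
have rS : rising (e + 1) p.+2 = rising (e + 1) p.+1 * (e + 1 + p.+1%:R) by rewrite /rising big_ord_recr.
have rS2 : rising (e + 1) p.+2 = (e + 1) * rising (e + 1 + 1) p.+1.
  rewrite /rising big_ord_recl addr0; congr (_ * _); apply: eq_bigr => i _.
  by rewrite lift0 -natr1; ring.
have A0 := rising_gt0 p.+1 ep; have B0 := rising_gt0 p.+1 (addr_gt0 ep ltr01).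
have -> : e + 1 + p.+1%:R = e + 1 + p%:R + 1 by rewrite -natr1; ring.
have -> : e + 1 + 1 + p%:R = e + 1 + p%:R + 1 by ring.
rewrite -!powR_mulX1// factS natrM rS2.
move: rS; rewrite rS2 -natr1.
move: (rising (e + 1) p.+1) (rising (e + 1 + 1) p.+1) A0 B0 => A B A0 B0 AB.
have N0 : 0 <= p%:R :> R by [].
move: (p%:R : R) N0 AB => N N0 AB.
have AE : A = (e + 1) * B / (e + 1 + (N + 1)) by rewrite AB mulfK// gt_eqF//; lra.
rewrite AE; field.
by rewrite !gt_eqF//; lra.
Qed.

Lemma fracint_tpow p w :
  fracint s (tpow p) w = p`!%:R / rising s p.+1 * pospow (s + p%:R) w.
Proof.
have /andP[s0 s1] := s01.
rewrite /pospow; case: ltP => w0; last by rewrite mulr0; apply: fracint_causal => //; exact: causal_tpow.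
have e1 : -1 < s - 1 by lra.
have [_ E] := integral_beta p w0 e1; rewrite subrK in E; rewrite -E.
apply: Rintegral_support => t; rewrite /= !in_itv /= ?andbT.
- by move=> t0; rewrite t0 /= => /negP; rewrite -ltNge => wt; rewrite tpow_lt0 ?mulr0//; lra.
- by move=> /andP[t0 _] /negP; rewrite t0.
- by move=> t0 /andP[_ tw]; rewrite tpow_ge0//; lra.
Qed.

Definition rl (g : R -> R) (w : R) := (Gamma s)^-1 * derive1n 2 (fracint s g) w.

(** Fractional integration sends degree [n.+2] to exponent [s + n.+2]. Both derivatives then start
    from an exponent above 1, hence are valid at 0 too, and their factors shorten [rising s n.+3] to
    [rising s n.+1]. Here the spline degree is at least 2. *)
Lemma rl_spline n w (g : R -> R) : (forall y, g y = n.+2`!%:R^-1 * nablas n.+3 (tpow n.+2) y) ->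
  rl g w = (Gamma s * rising s n.+1)^-1 * nablas n.+3 (pospow (s + n%:R)) w.
Proof.
move=> gE; have /andP[s0 s1] := s01.
have -> : g = (fun y => n.+2`!%:R^-1 * nablas n.+3 (tpow n.+2) y) by apply/funext.
have ct := causal_tpow n.+2.
rewrite /rl; have -> : fracint s (fun y => n.+2`!%:R^-1 * nablas n.+3 (tpow n.+2) y) =
    (fun w => (rising s n.+3)^-1 * nablas n.+3 (pospow (s + n.+2%:R)) w).
  apply/funext => y; rewrite fracintZ ?fracint_nablas//; last exact: causal_nablas.
  rewrite (eq_nablas _ (fracint_tpow n.+2)) nablasZ mulrA mulrA mulVf ?mul1r//.
have n1 : 1 < s + n.+1%:R by rewrite ltr_pwDl// ler1n.
have n2 : 1 < s + n.+2%:R by rewrite ltr_pwDl// ler1n.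
have E1 : s + n.+2%:R - 1 = s + n.+1%:R by rewrite -[n.+2%:R]natr1; ring.
have E2 : s + n.+1%:R - 1 = s + n%:R by rewrite -[n.+1%:R]natr1; ring.
rewrite (_ : forall f, derive1n 2 f = derive1 (derive1 f))//.
have -> : derive1 (fun w => (rising s n.+3)^-1 * nablas n.+3 (pospow (s + n.+2%:R)) w) =
    (fun w => (rising s n.+3)^-1 * (s + n.+2%:R) * nablas n.+3 (pospow (s + n.+1%:R)) w).
  apply/funext => y; apply: is_derive_derive1.
  have d (z : R) := is_derive_pospow z n2.
  have := is_derive_cstM (rising s n.+3)^-1 (is_derive_nablas n.+3 d y).
  by rewrite nablasZ E1 mulrA.
have d (z : R) := is_derive_pospow z n1.
have := is_derive_cstM ((rising s n.+3)^-1 * (s + n.+2%:R)) (is_derive_nablas n.+3 d w).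
move/is_derive_derive1 => ->; rewrite nablasZ E2.
have -> : rising s n.+3 = rising s n.+1 * (s + n.+1%:R) * (s + n.+2%:R).
  by rewrite /rising big_ord_recr /= big_ord_recr.
have G0 : 0 < Gamma s by rewrite GammaE// ?ltW//; apply: gammaI_gt0; lra.
have r0 := rising_gt0 n.+1 s0.
move: (nablas _ _ w) (Gamma s) (rising s n.+1) G0 r0 => X G r G0 r0.
move: (s + n.+1%:R) (s + n.+2%:R) n1 n2 => a b a1 b1.
by field; rewrite !gt_eqF//; lra.
Qed.

Lemma rl_scale (g : R -> R) (n m z : R) : 0 < n -> 0 <= m -> causal g ->
  rl (fun y => g (n * y - m)) z = n `^ (2 - s) * rl g (n * z - m).
Proof.
move=> n0 m0 cg; rewrite /rl.
have -> : fracint s (fun y => g (n * y - m)) = (fun z => n `^ (- s) * fracint s g (n * z + - m)).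
  by apply/funext => y; apply: fracint_scale.
rewrite derive1n2_affine ?gt_eqF ?powR_gt0//.
have -> : n `^ (2 - s) = n `^ (- s) * n ^+ 2.
  by rewrite expr2 mulrA !powR_mulX1//; congr powR; ring.
by ring.
Qed.

Lemma RL_left_rl (g : R -> R) z : causal g -> RL_left (2 - s) g z = rl g z.
Proof.
move=> cg; rewrite /RL_left /rl; have -> : 2 - (2 - s) = s by ring.
have -> // : (fun z0 => \int[mu]_(y in `[0, z0]) ((z0 - y) `^ (1 - (2 - s)) * g y)) = fracint s g.
apply/funext => y; rewrite -(left_integral s01 y cg).
by apply: eq_Rintegral => t _; congr (_ `^ _ * _); ring.
Qed.

(** The sign of the reflection is squared by the second derivative. The identity persists where the
    derivative is a default value. *)
Lemma RL_right_rl (g : R -> R) z : causal (fun y => g (1 - y)) -> measurable_fun setT g ->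
  RL_right (2 - s) g z = rl (fun y => g (1 - y)) (1 - z).
Proof.
move=> cg mg; rewrite /RL_right /rl; have -> : 2 - (2 - s) = s by ring.
have -> : (fun z0 => \int[mu]_(y in `[z0, 1]) ((y - z0) `^ (1 - (2 - s)) * g y)) =
    (fun z => 1 * fracint s (fun y => g (1 - y)) (-1 * z + 1)).
  apply/funext => y; rewrite mul1r (_ : -1 * y + 1 = 1 - y); last by ring.
  rewrite -(right_integral s01 y cg mg).
  by apply: eq_Rintegral => t _; congr (_ `^ _ * _); ring.
rewrite derive1n2_affine ?oppr_eq0 ?oner_neq0// mul1r sqrrN expr1n mul1r.
by have -> : -1 * z + 1 = 1 - z by ring.
Qed.

End Fixed.
End TruncatedPowers.

(** * B-splines *)

Section Splines.
Variable R : realType.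
Local Notation mu := (@lebesgue_measure R).
Implicit Types (kappa : nat -> R) (x : R).

(** [bspline] over an arbitrary knot sequence, so that knots can be shifted, rescaled and compared
    with integers. *)
Fixpoint bs kappa (k i : nat) x {struct k} : R :=
  match k with
  | 0 => if (kappa i <= x) && (x < kappa i.+1) then 1 else 0
  | k'.+1 =>
      fracz (x - kappa i) (kappa (i + k)%N - kappa i) * bs kappa k' i x
      + fracz (kappa (i + k + 1)%N - x) (kappa (i + k + 1)%N - kappa i.+1) * bs kappa k' i.+1 x
  end.

Lemma bspline_bs p n k i x : bspline p n k i x = bs (knot R p n) k i x.
Proof. by elim: k i => [//|k IH] i; rewrite /= !IH. Qed.

Lemma bs_ext kappa kappa' k i x :
  (forall l, (i <= l <= i + k + 1)%N -> kappa l = kappa' l) -> bs kappa k i x = bs kappa' k i x.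
Proof.
elim: k i => [|k IH] i E /=.
  by rewrite !E// addn0 addn1 leqnn leqnSn.
rewrite !IH => [|l /andP[h1 h2]|l /andP[h1 h2]]; last 2 first.
- by apply: E; lia.
- by apply: E; lia.
by rewrite !E//; lia.
Qed.

Lemma bs_shift kappa k i j x : bs kappa k (i + j) x = bs (fun l => kappa (l + j)%N) k i x.
Proof.
elim: k i => [|k IH] i /=; first by rewrite addSn.
rewrite -addSn !IH; have -> : (i + j + k.+1 = i + k.+1 + j)%N by lia.
by have -> : (i + k.+1 + j + 1 = i + k.+1 + 1 + j)%N by lia.
Qed.

Lemma bs_affine kappa kappa' (c d : R) k i x : 0 < c ->
  (forall l, kappa' l = c * kappa l - d) -> bs kappa' k i (c * x - d) = bs kappa k i x.
Proof.
move=> c0 E; elim: k i => [|k IH] i /=.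
  by rewrite !E lerD2r ltrD2r ler_pM2l// ltr_pM2l.
have F (a b : R) : fracz (c * a) (c * b) = fracz a b.
  rewrite /fracz mulf_eq0 gt_eqF//=; case: eqVneq => // b0.
  by rewrite -mulf_div divff ?mul1r// gt_eqF.
rewrite !IH !E -(F (x - _)) -(F (_ - x)); congr (fracz _ _ * _ + fracz _ _ * _); ring.
Qed.

Section Monotone.
Variable kappa : nat -> R.
Hypothesis kappa_nd : forall l, kappa l <= kappa l.+1.

Let nd : {homo kappa : l l' / (l <= l')%N >-> l <= l'}.
Proof. by apply: homo_leq => // a b c; exact: le_trans. Qed.

Lemma bs_support k i x : ~~ (kappa i <= x < kappa (i + k).+1) -> bs kappa k i x = 0.
Proof.
elim: k i => [|k IH] i /= h; first by rewrite addn0 in h; rewrite (negbTE h).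
rewrite !IH ?mulr0 ?addr0//.
- apply: contra h => /andP[h1 h2]; apply/andP; split.
    exact: (le_trans (kappa_nd i)).
  by rewrite addnS -addSn.
- apply: contra h => /andP[h1 h2]; rewrite h1 (lt_le_trans h2)//.
  by apply: nd; lia.
Qed.

(** Where a lower-degree spline does not vanish, its weight lies in [[0, 1]]; the crude [2 ^+ k]
    does not depend on the knots, which is all that matters. *)
Lemma bs_norm_le k i x : `|bs kappa k i x| <= 2 ^+ k.
Proof.
elim: k i => [|k IH] i /=; first by case: ifP; rewrite ?normr1 ?normr0.
have F (a b : R) : 0 <= a <= b -> `|fracz a b| <= 1.
  move=> /andP[a0 ab]; rewrite /fracz; case: eqVneq => [_|b0]; first by rewrite normr0.
  have bp : 0 < b by rewrite lt_neqAle eq_sym b0 (le_trans a0).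
  by rewrite ger0_norm ?divr_ge0// ?(ltW bp)// ler_pdivrMr// mul1r.
rewrite exprS mulr2n mulrDl mul1r; apply: (le_trans (ler_normD _ _)); apply: lerD.
- have [/andP[h1 h2]|h] := boolP (kappa i <= x < kappa (i + k).+1); last first.
    by rewrite bs_support// mulr0 normr0 exprn_ge0.
  rewrite normrM -[leRHS]mul1r; apply: ler_pM => //; apply: F.
  by rewrite subr_ge0 h1 lerD2r addnS ltW.
- have [/andP[h1 h2]|h] := boolP (kappa i.+1 <= x < kappa (i.+1 + k).+1); last first.
    by rewrite bs_support// mulr0 normr0 exprn_ge0.
  rewrite normrM -[leRHS]mul1r; apply: ler_pM => //; apply: F.
  rewrite addSn -addnS in h2; rewrite addn1.
  by rewrite subr_ge0 (ltW h2) lerD2l lerN2.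
Qed.

End Monotone.

Lemma measurable_bs kappa k i : measurable_fun setT (bs kappa k i).
Proof.
elim: k i => [|k IH] i.
  have -> : bs kappa 0 i = \1_(`[kappa i, kappa i.+1[%classic : set R).
    apply/funext => x; rewrite /= indicE mem_setE in_itv /=.
    by case: (_ && _).
  by apply: measurable_indic; exact: measurable_itv.
have F (a b c d : R) : measurable_fun setT (fun x : R => fracz (c * x + d) b).
  rewrite /fracz; case: (b == 0); first exact: measurable_cst.
  by apply: measurable_funM => //; exact: measurable_affine.
have E : bs kappa k.+1 i = (fun x =>
   fracz (1 * x + - kappa i) (kappa (i + k.+1)%N - kappa i) * bs kappa k i x +
   fracz (- 1 * x + kappa (i + k.+1 + 1)%N) (kappa (i + k.+1 + 1)%N - kappa i.+1) * bs kappa k i.+1 x).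
  by apply/funext => x /=; rewrite mul1r mulN1r [- x + _]addrC.
by rewrite E; apply: measurable_funD; apply: measurable_funM => //; exact: F 0 _ _ _.
Qed.

Definition cardinal_spline (k : nat) x := bs (fun l => l%:R) k 0 x.

Lemma cardinal_spline_rec k x : cardinal_spline k.+1 x =
  (x * cardinal_spline k x + (k.+2%:R - x) * cardinal_spline k (x - 1)) / k.+1%:R.
Proof.
rewrite /cardinal_spline /=.
have -> : bs (fun l => l%:R) k 1 x = bs (fun l => l%:R) k 0 (x - 1).
  have E l : l%:R = 1 * (l + 1)%N%:R - 1 :> R by rewrite natrD mul1r addrK.
  have := bs_affine k 0 x ltr01 E; rewrite mul1r => ->.
  exact: (bs_shift _ k 0 1).
have k1 : k.+1%:R != 0 :> R by rewrite pnatr_eq0.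
rewrite /fracz add0n !subr0 addn1 -[k.+2%:R]natr1 addrK (negbTE k1).
by move: (k.+1%:R : R) k1 => a a0; field.
Qed.

Lemma cardinal_spline_nablas k x : cardinal_spline k x = k`!%:R^-1 * nablas k.+1 (tpow k) x.
Proof.
elim: k x => [|k IH] x.
  rewrite fact0 invr1 mul1r /= /nabla /tpow /cardinal_spline /= subr_ge0.
  case: (leP 0 x) => x0; case: (leP 1 x) => x1; rewrite ?expr0 ?subrr ?subr0//=.
  lra.
rewrite cardinal_spline_rec !IH.
have -> : nablas k.+2 (tpow k.+1) x =
    (x - k.+2%:R) * nablas k.+2 (tpow k) x + k.+2%:R * nablas k.+1 (tpow k) x.
  rewrite -nablas_idM; apply: eq_nablas => y; rewrite /tpow.
  by case: ifP => _; rewrite ?mulr0// exprS.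
rewrite [nablas k.+2 (tpow k) x]nablasS factS natrM.
have k1 : k.+1%:R != 0 :> R by rewrite pnatr_eq0.
have f1 : k`!%:R != 0 :> R by rewrite pnatr_eq0 -lt0n fact_gt0.
move: (nablas k.+1 (tpow k) x) (nablas k.+1 (tpow k) (x - 1)) => D D'.
move: (k`!%:R : R) (k.+1%:R : R) (k.+2%:R : R) k1 f1 => f a b a0 f0.
by field; rewrite ?a0 ?f0.
Qed.

(** The induction starts in degree 1, since the half-open interval of degree 0 is not symmetric;
    there [tpow 1 y = (|y| + y) / 2] exhibits the symmetry. *)
Lemma cardinal_spline_sym k x : cardinal_spline k.+1 (k.+2%:R - x) = cardinal_spline k.+1 x.
Proof.
elim: k x => [|k IH] x.
  rewrite !cardinal_spline_nablas (_ : 1`! = 1)%N// invr1 !mul1r /= /nabla.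
  have T y : tpow 1 y = (`|y| + y) / 2 :> R.
    by rewrite /tpow expr1; case: ger0P => _; field.
  rewrite !T.
  have -> : 2 - x - 1 = - (x - 1) by ring.
  have -> : - (x - 1) - 1 = - x by ring.
  have -> : 2 - x = - (x - 1 - 1) by ring.
  by rewrite !normrN; field.
rewrite [LHS]cardinal_spline_rec [RHS]cardinal_spline_rec.
have -> : k.+3%:R - x = k.+2%:R - (x - 1) by rewrite -[k.+3%:R]natr1; ring.
have -> : k.+2%:R - (x - 1) - 1 = k.+2%:R - x by ring.
rewrite !IH; congr (_ / _); rewrite -[k.+3%:R]natr1; ring.
Qed.

End Splines.

(** * Integer knots and Greville points *)

Section Knots.
Implicit Types p n i j l : nat.

(** [n] times the knot: truncated subtraction repeats the knot 0, the minimum repeats the last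
    one. *)
Definition kn p n i := minn (i - p.+1) n.

Lemma kn_mono p n i j : (i <= j)%N -> (kn p n i <= kn p n j)%N.
Proof. by rewrite /kn; lia. Qed.

Lemma kn_step p n i l : (kn p n (i + l) - kn p n i <= l)%N.
Proof. by rewrite /kn; lia. Qed.

(** [p * n] times the Greville point; being a natural number, it places the rescaled point on the
    grid of multiples of [1 / p]. *)
Definition greville_num p n i := (\sum_(1 <= k < p.+1) kn p n (i + k))%N.

Lemma leq_sum_nat m n (F G : nat -> nat) : (forall k, (m <= k < n)%N -> (F k <= G k)%N) ->
  (\sum_(m <= k < n) F k <= \sum_(m <= k < n) G k)%N.
Proof.
move=> FG; rewrite big_nat_cond [leqRHS]big_nat_cond.
by apply: leq_sum => k; rewrite andbT; exact: FG.
Qed.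

Lemma greville_num_bounds p n i : (i <= n + p)%N ->
  (p * i <= greville_num p n i + p * p /\ greville_num p n i <= p * i)%N.
Proof.
move=> inp; have cst c : (\sum_(1 <= k < p.+1) c = p * c)%N by rewrite sum_nat_const_nat subn1.
split; last first.
  by rewrite -[leqRHS]cst; apply: leq_sum_nat => k /andP[k1 kp]; rewrite /kn; lia.
rewrite /greville_num -[leqLHS]cst -[X in (_ <= _ + X)%N]cst -big_split /=.
by apply: leq_sum_nat => k /andP[k1 kp]; rewrite /kn; lia.
Qed.

Lemma greville_num_central p n i : (p <= i)%N -> (i <= n.+1)%N ->
  (2 * greville_num p n i + p * p.+1 = 2 * (p * i))%N.
Proof.
move=> pi ni; have cst c : (\sum_(1 <= k < p.+1) c = p * c)%N by rewrite sum_nat_const_nat subn1.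
have E : (greville_num p n i + p * p.+1 = p * i + \sum_(1 <= k < p.+1) k)%N.
  rewrite /greville_num -(cst p.+1) -(cst i) -!big_split /=.
  by apply: eq_big_nat => k /andP[k1 kp]; rewrite /kn; lia.
have E2 q : (2 * \sum_(1 <= k < q.+1) k = q * q.+1)%N.
  elim: q => [|q IH]; first by rewrite big_geq.
  by rewrite big_nat_recr//= mulnDr IH; lia.
by have := E2 p; lia.
Qed.

End Knots.

(** * Knot patterns and uniform entry bounds *)

Section Shapes.
Variable R : realType.
Variable p : nat.

Lemma knotE n i : (0 < n)%N -> knot R p n i = (kn p n i)%:R / n%:R.
Proof.
move=> n0; have nR : n%:R != 0 :> R by rewrite pnatr_eq0 -lt0n.
rewrite /knot; case: ifP => h1.
  by have -> : kn p n i = 0%N; [rewrite /kn; lia|rewrite mul0r].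
case: ifP => h2; first by congr (_%:R / _); rewrite /kn; lia.
by have -> : kn p n i = n; [rewrite /kn; lia|rewrite divff].
Qed.

Lemma grevilleE n i : (0 < n)%N -> n%:R * greville R p n i = (greville_num p n i)%:R / p%:R.
Proof.
move=> n0; have nR : n%:R != 0 :> R by rewrite pnatr_eq0 -lt0n.
rewrite /greville mulrA mulr_sumr /greville_num natr_sum; congr (_ / _).
by apply: eq_bigr => k _; rewrite knotE// mulrC divfK.
Qed.

Let shape : finType := {ffun 'I_p.+2 -> 'I_p.+2}.

(* Only finitely many knot patterns occur, and the left and right derivatives are sampled on
   the grid [Z/p]: near the support this bounds them uniformly in [n] without any regularity
   analysis (some of the derivatives are junk values).  The [minn] keeps the knots monotone
   beyond the last one. *)
Definition shape_knot (sigma : shape) (l : nat) : nat := sigma (inord (minn l p.+1)).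

Definition shape_spline (sigma : shape) : R -> R := bs (fun l => (shape_knot sigma l)%:R) p 0.

(** The spline read backwards from its last knot: its left derivatives are the right derivatives of
    the shape. *)
Definition shape_spline_rev (sigma : shape) (t : R) : R :=
  shape_spline sigma ((shape_knot sigma p.+1)%:R - t).

Definition valid_shape (sigma : shape) := shape_knot sigma 0 = 0%N /\
  forall l, (shape_knot sigma l <= shape_knot sigma l.+1)%N.

Section Valid.
Variable sigma : shape.
Hypothesis vs : valid_shape sigma.

Let nd l : (shape_knot sigma l)%:R <= (shape_knot sigma l.+1)%:R :> R.
Proof. by rewrite ler_nat; case: vs. Qed.

Let last_le : (shape_knot sigma p.+1)%:R <= p.+1%:R :> R.
Proof. by rewrite ler_nat -ltnS /shape_knot. Qed.

Let supp t : ~~ (0 <= t < (shape_knot sigma p.+1)%:R) -> shape_spline sigma t = 0.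
Proof.
move=> h; apply: bs_support => //; case: vs => -> _; rewrite add0n //.
Qed.

Lemma shape_spline_le t : `|shape_spline sigma t| <= 2 ^+ p.
Proof. exact: bs_norm_le. Qed.

Lemma shape_spline_right t : p.+1%:R < t -> shape_spline sigma t = 0.
Proof. by move=> pt; apply: supp; rewrite negb_and -!ltNge; apply/orP; right; rewrite -leNgt (le_trans last_le)// ltW. Qed.

Lemma causal_shape_spline : causal (shape_spline sigma).
Proof.
split; [|exact: measurable_bs|by move=> A; exists (2 ^+ p) => t _; exact: shape_spline_le].
by move=> t t0; apply: supp; rewrite negb_and -ltNge t0.
Qed.

Lemma causal_shape_spline_rev : causal (shape_spline_rev sigma).
Proof.
split; [| |by move=> A; exists (2 ^+ p) => t _; exact: shape_spline_le].
  move=> t t0; apply: supp; rewrite negb_and; apply/orP; right.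
  by rewrite -leNgt lerDl oppr_ge0 ltW.
have := measurable_comp_affine (-1) ((shape_knot sigma p.+1)%:R : R) (measurable_bs (fun l => (shape_knot sigma l)%:R : R) p 0).
by under eq_fun do rewrite mulN1r addrC.
Qed.

Lemma shape_spline_rev_right t : p.+1%:R < t -> shape_spline_rev sigma t = 0.
Proof.
by move=> pt; apply: supp; rewrite negb_and -ltNge; apply/orP; left; rewrite subr_lt0 (le_lt_trans last_le).
Qed.

End Valid.

(** By [kn_step] these differences are at most [p.+1], so [inord] does not alter them. *)
Definition shape_of (n j : nat) : shape := [ffun l : 'I_p.+2 => inord (kn p n (j + l) - kn p n j)].

Lemma shape_knot_of n j l : shape_knot (shape_of n j) l = (kn p n (j + minn l p.+1) - kn p n j)%N.
Proof.
have h : (inord (minn l p.+1) : 'I_p.+2) = minn l p.+1 :> nat by rewrite inordK// ltnS geq_minr.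
by rewrite /shape_knot ffunE h inordK// ltnS (leq_trans (kn_step _ _ _ _))// geq_minr.
Qed.

Lemma valid_shape_of n j : valid_shape (shape_of n j).
Proof.
split; first by rewrite shape_knot_of min0n addn0 subnn.
by move=> l; rewrite !shape_knot_of leq_sub2r// kn_mono//; lia.
Qed.

Lemma bspline_shape n j x : (0 < n)%N ->
  bspline p n p j x = shape_spline (shape_of n j) (n%:R * x - (kn p n j)%:R).
Proof.
move=> n0; have nR : 0 < n%:R :> R by rewrite ltr0n.
rewrite bspline_bs.
pose kappa' l : R := n%:R * knot R p n l - (kn p n j)%:R.
rewrite -(@bs_affine _ _ kappa' n%:R (kn p n j)%:R p j x nR)// -[j in bs _ _ j _]add0n bs_shift.
apply: bs_ext => l /andP[_ lp]; rewrite shape_knot_of (minn_idPl _); last by lia.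
rewrite natrB; last by apply: kn_mono; lia.
by rewrite /kappa' knotE// mulrC divfK ?gt_eqF// addnC.
Qed.

Lemma bspline_shape_rev n j x : (0 < n)%N ->
  bspline p n p j (1 - x) =
  shape_spline_rev (shape_of n j) (n%:R * x - (n - kn p n (j + p.+1))%:R).
Proof.
move=> n0; rewrite bspline_shape// /shape_spline_rev shape_knot_of minnn.
rewrite !natrB; [|by rewrite /kn geq_minr|by apply: kn_mono; lia].
by congr shape_spline; ring.
Qed.

Section Bounds.
Variable s : R.
Hypothesis s01 : 0 < s < 1.
Hypothesis p0 : (0 < p)%N.

Let pR : 0 < p%:R :> R. Proof. by rewrite ltr0n. Qed.

(** [p.+3] comes from [1 + w <= p.+3 (w - p.+1)] for [w >= p.+2], which trades the distance to the
    support for [1 + |w|]. *)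
Lemma rl_tail (V : R -> R) w : causal V -> (forall t, p.+1%:R < t -> V t = 0) ->
  (forall t, `|V t| <= 2 ^+ p) -> p.+2%:R <= w ->
  `|rl s V w| <= (Gamma s)^-1 * (2 * 2 ^+ p * p.+1%:R) * p.+3%:R ^+ 2 / (1 + `|w|) ^+ 2.
Proof.
move=> cV VL VB pw; have /andP[s0 s1] := s01.
have P2 : p.+2%:R = p.+1%:R + 1 :> R by rewrite -natr1.
have P3 : p.+3%:R = p.+1%:R + 2 :> R by rewrite -(addn2 p.+1) natrD.
have P0 : 1 <= p.+1%:R :> R by rewrite ler1n.
have G0 : 0 < (Gamma s)^-1 by rewrite invr_gt0 GammaE// ?ltW//; apply: gammaI_gt0; lra.
rewrite /rl normrM (gtr0_norm G0) -!mulrA ler_wpM2l ?(ltW G0)//.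
have h := derive1n2_fracint_tail s01 (ler0n R p.+1) cV VL VB (w := w).
rewrite -P2 in h; apply: (le_trans (h pw)); rewrite -!mulrA !ler_wpM2l ?exprn_ge0//.
have d0 : 0 < w - p.+1%:R by lra.
rewrite powRN powR_mulrn ?(ltW d0)// ger0_norm; last by lra.
rewrite [leRHS]mulrA -expr2 -exprVn -[((1 + w) ^+ 2)^-1]exprVn -exprMn lerXn2r ?nnegrE ?invr_ge0 ?(ltW d0)//.
  by rewrite divr_ge0//; lra.
rewrite ler_pdivlMr; last by lra.
rewrite mulrC ler_pdivrMr// P3 -subr_ge0.
rewrite (_ : _ - _ = (p.+1%:R + 1) * (w - p.+1%:R - 1)); last by ring.
by rewrite mulr_ge0//; lra.
Qed.

Lemma ler_sum_term (I : finType) (F : I -> R) i : (forall i, 0 <= F i) -> F i <= \sum_i F i.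
Proof. by move=> F0; rewrite (bigD1 i)//= lerDl; apply: sumr_ge0. Qed.

(** Three ranges: the value 0 for negative [w], the kernel tail from [p.+2] on, and in between
    finitely many grid points, where the sum of all values over all shapes is the bound. *)
Lemma rl_shape_bound : exists2 C, 0 <= C & forall sigma, valid_shape sigma -> forall w,
  (w < 0 \/ exists k : nat, w = k%:R / p%:R) ->
  `|rl s (shape_spline sigma) w| <= C / (1 + `|w|) ^+ 2 /\
  `|rl s (shape_spline_rev sigma) w| <= C / (1 + `|w|) ^+ 2.
Proof.
have /andP[s0 s1] := s01.
pose C1 := (Gamma s)^-1 * (2 * 2 ^+ p * p.+1%:R) * p.+3%:R ^+ 2.
have G0 : 0 < (Gamma s)^-1 by rewrite invr_gt0 GammaE// ?ltW//; apply: gammaI_gt0; lra.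
have C10 : 0 <= C1 by rewrite /C1 !mulr_ge0 ?exprn_ge0 ?(ltW G0).
pose T (sigma : shape) (k : nat) := `|rl s (shape_spline sigma) (k%:R / p%:R)| +
  `|rl s (shape_spline_rev sigma) (k%:R / p%:R)|.
pose M := \sum_(sigma : shape) \sum_(k < (p * p.+2).+1) T sigma k.
have T0 sigma k : 0 <= T sigma k by rewrite addr_ge0.
have M0 : 0 <= M by apply: sumr_ge0 => ? _; apply: sumr_ge0.
have TM sigma k : (k < (p * p.+2).+1)%N -> T sigma k <= M.
  move=> kp; apply: (@le_trans _ _ (\sum_(k < (p * p.+2).+1) T sigma k)).
    exact: (@ler_sum_term _ (fun k : 'I_(p * p.+2).+1 => T sigma k) (Ordinal kp)).
  apply: (@ler_sum_term _ (fun sigma => \sum_(k < (p * p.+2).+1) T sigma k) sigma) => ?.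
  by apply: sumr_ge0.
exists (C1 + M * p.+3%:R ^+ 2); first by rewrite addr_ge0// mulr_ge0 ?exprn_ge0.
move=> sigma vs w hw.
have q0 : 0 < (1 + `|w|) ^+ 2 by rewrite exprn_gt0// ltr_pwDl.
have [w0|w0] := ltP w 0.
  rewrite /rl !derive1n2_fracint_causal//; [|exact: causal_shape_spline_rev|exact: causal_shape_spline].
  by rewrite mulr0 normr0 divr_ge0 ?(ltW q0)// addr_ge0// mulr_ge0 ?exprn_ge0.
case: hw => [|[k wk]]; first by rewrite ltNge w0.
have [pw|wp] := leP p.+2%:R w.
  have W X : X <= C1 / (1 + `|w|) ^+ 2 -> X <= (C1 + M * p.+3%:R ^+ 2) / (1 + `|w|) ^+ 2.
    move=> h; apply: (le_trans h); rewrite ler_wpM2r ?invr_ge0 ?(ltW q0)//.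
    by rewrite lerDl mulr_ge0 ?exprn_ge0.
  split; apply: W; apply: rl_tail => //.
  - exact: causal_shape_spline.
  - exact: shape_spline_right.
  - by move=> t; exact: shape_spline_le.
  - exact: causal_shape_spline_rev.
  - exact: shape_spline_rev_right.
  - by move=> t; exact: shape_spline_le.
have kp : (k < (p * p.+2).+1)%N.
  rewrite ltnS -(ler_nat R) natrM mulrC -ler_pdivrMr// -wk; exact: ltW.
have W X : X <= T sigma k -> X <= (C1 + M * p.+3%:R ^+ 2) / (1 + `|w|) ^+ 2.
  move=> h; apply: (le_trans h); apply: (le_trans (TM _ _ kp)).
  rewrite ler_pdivlMr//; apply: (@le_trans _ _ (M * p.+3%:R ^+ 2)); last by rewrite lerDr.
  rewrite ler_wpM2l// lerXn2r ?nnegrE// ?addr_ge0// ger0_norm//.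
  by rewrite -[p.+3%:R]natr1 addrC lerD2r ltW.
split; apply: W; rewrite wk /T; [rewrite lerDl|rewrite lerDr]; exact: normr_ge0.
Qed.

Lemma RL_bspline n i j : (0 < n)%N ->
  RL_left (2 - s) (bspline p n p j) (greville R p n i) + RL_right (2 - s) (bspline p n p j) (greville R p n i) =
  n%:R `^ (2 - s) *
  (rl s (shape_spline (shape_of n j)) ((greville_num p n i)%:R / p%:R - (kn p n j)%:R) +
   rl s (shape_spline_rev (shape_of n j)) ((kn p n (j + p.+1))%:R - (greville_num p n i)%:R / p%:R)).
Proof.
move=> n0; have nR : 0 < n%:R :> R by rewrite ltr0n.
have E1 : bspline p n p j = (fun y => shape_spline (shape_of n j) (n%:R * y - (kn p n j)%:R)).
  by apply/funext => y; rewrite bspline_shape.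
have E2 : (fun y => bspline p n p j (1 - y)) =
    (fun y => shape_spline_rev (shape_of n j) (n%:R * y - (n - kn p n (j + p.+1))%:R)).
  by apply/funext => y; rewrite bspline_shape_rev.
have v := valid_shape_of n j.
have c1 := causal_scale nR (ler0n R (kn p n j)) (causal_shape_spline v).
have c2 := causal_scale nR (ler0n R (n - kn p n (j + p.+1))) (causal_shape_spline_rev v).
rewrite RL_right_rl//; last 2 first.
- by rewrite E2.
- by rewrite E1; case: c1.
rewrite E2 E1 (RL_left_rl s01 _ c1).
rewrite (rl_scale s01 _ nR (ler0n R _) (causal_shape_spline v)).
rewrite (rl_scale s01 _ nR (ler0n R _) (causal_shape_spline_rev v)).
have kn_le : (kn p n (j + p.+1) <= n)%N by rewrite /kn geq_minr.
rewrite -mulrDr mulrBr mulr1 (grevilleE i n0) (natrB _ kn_le).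
set gp := _ / _; set kR := (kn p n (j + p.+1))%:R.
have -> : n%:R - gp - (n%:R - kR) = kR - gp by ring.
reflexivity.
Qed.

Lemma colloc_matrix_rl n (i j : 'I_(n + p - 2)) : (0 < n)%N ->
  n%:R `^ (- (2 - s)) * colloc_matrix p (2 - s) n i j =
  (2 * cos (pi * (2 - s) / 2))^-1 *
  (rl s (shape_spline (shape_of n j.+2))
     ((greville_num p n i.+2)%:R / p%:R - (kn p n j.+2)%:R) +
   rl s (shape_spline_rev (shape_of n j.+2))
     ((kn p n (j.+2 + p.+1))%:R - (greville_num p n i.+2)%:R / p%:R)).
Proof.
move=> n0; have nR : n%:R != 0 :> R by rewrite pnatr_eq0 -lt0n.
rewrite /colloc_matrix mxE.
have E := RL_bspline i.+2 j.+2 n0.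
refine (etrans (congr1 (fun z => n%:R `^ (- (2 - s)) * ((2 * cos (pi * (2 - s) / 2))^-1 * z)) E) _).
move: (rl s _ _ + _) => X; move: ((2 * _)^-1) => c.
have e : n%:R `^ (- (2 - s)) * n%:R `^ (2 - s) = 1 :> R.
  by rewrite -powRD ?nR ?implybT// addNr powRr0.
transitivity (n%:R `^ (- (2 - s)) * n%:R `^ (2 - s) * (c * X)); first by ring.
by rewrite e mul1r.
Qed.

End Bounds.
End Shapes.

(** * The scaled collocation matrix *)

Section Entries.
Variable R : realType.
Local Notation mu := (@lebesgue_measure R).

Lemma dist_norm (i j : nat) : (dist i j)%:R = `|i%:R - j%:R| :> R.
Proof.
rewrite /dist; have [ij|ji] := leqP i j.
  by rewrite (eqP ij) add0n natrB// distrC ger0_norm// subr_ge0 ler_nat.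
by rewrite (eqP (ltnW ji)) addn0 natrB ?(ltnW ji)// ger0_norm// subr_ge0 ler_nat ltnW.
Qed.

Lemma distC (i j : nat) : dist i j = dist j i.
Proof. by rewrite /dist addnC. Qed.

Lemma index_le (n m : nat) (i : 'I_(n + m.+2 - 2)) : (i.+2 <= n + m.+2)%N.
Proof. by have := ltn_ord i; lia. Qed.

Lemma ler_inv_square (a b c : R) : 0 < a -> 0 < b -> b <= c * a -> a ^- 2 <= c ^+ 2 / b ^+ 2.
Proof.
move=> a0 b0 h; have c0 : 0 <= c.
  by rewrite -(pmulr_lge0 _ a0) (le_trans (ltW b0)).
rewrite ler_pdivlMr ?exprn_gt0// mulrC ler_pdivrMr ?exprn_gt0// -exprMn.
by rewrite lerXn2r ?nnegrE ?mulr_ge0// ltW.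
Qed.

Lemma sum_inv_square_dist (d i : nat) : (i < d)%N ->
  \sum_(j < d) (dist i j).+1%:R ^- 2 <= 4 :> R.
Proof.
move=> id_; rewrite -(big_mkord xpredT (fun j => (dist i j).+1%:R ^- 2)).
rewrite (@big_cat_nat _ _ _ i)//=; last exact: ltnW.
have -> : 4 = 2 + 2 :> R by ring.
have S N : \sum_(0 <= r < N) r.+1%:R ^- 2 <= 2 :> R.
  by have := sum_inv_square R (leq0n N); rewrite divr1.
apply: lerD.
- apply: le_trans (S i); rewrite big_nat_rev /= big_nat_cond [leRHS]big_nat_cond.
  apply: ler_sum => r /andP[/andP[_ ri] _].
  have rr : 0 < r.+1%:R ^+ 2 :> R by rewrite exprn_gt0.
  rewrite lef_pV2 ?posrE ?exprn_gt0// lerXn2r ?nnegrE// ler_nat ltnS /dist; lia.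
- apply: le_trans (S (d - i)%N); rewrite -{1}(add0n i) big_addn.
  apply: ler_sum => r _.
  rewrite lef_pV2 ?posrE ?exprn_gt0// lerXn2r ?nnegrE// ler_nat ltnS /dist; lia.
Qed.

Variable s : R.
Hypothesis s01 : 0 < s < 1.
Variable m : nat.
Local Notation p := m.+2.

Let pR : 0 < p%:R :> R. Proof. by rewrite ltr0n. Qed.

Let c0 : 0 < cos (pi * s / 2).
Proof.
have /andP[s0 s1] := s01; have pi0 := pi_gt0 R.
apply: cos_gt0_pihalf; apply/andP; split; last by rewrite ltr_pM2r// gtr_pMr.
by apply: (@lt_le_trans _ _ 0); [rewrite oppr_lt0 divr_gt0|rewrite divr_ge0// mulr_ge0// ltW].
Qed.

Let cosE : cos (pi * (2 - s) / 2) = - cos (pi * s / 2).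
Proof.
have -> : pi * (2 - s) / 2 = - (pi * s / 2) + pi by field.
by rewrite cosDpi cosN.
Qed.

Definition scaled_entry n (i j : 'I_(n + p - 2)) : R :=
  n%:R `^ (- (2 - s)) * colloc_matrix p (2 - s) n i j.

Definition left_arg n (i j : nat) : R := (greville_num p n i)%:R / p%:R - (kn p n j)%:R.
Definition right_arg n (i j : nat) : R := (kn p n (j + p.+1))%:R - (greville_num p n i)%:R / p%:R.

Lemma scaled_entryE n (i j : 'I_(n + p - 2)) : (0 < n)%N ->
  scaled_entry i j = - (2 * cos (pi * s / 2))^-1 *
   (rl s (shape_spline (shape_of p n j.+2)) (left_arg n i.+2 j.+2) +
    rl s (shape_spline_rev (shape_of p n j.+2)) (right_arg n i.+2 j.+2)).
Proof.
move=> n0; have := colloc_matrix_rl s01 i j n0.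
by rewrite cosE mulrN invrN.
Qed.

Lemma arg_bounds n (i j : nat) : (i <= n + p)%N -> (j <= n + p)%N ->
  `|i%:R - j%:R| <= `|left_arg n i j| + p.+1%:R /\
  `|i%:R - j%:R| <= `|right_arg n i j| + p.+1%:R.
Proof.
move=> inp jnp; have [g1 g2] := greville_num_bounds inp.
have k1 : (j <= kn p n j + p.+1)%N by rewrite /kn; lia.
have k2 : (kn p n j <= j)%N by rewrite /kn; lia.
have k3 : (j <= kn p n (j + p.+1) + p)%N by rewrite /kn; lia.
have k4 : (kn p n (j + p.+1) <= j)%N by rewrite /kn; lia.
rewrite -(ler_nat R) natrM natrD natrM in g1; rewrite -(ler_nat R) natrM in g2.
rewrite -(ler_nat R) natrD in k1; rewrite -(ler_nat R) in k2.
rewrite -(ler_nat R) natrD in k3; rewrite -(ler_nat R) in k4.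
have h1 : (greville_num p n i)%:R / p%:R <= i%:R :> R by rewrite ler_pdivrMr// mulrC.
have h2 : i%:R - p%:R <= (greville_num p n i)%:R / p%:R :> R.
  by rewrite ler_pdivlMr// mulrBl lerBlDr ![_ * p%:R]mulrC.
have P1 : p.+1%:R = p%:R + 1 :> R by rewrite -natr1.
rewrite P1 in k1 *; rewrite /left_arg /right_arg.
move: (_ / _) h1 h2 => g h1 h2; move: (i%:R : R) (j%:R : R) h1 h2 k1 k2 k3 k4 => I J.
move: ((kn p n j)%:R : R) ((kn p n (j + p.+1))%:R : R) => K K' h1 h2 k1 k2 k3 k4.
have q0 := pR; move: (p%:R : R) q0 h2 k1 k3 => P P0 h2 k1 k3.
have := ler_norm (g - K); have := ler_norm (- (g - K)).
have := ler_norm (K' - g); have := ler_norm (- (K' - g)); rewrite !normrN => a1 a2 a3 a4.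
by rewrite !ler_norml; split; apply/andP; split; lra.
Qed.

Lemma arg_grid n i j :
  (left_arg n i j < 0 \/ exists k : nat, left_arg n i j = k%:R / p%:R) /\
  (right_arg n i j < 0 \/ exists k : nat, right_arg n i j = k%:R / p%:R).
Proof.
have p1 : p%:R != 0 :> R by rewrite gt_eqF.
have L (a b : nat) : a%:R / p%:R - b%:R < 0 :> R \/ exists k : nat, a%:R / p%:R - b%:R = k%:R / p%:R :> R.
  have [ab|ba] := ltnP a (b * p); [left|right; exists (a - b * p)%N].
    by rewrite subr_lt0 ltr_pdivrMr// -natrM ltr_nat.
  by rewrite natrB// natrM mulrBl mulfK.
have L' (a b : nat) : b%:R - a%:R / p%:R < 0 :> R \/ exists k : nat, b%:R - a%:R / p%:R = k%:R / p%:R :> R.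
  have [ab|ba] := ltnP (b * p) a; [left|right; exists (b * p - a)%N].
    by rewrite subr_lt0 ltr_pdivlMr// -natrM ltr_nat.
  by rewrite natrB// natrM mulrBl mulfK.
by split; [exact: L|exact: L'].
Qed.

(** Both arguments differ from plus or minus [i - j] by at most [p.+1], so decay in the argument is
    decay away from the diagonal; [p.+2] comes from [dist i j + 1 <= p.+2 (1 + |w|)]. *)
Lemma scaled_entry_bound : exists2 K, 0 <= K & forall n (i j : 'I_(n + p - 2)), (0 < n)%N ->
  `|scaled_entry i j| <= K / (dist i j).+1%:R ^+ 2.
Proof.
have [C C0 HC] := rl_shape_bound s01 (ltn0Sn m.+1).
pose c := (2 * cos (pi * s / 2))^-1.
have c1 : 0 <= c by rewrite invr_ge0 mulr_ge0// ltW.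
exists (c * (C * p.+2%:R ^+ 2 + C * p.+2%:R ^+ 2)).
  by rewrite mulr_ge0// addr_ge0// mulr_ge0// exprn_ge0.
move=> n i j n0; rewrite scaled_entryE// mulNr normrN normrM (ger0_norm c1) -mulrA ler_wpM2l//.
have v := valid_shape_of p n j.+2.
have [g1 g2] := arg_grid n i.+2 j.+2.
have [b1 _] := HC _ v _ g1; have [_ b2] := HC _ v _ g2.
have ib := index_le i; have jb := index_le j.
have [d1 d2] := arg_bounds ib jb.
have dE : dist i j = dist i.+2 j.+2 by rewrite /dist !subSS.
have W (w X : R) : `|i.+2%:R - j.+2%:R| <= `|w| + p.+1%:R -> X <= C / (1 + `|w|) ^+ 2 ->
    X <= C * p.+2%:R ^+ 2 / (dist i j).+1%:R ^+ 2.
  move=> hw hX; apply: (le_trans hX); rewrite -mulrA ler_wpM2l//.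
  have w0 : 0 < 1 + `|w| by rewrite ltr_pwDl.
  have D0 : 0 < (dist i j).+1%:R :> R by [].
  apply: ler_inv_square => //.
  rewrite -natr1 dE dist_norm.
  have w1 := normr_ge0 w; have P0 : 0 <= p.+1%:R :> R by [].
  have -> : p.+2%:R = p.+1%:R + 1 :> R by rewrite -natr1.
  apply: (@le_trans _ _ (`|w| + p.+1%:R + 1)); first by rewrite lerD2r.
  rewrite -subr_ge0 (_ : _ - _ = p.+1%:R * `|w|); last by ring.
  exact: mulr_ge0.
apply: (le_trans (ler_normD _ _)); rewrite mulrDl; apply: lerD; [exact: W d1 b1|exact: W d2 b2].
Qed.

Definition fourier_coefficient (k : nat) : R :=
  pi^-1 * \int[mu]_(x in `]0, +oo[) (sine_pow (- 1 - s - m%:R) m.+3 x * cos (x * k%:R)).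

(** The range of [j] makes the integer knots of the spline consecutive, that of [i] those averaged
    by the Greville point. The two arguments are then symmetric about the centre [p.+1 / 2] of the
    support. *)
Lemma scaled_entry_central n (i j : 'I_(n + p - 2)) : (0 < n)%N ->
  (p <= i.+2 <= n.+1)%N -> (p.+1 <= j.+2 <= n)%N -> scaled_entry i j = fourier_coefficient (dist i j).
Proof.
move=> n0 /andP[i1 i2] /andP[j1 j2].
have sk l : (l <= p.+1)%N -> shape_knot (shape_of p n j.+2) l = l.
  by move=> lp; rewrite shape_knot_of (minn_idPl lp) /kn; lia.
have E1 t : shape_spline (shape_of p n j.+2) t = cardinal_spline p t :> R.
  by apply: bs_ext => l /andP[_ lp]; rewrite sk//; lia.
have E2 t : shape_spline_rev (shape_of p n j.+2) t = cardinal_spline p t :> R.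
  by rewrite /shape_spline_rev E1 sk// cardinal_spline_sym.
rewrite scaled_entryE//.
have -> : shape_spline (shape_of p n j.+2) = @cardinal_spline R p by apply/funext.
have -> : shape_spline_rev (shape_of p n j.+2) = @cardinal_spline R p by apply/funext.
have G := greville_num_central i1 i2.
have gE : (greville_num p n i.+2)%:R / p%:R = i.+2%:R - p.+1%:R / 2 :> R.
  have G' : 2%N%:R * (greville_num p n i.+2)%:R + p%:R * p.+1%:R = 2%N%:R * (p%:R * i.+2%:R) :> R.
    by rewrite -!natrM -natrD G.
  have p1 : p%:R != 0 :> R by rewrite gt_eqF.
  apply: (mulIf p1); rewrite divfK//; move: G'.
  move: (p%:R : R) (p.+1%:R : R) ((greville_num p n i.+2)%:R : R) (i.+2%:R : R) => P P1 g I G'.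
  have -> : (I - P1 / 2) * P = (2 * (P * I) - P * P1) / 2 by field.
  by rewrite -G'; field.
have k1 : (kn p n j.+2)%:R = j.+2%:R - p.+1%:R :> R.
  have -> : kn p n j.+2 = (j.+2 - p.+1)%N by rewrite /kn; lia.
  by rewrite natrB.
have k2 : kn p n (j.+2 + p.+1) = j.+2 by rewrite /kn; lia.
have ijE : i.+2%:R - j.+2%:R = i%:R - j%:R :> R.
  by rewrite -(addn2 i) -(addn2 j) !natrD; ring.
have -> : left_arg n i.+2 j.+2 = p.+1%:R / 2 + (i%:R - j%:R).
  by rewrite -ijE /left_arg gE k1; field.
have -> : right_arg n i.+2 j.+2 = p.+1%:R / 2 - (i%:R - j%:R).
  by rewrite -ijE /right_arg gE k2; ring.
have wE x := rl_spline s01 x (@cardinal_spline_nablas R p).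
rewrite (central_coefficient s01 _ wE) /fourier_coefficient.
rewrite mulrA mulrNN mulVf ?mul1r; last by rewrite mulf_neq0// gt_eqF.
by congr (_ * _); apply: eq_Rintegral => x _; rewrite mulrC (mulrC x) cos_dist (mulrC x) mulrC.
Qed.

(** The [k]-th coefficient occurs as a central entry of the matrix with [n = p + k + 1], at distance
    [k] from the diagonal, so the entry bound applies to it with the same [K]. *)
Lemma fourier_coefficient_bound : exists2 K, 0 <= K &
  (forall n (i j : 'I_(n + p - 2)), (0 < n)%N -> `|scaled_entry i j| <= K / (dist i j).+1%:R ^+ 2) /\
  (forall k, `|fourier_coefficient k| <= K / k.+1%:R ^+ 2).
Proof.
have [K K0 HK] := scaled_entry_bound; exists K => //; split=> // k.
have hi : (m.+1 + k < p + k + 1 + p - 2)%N by lia.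
have hj : (m.+1 < p + k + 1 + p - 2)%N by lia.
have n0 : (0 < p + k + 1)%N by lia.
have := HK _ (Ordinal hi) (Ordinal hj) n0.
rewrite scaled_entry_central//=; [|by apply/andP; split; lia|by apply/andP; split; lia].
by have -> : dist (m.+1 + k) m.+1 = k by rewrite /dist; lia.
Qed.

End Entries.

(** * Toeplitz structure up to the boundary, and conclusion *)

Section Assembly.
Variable R : realType.
Local Notation mu := (@lebesgue_measure R).

Lemma sum_ltn_index (d p : nat) : (\sum_(i < d) (i < p)%N <= p)%N.
Proof.
have -> : (\sum_(i < d) (i < p) = minn d p)%N; last exact: geq_minr.
elim: d => [|d IH]; first by rewrite big_ord0 min0n.
by rewrite big_ord_recr /= IH; lia.
Qed.

Lemma sum_end_index (d p : nat) : (\sum_(i < d) (d <= i + p)%N <= p)%N.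
Proof.
rewrite (reindex_inj rev_ord_inj) /=; apply: leq_trans (sum_ltn_index d p).
by apply: leq_sum => i _; have := ltn_ord i; lia.
Qed.

(** At most [2 p] indices lie near an end. A row or column of one of them contributes at most
    [2 K * 4], and rows and columns together give [2 * 2 p * 8 K]. *)
Lemma toeplitz_defect_sum (d p : nat) (B : 'I_d -> 'I_d -> R) (a : nat -> R) (K : R) : 0 <= K ->
  (forall i j, `|B i j| <= K / (dist i j).+1%:R ^+ 2) -> (forall k, `|a k| <= K / k.+1%:R ^+ 2) ->
  (forall i j : 'I_d, ~~ ((i < p) || (d <= i + p))%N -> ~~ ((j < p) || (d <= j + p))%N ->
     B i j = a (dist i j)) ->
  \sum_(i < d) \sum_(j < d) `|B i j - a (dist i j)| <= 32 * K * p%:R.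
Proof.
move=> K0 BK aK Ba.
pose bad (i : 'I_d) := ((i < p) + (d <= i + p))%N.
have badN : (\sum_(i < d) bad i <= 2 * p)%N.
  by rewrite /bad big_split /= mul2n -addnn; apply: leq_add; [exact: sum_ltn_index|exact: sum_end_index].
have row (i : 'I_d) : \sum_(j < d) (2 * K / (dist i j).+1%:R ^+ 2) <= 8 * K.
  rewrite -mulr_sumr; have := @sum_inv_square_dist R d i (ltn_ord i) => h.
  apply: (@le_trans _ _ (2 * K * 4)); first by rewrite ler_wpM2l ?mulr_ge0.
  by rewrite le_eqVlt; apply/orP; left; apply/eqP; ring.
have dK i j : `|B i j - a (dist i j)| <= 2 * K / (dist i j).+1%:R ^+ 2.
  apply: (le_trans (ler_normB _ _)); rewrite -mulrA mulr2n mulrDl mul1r.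
  by apply: lerD; [exact: BK|exact: aK].
have E i j : `|B i j - a (dist i j)| <=
    (bad i)%:R * (2 * K / (dist i j).+1%:R ^+ 2) + (bad j)%:R * (2 * K / (dist i j).+1%:R ^+ 2).
  have q0 : 0 <= 2 * K / (dist i j).+1%:R ^+ 2 by rewrite divr_ge0 ?mulr_ge0 ?exprn_ge0.
  have [bi|nbi] := boolP ((i < p) || (d <= i + p))%N; last first.
    have [bj|nbj] := boolP ((j < p) || (d <= j + p))%N; last first.
      by rewrite Ba// subrr normr0 addr_ge0// mulr_ge0.
    apply: (@le_trans _ _ (2 * K / (dist i j).+1%:R ^+ 2)).
      exact: dK.
    rewrite -[leLHS]add0r; apply: lerD; first by rewrite mulr_ge0.
    by rewrite ler_peMl// ler1n /bad; move: bj; do 2 case: (_ <= _)%N.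
  apply: (@le_trans _ _ (2 * K / (dist i j).+1%:R ^+ 2)).
    exact: dK.
  rewrite -[leLHS]addr0; apply: lerD; last by rewrite mulr_ge0.
  by rewrite ler_peMl// ler1n /bad; move: bi; do 2 case: (_ <= _)%N.
apply: (@le_trans _ _ (\sum_(i < d) \sum_(j < d) (bad i)%:R * (2 * K / (dist i j).+1%:R ^+ 2) +
   \sum_(i < d) \sum_(j < d) (bad j)%:R * (2 * K / (dist i j).+1%:R ^+ 2))).
  rewrite -big_split /=; apply: ler_sum => i _; rewrite -big_split /=.
  by apply: ler_sum => j _; exact: E.
have T : \sum_(i < d) \sum_(j < d) (bad i)%:R * (2 * K / (dist i j).+1%:R ^+ 2) <= 16 * K * p%:R.
  apply: (@le_trans _ _ (\sum_(i < d) (bad i)%:R * (8 * K))).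
    by apply: ler_sum => i _; rewrite -mulr_sumr ler_wpM2l.
  rewrite -mulr_suml -natr_sum.
  have : ((\sum_(i < d) bad i)%N%:R : R) <= (2 * p)%N%:R.
    by rewrite ler_nat.
  move=> h; apply: (@le_trans _ _ ((2 * p)%N%:R * (8 * K))); first by rewrite ler_wpM2r ?mulr_ge0.
  by rewrite natrM le_eqVlt; apply/orP; left; apply/eqP; ring.
have -> : 32 * K * p%:R = 16 * K * p%:R + 16 * K * p%:R by ring.
apply: lerD; first exact: T.
rewrite exchange_big /=; apply: le_trans T; apply: ler_sum => i _; apply: ler_sum => j _.
by rewrite distC.
Qed.

Lemma cvg_cst_div (d : nat -> nat) (c : R) : (forall n, (d n < d n.+1)%N) ->
  (d n)%:R^-1 * c @[n --> \oo] --> (0 : R).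
Proof.
move=> dS; have dn n : (n <= d n)%N by elim: n => // n IH; exact: leq_ltn_trans (dS n).
rewrite -(mul0r c); apply: cvgMl.
apply/cvgrPdist_le => e e0; near=> n.
have n0 : 0 < n%:R :> R by near: n; exact: nbhs_infty_gtr.
have ne : e^-1 <= n%:R by near: n; exact: nbhs_infty_ger.
have d0 : 0 < (d n)%:R :> R by rewrite (lt_le_trans n0)// ler_nat.
rewrite sub0r normrN gtr0_norm ?invr_gt0// -[e]invrK lef_pV2 ?posrE ?invr_gt0//.
by rewrite (le_trans ne)// ler_nat.
Unshelve. all: by end_near. Qed.

Lemma squeeze_cst_div (d : nat -> nat) (u : nat -> R) (c : R) : (forall n, (d n < d n.+1)%N) ->
  (forall n, (0 < n)%N -> 0 <= u n <= c) -> (d n)%:R^-1 * u n @[n --> \oo] --> (0 : R).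
Proof.
move=> dS uc; apply: (@squeeze_cvgr _ _ _ _ (fun=> 0) (fun n => (d n)%:R^-1 * c)).
- near=> n.
  have n0 : (0 < n)%N by near: n; exists 1%N.
  by have /andP[u0 u1] := uc n n0; rewrite mulr_ge0//= ler_wpM2l// invr_ge0.
- exact: cvg_cst.
- exact: cvg_cst_div.
Unshelve. all: by end_near. Qed.

(** The Toeplitz matrix is symmetric, so it drops out of [B i j - B j i]. One factor of the square
    is bounded by [2 K], the other by the defect, once for each order of the indices. *)
Lemma antisymmetric_part_sum (d : nat) (B : 'I_d -> 'I_d -> R) (a : nat -> R) (K c : R) : 0 <= K ->
  (forall i j, `|B i j| <= K) ->
  \sum_(i < d) \sum_(j < d) `|B i j - a (dist i j)| <= c ->
  \sum_(i < d) \sum_(j < d) (B i j - B j i) ^+ 2 <= 4 * K * c.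
Proof.
move=> K0 BK S.
have E i j : (B i j - B j i) ^+ 2 <= 2 * K * `|B i j - a (dist i j)| + 2 * K * `|B j i - a (dist j i)|.
  rewrite -[leLHS]ger0_norm ?sqr_ge0// expr2 normrM -mulrDr; apply: ler_pM => //.
    by have := ler_normB (B i j) (B j i); have := BK i j; have := BK j i; lra.
  have -> : B i j - B j i = (B i j - a (dist i j)) - (B j i - a (dist j i)).
    by rewrite (distC j i); ring.
  exact: ler_normB.
apply: (@le_trans _ _ (\sum_(i < d) \sum_(j < d) 2 * K * `|B i j - a (dist i j)| +
   \sum_(i < d) \sum_(j < d) 2 * K * `|B j i - a (dist j i)|)).
  by rewrite -big_split /=; apply: ler_sum => i _; rewrite -big_split /=; apply: ler_sum.
have P : \sum_(i < d) \sum_(j < d) 2 * K * `|B i j - a (dist i j)| =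
    2 * K * \sum_(i < d) \sum_(j < d) `|B i j - a (dist i j)|.
  by rewrite mulr_sumr; apply: eq_bigr => i _; rewrite mulr_sumr.
rewrite [X in _ + X]exchange_big /= P; move: (\sum_(i < d) _) S => T TC.
have -> : 2 * K * T + 2 * K * T = 4 * K * T by ring.
by rewrite ler_wpM2l ?mulr_ge0.
Qed.

Lemma collocation_distribution (s : R) (m : nat) : 0 < s < 1 ->
  spectral_distribution (d := fun n => (n + m.+2 - 2)%N)
    (fun n => (n%:R `^ (- (2 - s))) *: colloc_matrix m.+2 (2 - s) n)
    (symbol m.+2 (2 - s)) `[- pi, pi].
Proof.
move=> s01; have /andP[s0 s1] := s01; have pi0 := pi_gt0 R.
have al : 1 < 2 - s < 2 by apply/andP; split; lra.
pose a := fourier_coefficient s m.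
have [K K0 [BK aK]] := fourier_coefficient_bound s01 m.
have dS n : (n + m.+2 - 2 < n.+1 + m.+2 - 2)%N by lia.
have [Mf fMf] := symbol_bounded m al.
(* One bound for the symbol and for the column sums, which are at most [4 K]; the 1 makes it
   positive. *)
pose M := `|Mf| + 8 * K + 1.
have M0 : 0 < M by rewrite /M ltr_wpDl// addr_ge0// mulr_ge0.
have fM x : - pi <= x <= pi -> `|symbol m.+2 (2 - s) x| <= M.
  move=> xpi; apply: (le_trans (fMf x xpi)); apply: (le_trans (ler_norm _)).
  by rewrite /M -addrA lerDl addr_ge0// mulr_ge0.
have cf : cont_on (- pi) pi (symbol m.+2 (2 - s)) by exact: continuous_symbol.
pose B n := (n%:R `^ (- (2 - s))) *: colloc_matrix m.+2 (2 - s) n.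
have BE n i j : B n i j = scaled_entry (m := m) s i j by rewrite /B mxE.
have BKn n i j : (0 < n)%N -> `|B n i j| <= K / (dist i j).+1%:R ^+ 2 by move=> n0; rewrite BE; exact: BK.
(* [2 / N.+1] bounds a tail of inverse squares; the outer 2 is the one in the conclusion of
   [cosine_series]. *)
pose t N := 2 * (K * (2 / N.+1%:R)).
have tt : t N @[N --> \oo] --> (0 : R).
  rewrite /t -(mulr0 2); apply: cvgMr; rewrite -(mulr0 K); apply: cvgMr.
  by rewrite -(mulr0 2); apply: cvgMr; exact: cvg_harmonic.
have t0 N : 0 <= t N by rewrite /t !mulr_ge0.
have tail N N' : (N <= N')%N -> \sum_(N <= r < N') `|a r.+1| <= K * (2 / N.+1%:R).
  move=> NN; apply: (@le_trans _ _ (\sum_(N <= r < N') K * r.+1%:R ^- 2)).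
    apply: ler_sum => r _; apply: (le_trans (aK r.+1)); rewrite ler_wpM2l//.
    by rewrite lef_pV2 ?posrE ?exprn_gt0// lerXn2r ?nnegrE// ler_nat.
  by rewrite -mulr_sumr ler_wpM2l// sum_inv_square.
have tail2 N N' : (N <= N')%N -> \sum_(N <= r < N') `|a r.+1| <= t N.
  move=> NN; apply: (le_trans (tail _ _ NN)); rewrite /t.
  by rewrite ler_peMl ?mulr_ge0 ?ler1n.
have th : K * (2 / N.+1%:R) @[N --> \oo] --> (0 : R).
  rewrite -(mulr0 K); apply: cvgMr.
  by rewrite -(mulr0 2); apply: cvgMr; exact: cvg_harmonic.
have cf0 : cont_on 0 pi (symbol m.+2 (2 - s)).
  by move=> x /andP[x0 xp]; apply: cf; rewrite xp andbT; lra.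
have fc k : \int[mu]_(x in `[0, pi]) (symbol m.+2 (2 - s) x * cos (k%:R * x)) = pi * a k.
  rewrite symbol_fourier// /a /fourier_coefficient mulrA divff ?gt_eqF// mul1r.
  by have -> : 2 - (2 - s) = s by ring.
have ft0 := cosine_series cf0 th tail fc.
have ft N x : - pi <= x <= pi ->
    `|symbol m.+2 (2 - s) x - (a 0%N + \sum_(r < N) 2 * a r.+1 * cos (r.+1%:R * x))| <= t N.
  move=> /andP[x1 x2]; have [x0|x0] := leP 0 x; first by apply: ft0; rewrite x0.
  rewrite -symbolN//; last by rewrite x1.
  under eq_bigr do rewrite -cosN -mulrN.
  by apply: ft0; apply/andP; split; lra.
have defect n : (0 < n)%N ->
    0 <= \sum_(i < n + m.+2 - 2) \sum_(j < n + m.+2 - 2) `|B n i j - a (dist i j)| <= 32 * K * m.+2%:R.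
  move=> n0; apply/andP; split; first by apply: sumr_ge0 => i _; apply: sumr_ge0.
  apply: (@toeplitz_defect_sum _ m.+2 (fun i j => B n i j) a K K0) => // [i j|i j hi hj].
    exact: BKn.
  rewrite BE; apply: scaled_entry_central => //; move: hi hj; clear; move: (nat_of_ord i) (nat_of_ord j); lia.
have colsum : \forall n \near \oo, forall j, \sum_i `|B n i j| <= M.
  near=> n => j; have n0 : (0 < n)%N by near: n; exists 1%N.
  apply: (@le_trans _ _ (\sum_(i < n + m.+2 - 2) K * (dist j i).+1%:R ^- 2)).
    by apply: ler_sum => i _; rewrite distC; exact: BKn.
  rewrite -mulr_sumr; have h := @sum_inv_square_dist R _ j (ltn_ord j).
  apply: (@le_trans _ _ (K * 4)); first by rewrite ler_wpM2l.
  by rewrite /M; have := normr_ge0 Mf; lra.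
have sk := @squeeze_cst_div (fun n => (n + m.+2 - 2)%N).
apply: (@spectral_distribution_moments R _ B (symbol m.+2 (2 - s)) M) => //.
- apply: (@toeplitz_moments R a t (symbol m.+2 (2 - s)) M) => //.
  exact: sk dS defect.
- apply: (sk _ (4 * K * (32 * K * m.+2%:R))) => // n n0; apply/andP; split.
    by apply: sumr_ge0 => i _; apply: sumr_ge0 => j _; exact: sqr_ge0.
  have /andP[_ h] := defect n n0.
  apply: (@antisymmetric_part_sum _ (fun i j => B n i j) a K _ K0 _ h) => i j.
  apply: (le_trans (BKn n i j n0)); rewrite ler_pdivrMr ?exprn_gt0// ler_peMr//.
  by rewrite exprn_ege1// ler1n.
Unshelve. all: by end_near. Qed.

End Assembly.

Theorem theorem6p5 (R : realType) (alpha : R) (p : nat) :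
  1 < alpha < 2 -> (2 <= p)%N ->
  spectral_distribution (d := fun n => (n + p - 2)%N)
    (fun n => (n%:R `^ (- alpha)) *: colloc_matrix p alpha n)
    (symbol p alpha) `[- pi, pi].
Proof.
move=> /andP[a1 a2]; case: p => [//|[//|m]] _.
have s01 : 0 < 2 - alpha < 1 by apply/andP; split; lra.
have := collocation_distribution m s01.
by have -> : 2 - (2 - alpha) = alpha by ring.
Qed.
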